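(* Let $1<p<\infty$ and let $\mathscr{U}\subset\mathbb{C}^n$ be a monomial polyhedron. Then the operator $$(\bm{P}^{\mathscr{U}}_{p,1})^+f(z)=\int_{\mathscr{U}}\big|K^{\mathscr{U}}_{p,1}(z,w)\big|\,f(w)\,dV(w)$$ is bounded from $L^p(\mathscr{U})$ to itself.
   Context: $dV$ is Lebesgue measure. For $\alpha\in\mathbb{Z}^n$, $e_\alpha(z)=z_1^{\alpha_1}\cdots z_n^{\alpha_n}$ denotes the Laurent monomial. A monomial polyhedron is a bounded domain of the form $\mathscr{U}=\{z\in\mathbb{C}^n: e_{\alpha^j}(z)\text{ is defined and }|e_{\alpha^j}(z)|<1,\ 1\le j\le n\}$ for $n$ multi-indices $\alpha^1,\dots,\alpha^n\in\mathbb{Z}^n$ such that the integer matrix with rows $\alpha^1,\dots,\alpha^n$ has nonzero determinant (here $e_{\alpha^j}(z)$ is defined if $z_k\neq0$ whenever $\alpha^j_k<0$). For a domain $\Omega$, $A^p(\Omega)$ is the space of holomorphic functions $f$ on $\Omega$ with $\|f\|_p^p=\int_\Omega|f|^p\,dV<\infty$, and $\mathcal{S}_p(\Omega)=\{\alpha\in\mathbb{Z}^n: e_\alpha\in A^p(\Omega)\}$. The Monomial Basis Kernel of $A^p(\Omega)$ is $$K^{\Omega}_{p,1}(z,w)=\sum_{\alpha\in\mathcal{S}_p(\Omega)}\frac{e_\alpha(z)\,\overline{e_\alpha(w)}\,|e_\alpha(w)|^{p-2}}{\|e_\alpha\|_p^p},\qquad z,w\in\Omega.$$ *)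

(* Defs.v *)
From HB Require Import structures.
From mathcomp Require Import all_boot all_order all_algebra.
From mathcomp Require Import all_classical all_reals all_analysis.
From mathcomp Require Import complex.

Set Implicit Arguments.
Unset Strict Implicit.
Unset Printing Implicit Defensive.

Import Order.TTheory GRing.Theory Num.Theory.
Import numFieldNormedType.Exports.
Local Open Scope classical_set_scope.
Local Open Scope ring_scope.

Section monomial_polyhedra.
Variable R : realType.

(* A point of C^n is an n-tuple of pairs (x_k, y_k) of reals, z_k = x_k + i y_k.
   n.-tuple (R * R) carries the product (= Borel) sigma-algebra of R^(2n). *)
Definition Cn (n : nat) := n.-tuple (R * R)%type.

Definition coord (n : nat) (z : Cn n) (k : 'I_n) : R[i] :=
  ((tnth z k).1 +i* (tnth z k).2)%C.

Definition cabs (u : R[i]) : R := Num.sqrt (complex.Re u ^+ 2 + complex.Im u ^+ 2).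

(* Lebesgue integral over C^n = R^(2n) of a nonnegative function, written as the
   iterated integral w.r.t. one-dimensional Lebesgue measure in x_1, y_1, ..., x_n, y_n
   (for nonnegative measurable functions this is the Lebesgue integral, by Tonelli). *)
Fixpoint intCn (n : nat) : (Cn n -> \bar R) -> \bar R :=
  match n return (Cn n -> \bar R) -> \bar R with
  | 0 => fun f => f [tuple]
  | m.+1 => fun f =>
      (\int[@lebesgue_measure R]_x \int[@lebesgue_measure R]_y
          intCn (fun t : Cn m => f [tuple of (x, y) :: t]))%E
  end.

Definition intOn (n : nat) (D : set (Cn n)) (f : Cn n -> \bar R) : \bar R :=
  intCn (fun z => if `[< D z >] then f z else 0%E).

Definition mono (n : nat) (a : 'rV[int]_n) (z : Cn n) : R[i] :=
  \prod_(k < n) (coord z k) ^ (a ord0 k).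

Definition mono_defined (n : nat) (a : 'rV[int]_n) (z : Cn n) : Prop :=
  forall k : 'I_n, a ord0 k < 0 -> coord z k != 0.

Definition mpoly_set (n : nat) (A : 'M[int]_n) : set (Cn n) :=
  [set z | forall j : 'I_n, mono_defined (row j A) z /\ cabs (mono (row j A) z) < 1].

Definition bounded_set (n : nat) (D : set (Cn n)) : Prop :=
  exists M : R, forall z, D z -> forall k : 'I_n, cabs (coord z k) <= M.

Definition monomial_polyhedron (n : nat) (A : 'M[int]_n) : Prop :=
  \det A != 0 /\ bounded_set (mpoly_set A).

(* S_p(D) = { alpha in Z^n : e_alpha in A^p(D) }: e_alpha is defined (hence
   holomorphic) on all of D and int_D |e_alpha|^p dV < oo *)
Definition Sp (n : nat) (p : R) (D : set (Cn n)) (a : 'rV[int]_n) : Prop :=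
  (forall z, D z -> mono_defined a z) /\
  (intOn D (fun z => ((cabs (mono a z)) `^ p)%:E) < +oo)%E.

Definition normpp (n : nat) (p : R) (D : set (Cn n)) (a : 'rV[int]_n) : R :=
  fine (intOn D (fun z => ((cabs (mono a z)) `^ p)%:E)).

Definition mbk_term (n : nat) (p : R) (D : set (Cn n)) (a : 'rV[int]_n)
  (z w : Cn n) : R[i] :=
  mono a z * (mono a w)^* * (((cabs (mono a w)) `^ (p - 2))%:C)%C / ((normpp p D a)%:C)%C.

Definition box_index (n N : nat) (t : n.-tuple 'I_(N + N).+1) : 'rV[int]_n :=
  \row_k ((tnth t k : nat)%:Z - N%:Z).

Definition mbk_partial (n : nat) (p : R) (D : set (Cn n)) (z w : Cn n) (N : nat)
  : R[i] :=
  \sum_(t : n.-tuple 'I_(N + N).+1 | `[< Sp p D (box_index t) >])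
     mbk_term p D (box_index t) z w.

Definition mbk (n : nat) (p : R) (D : set (Cn n)) (z w : Cn n) : R[i] :=
  ((limn (fun N => complex.Re (mbk_partial p D z w N)))
   +i* (limn (fun N => complex.Im (mbk_partial p D z w N))))%C.

End monomial_polyhedra.

(* Main.v *)
(* Put [zeta_j = e_(alpha^j)(z)] and [t_j = - ln |zeta_j|]. In the coordinates [t] and the
   arguments of [z], Lebesgue measure is [exp (- 2 <gamma, t>)] times Haar measure, and
   the polyhedron is the set where all [t_j] are positive. A monomial [e_a] thus has norm
   [||e_a||_p^p = kap * \prod_j (p beta_j(a) + 2 gamma_j)^-1], where [a = beta(a) A], and
   lies in A^p exactly when all these factors are positive. So S_p is a finite disjoint
   union of translates [r + N^n A], on each of which the kernel is a product over [j] of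
   arithmetic-geometric series [\sum_m (c_j + p m) X_j^m], bounded by [C / |1 - X_j|^2],
   where [|X_j| = exp (- t_j(z) - (p - 1) t_j(w))].

   The rotations of the torus act transitively on the arguments of the [X_j], and the
   average of [1 / |1 - X|^2] over the argument of [X] is at most [1 / (1 - |X|)], by
   Parseval over roots of unity and Fatou's lemma. With [|X| = exp (- u)] this is at most
   [1 + 1 / u], so each variable contributes a Hilbert-type kernel [1 / (s + t)] times
   exponentials, and Schur's test applies with powers of the weight
   [\prod_j exp (2 gamma_j t_j) / t_j]. *)

Require Import Defs.
From HB Require Import structures.
From mathcomp Require Import all_boot all_order all_algebra.
From mathcomp Require Import all_classical all_reals all_analysis.
From mathcomp Require Import measurable_realfun complex.
From mathcomp Require Import cyclic separable cyclotomic.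
From mathcomp Require Import ring lra zify.

Set Implicit Arguments.
Unset Strict Implicit.
Unset Printing Implicit Defensive.
Import Order.TTheory GRing.Theory Num.Theory.
Import numFieldNormedType.Exports.
Local Open Scope classical_set_scope.
Local Open Scope ring_scope.

(** * Products of measures and Lebesgue measure on C^n *)

(** Averaging over arguments gains the decisive power: the cruder bound [1 / (1 - |X|)^2] would lead
    to kernels [1 / (s + t)^2] in each variable, which are too singular for Schur's test, while the
    average leads to [1 / (s + t)]. Membership in S_p is then exactly what the test asks for. With
    weight exponents [1/p] and [1/q], the rates that must be positive in direction j are
    [2 gamma_j / q + (p - 1) beta_j] and [2 gamma_j / p + beta_j], and these equal
    [(p beta_j + 2 gamma_j) / q] and [(p beta_j + 2 gamma_j) / p]. Two obstacles shape the argument.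
    The kernel, a limit with a default value, is not shown to be measurable, so integrals containing
    it are only compared with those of an explicit measurable majorant. And no Jacobian of the
    logarithmic coordinates is computed: invariance under dilations determines the image measure up
    to a constant, whose positivity and finiteness are then checked on test functions. *)

Section prod_sigma_finite.
Context {R : realType} {d1 d2 : measure_display}.
Context {T1 : measurableType d1} {T2 : measurableType d2}.
Variables (m1 : {sigma_finite_measure set T1 -> \bar R}).
Variables (m2 : {sigma_finite_measure set T2 -> \bar R}).

(** The product gets a name of its own so that it can carry the sigma-finite instance declared
    below, which iterated products need. *)
Definition prod_measure : set (T1 * T2) -> \bar R := (m1 \x m2)%E.

HB.instance Definition _ := Measure.on prod_measure.

Lemma prod_measure_sigma_finite : sigma_finite setT prod_measure.
Proof.
have /sigma_finiteP[F [TF ndF Foo]] := sigma_finiteT m1.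
have /sigma_finiteP[G [TG ndG Goo]] := sigma_finiteT m2.
(* Both exhaustions are nondecreasing, so a point of [F i * G k] lies in the square whose index is
   the maximum of i and k. *)
exists (fun k => F k `*` G k).
  rewrite -setXTT TF TG predeqE => -[x y]; split.
    move=> [/= [i _ Fnx] [k _ Gky]]; exists (maxn i k) => //; split.
    - by move: x Fnx; exact/subsetPset/ndF/leq_maxl.
    - by move: y Gky; exact/subsetPset/ndG/leq_maxr.
  by move=> [i _ []/= ? ?]; split; exists i.
move=> k; have [? ?] := Foo k; have [? ?] := Goo k; split.
  exact: measurableX.
by rewrite /prod_measure product_measure1E// lte_mul_pinfty// ge0_fin_numE.
Qed.

HB.instance Definition _ :=
  @Measure_isSigmaFinite.Build _ _ _ prod_measure prod_measure_sigma_finite.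

End prod_sigma_finite.

Section power_measure.
Context {R : realType} {d : measure_display} {T : measurableType d}.
Variable mu : {sigma_finite_measure set T -> \bar R}.

Definition tcons n (x : T * n.-tuple T) : n.+1.-tuple T := [tuple of x.1 :: x.2].

Lemma measurable_tcons n : measurable_fun [set: T * n.-tuple T] (@tcons n).
Proof. exact: measurable_cons. Qed.

HB.instance Definition _ n := @isMeasurableFun.Build _ _ _ _ (@tcons n) (@measurable_tcons n).

Definition tuncons n (x : n.+1.-tuple T) : T * n.-tuple T := (thead x, [tuple of behead x]).

Lemma tconsK n : cancel (@tcons n) (@tuncons n).
Proof. by move=> [x t]; congr pair => //; apply: val_inj. Qed.

Lemma measurable_tuncons n : measurable_fun [set: n.+1.-tuple T] (@tuncons n).
Proof.
apply/measurable_fun_pairP; split.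
  exact: (@measurable_tnth _ T n.+1 ord0).
exact: measurable_behead.
Qed.

Section step.
Variables (n : nat) (nu : {sigma_finite_measure set (n.-tuple T) -> \bar R}).

Definition cons_measure : set (n.+1.-tuple T) -> \bar R :=
  pushforward (mu \x nu)%E (@tcons n).

Let cons_measure0 : cons_measure set0 = 0%E.
Proof. by rewrite /cons_measure /pushforward preimage_set0 measure0. Qed.

Let cons_measure_ge0 A : (0 <= cons_measure A)%E.
Proof. exact: measure_ge0. Qed.

Let measurable_preimage_tcons A : measurable A -> measurable (@tcons n @^-1` A).
Proof. by move=> mA; rewrite -[X in measurable X]setTI; apply: measurable_tcons. Qed.

Let cons_measure_sigma_additive : semi_sigma_additive cons_measure.
Proof.
move=> F mF tF mUF; rewrite /cons_measure /pushforward preimage_bigcup.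
apply: measure_semi_sigma_additive.
- by move=> i; exact: measurable_preimage_tcons.
- apply/trivIsetP => /= i j _ _ ij; rewrite -preimage_setI.
  by move/trivIsetP : tF => /(_ _ _ _ _ ij) ->//; rewrite preimage_set0.
- by rewrite -preimage_bigcup; exact: measurable_preimage_tcons.
Qed.

HB.instance Definition _ := isMeasure.Build _ _ _ cons_measure
  cons_measure0 cons_measure_ge0 cons_measure_sigma_additive.

Lemma cons_measure_sigma_finite : sigma_finite setT cons_measure.
Proof.
have [F TF mF] := prod_measure_sigma_finite mu nu.
exists (fun k => @tuncons n @^-1` F k).
  by rewrite -preimage_bigcup -TF preimage_setT.
move=> k; have [mFk Fk] := mF k; split.
  by rewrite -[X in measurable X]setTI; apply: measurable_tuncons.
rewrite /cons_measure /pushforward -comp_preimage.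
by rewrite (_ : _ \o _ = id)//; apply/funext => x /=; rewrite tconsK.
Qed.

HB.instance Definition _ :=
  @Measure_isSigmaFinite.Build _ _ _ cons_measure cons_measure_sigma_finite.

End step.

(** The base case is a Dirac mass, so that integration over [0.-tuple T] is evaluation, as in
    [intCn]. *)
Fixpoint power_measure n : {sigma_finite_measure set (n.-tuple T) -> \bar R} :=
  match n return {sigma_finite_measure set (n.-tuple T) -> \bar R} with
  | 0 => @dirac _ (0.-tuple T) [tuple] R
  | m.+1 => cons_measure (power_measure m)
  end.

Lemma integral_power0 (f : 0.-tuple T -> \bar R) :
  measurable_fun [set: 0.-tuple T] f ->
  (\int[power_measure 0]_t f t = f [tuple])%E.
Proof. by move=> mf; rewrite integral_dirac// diracE in_setT mul1e. Qed.

Lemma integral_powerS n (f : n.+1.-tuple T -> \bar R) :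
  measurable_fun [set: n.+1.-tuple T] f -> (forall t, 0 <= f t)%E ->
  (\int[power_measure n.+1]_t f t =
   \int[mu]_x \int[power_measure n]_t f (tcons (x, t)))%E.
Proof.
move=> mf f0; rewrite ge0_integral_pushforward//= preimage_setT.
rewrite fubini_tonelli1//=.
exact: measurableT_comp.
Qed.
End power_measure.

Section power_measure_theory.
Context {R : realType} {d : measure_display} {T : measurableType d}.
Variable mu : {sigma_finite_measure set T -> \bar R}.

Lemma prodEFin_ge0 (I : Type) (r : seq I) (f : I -> \bar R) :
  (forall i, (0 <= f i)%E) -> (0 <= \big[mule/1%E]_(i <- r) f i)%E.
Proof.
by move=> f0; elim/big_ind: _ => // x y x0 y0; exact: mule_ge0.
Qed.

Lemma integral_power_prod n (g : 'I_n -> T -> R) :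
  (forall i, measurable_fun setT (g i)) -> (forall i x, 0 <= g i x) ->
  (\int[power_measure mu n]_t (\prod_(i < n) g i (tnth t i))%:E =
   \big[mule/1]_(i < n) \int[mu]_x (g i x)%:E)%E.
Proof.
elim: n g => [|n IHn] g mg g0.
  rewrite integral_power0 ?big_ord0//.
  by apply/measurable_EFinP; under eq_fun do rewrite big_ord0; exact: measurable_cst.
have mprod m (h : 'I_m -> T -> R) : (forall i, measurable_fun setT (h i)) ->
    measurable_fun [set: m.-tuple T] (fun t => (\prod_(i < m) h i (tnth t i))%:E).
  move=> mh; apply/measurable_EFinP; apply: measurable_prod => i _.
  by apply: measurableT_comp => //; exact: measurable_tnth.
rewrite integral_powerS; last 2 first.
- exact: mprod.
- by move=> t; rewrite lee_fin prodr_ge0.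
rewrite big_ord_recl -(IHn (fun i => g (lift ord0 i)))//.
have mg0 : measurable_fun setT (EFin \o g ord0) by exact/measurable_EFinP.
rewrite -ge0_integralZr//; last 2 first.
- by move=> x _; rewrite lee_fin.
- by apply: integral_ge0 => t _; rewrite lee_fin prodr_ge0.
have mp := mprod _ (fun i => g (lift ord0 i)) (fun i => mg _).
apply: eq_integral => x _; rewrite -ge0_integralZl//; last 2 first.
- by move=> t _; rewrite lee_fin prodr_ge0.
- by rewrite lee_fin.
apply: eq_integral => t _; rewrite big_ord_recl -EFinM; congr (_ * _)%:E.
by apply: eq_bigr => i _; rewrite tnthS.
Qed.

Definition tmap n (phi : 'I_n -> T -> T) (t : n.-tuple T) : n.-tuple T :=
  [tuple phi i (tnth t i) | i < n].

Lemma measurable_tmap n (phi : 'I_n -> T -> T) :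
  (forall i, measurable_fun setT (phi i)) -> measurable_fun [set: n.-tuple T] (tmap phi).
Proof.
move=> mphi; apply/measurable_fun_tnthP => i.
rewrite (_ : _ \o _ = phi i \o (@tnth n T ^~ i)); last first.
  by apply/funext => t /=; rewrite tnth_mktuple.
by apply: measurableT_comp => //; exact: measurable_tnth.
Qed.

(** The one-variable rule is a hypothesis, so that the same induction serves complex dilations of
    C^n and translations of R^n. *)
Lemma integral_power_subst n (phi : 'I_n -> T -> T) (J : 'I_n -> R) :
  (forall i, measurable_fun setT (phi i)) -> (forall i, 0 <= J i) ->
  (forall i (f : T -> \bar R), measurable_fun setT f -> (forall x, 0 <= f x)%E ->
    (\int[mu]_x f x = (J i)%:E * \int[mu]_x f (phi i x))%E) ->
  forall f : n.-tuple T -> \bar R,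
    measurable_fun [set: n.-tuple T] f -> (forall t, 0 <= f t)%E ->
    (\int[power_measure mu n]_t f t =
     (\prod_(i < n) J i)%:E * \int[power_measure mu n]_t f (tmap phi t))%E.
Proof.
elim: n phi J => [|n IHn] phi J mphi J0 phiJ f mf f0.
  rewrite !integral_power0//; last by apply: measurableT_comp => //; exact: measurable_tmap.
  by rewrite big_ord0 mul1e; congr f; apply: eq_from_tnth; case.
rewrite !integral_powerS//; last by apply: measurableT_comp => //; exact: measurable_tmap.
have mfc : measurable_fun setT (f \o @tcons _ T n).
  by apply: measurableT_comp => //; exact: measurable_tcons.
have mF := @measurable_fun_fubini_tonelli_F _ _ _ _ _ (power_measure mu n) _ mfc (fun=> f0 _).
rewrite (phiJ ord0)//; last by move=> x; exact: integral_ge0.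
rewrite big_ord_recl EFinM -muleA; congr (_ * _)%E.
have J'0 : 0 <= \prod_(i < n) J (lift ord0 i) by apply: prodr_ge0.
rewrite -ge0_integralZl//; last 2 first.
- pose h := fun xt : T * n.-tuple T => f (tmap phi (tcons xt)).
  apply: (@measurable_fun_fubini_tonelli_F _ _ _ _ _ (power_measure mu n) h) => [|x].
    apply: measurableT_comp => //; apply: measurableT_comp; first exact: measurable_tmap.
    exact: measurable_tcons.
  exact: f0.
- by move=> x _; exact: integral_ge0.
apply: eq_integral => x _.
rewrite (IHn (fun i => phi (lift ord0 i)) (fun i => J (lift ord0 i)))//.
- congr (_ * _)%E; apply: eq_integral => t _; congr f.
  apply: eq_from_tnth => i; rewrite tnth_mktuple.
  case: (unliftP ord0 i) => [j ->|->].
    by rewrite !tnthS tnth_mktuple.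
  by rewrite !tnth0.
- by move=> i; exact: phiJ.
- apply: (measurableT_comp mf); apply: measurable_cons => //; exact: measurable_id.
Qed.

End power_measure_theory.

Section leb2.
Context {R : realType}.

(* [Cm n] is [Cn R n] with the sigma-algebra that [lebesgue_measure] lives on: it
   has the same measurable sets as the canonical one, but another display. *)
Definition MR : measurableType _ := measurableTypeR R.
Definition Cm n : measurableType _ := n.-tuple (MR * MR)%type.

Definition leb2 : {sigma_finite_measure set (MR * MR)%type -> \bar R} :=
  prod_measure (@lebesgue_measure R) (@lebesgue_measure R).
Definition volC n : {sigma_finite_measure set (Cm n) -> \bar R} := power_measure leb2 n.

Lemma integral_leb2 (f : MR * MR -> \bar R) :
  measurable_fun setT f -> (forall x, 0 <= f x)%E ->
  (\int[leb2]_z f z =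
   \int[@lebesgue_measure R]_x \int[@lebesgue_measure R]_y f (x, y))%E.
Proof. by move=> mf f0; rewrite fubini_tonelli1. Qed.

Lemma intCnE n (f : Cm n -> \bar R) : measurable_fun setT f -> (forall x, 0 <= f x)%E ->
  (@intCn R n f = \int[volC n]_z f z)%E.
Proof.
elim: n f => [|n IHn] f mf f0; first by rewrite integral_power0.
rewrite integral_powerS// integral_leb2/=; last 2 first.
- pose h := fun xt : (MR * MR) * Cm n => f (tcons xt).
  apply: (@measurable_fun_fubini_tonelli_F _ _ _ _ _ (power_measure leb2 n) h) => [|x].
    by apply: measurableT_comp => //; exact: measurable_tcons.
  exact: f0.
- by move=> x; exact: integral_ge0.
apply: eq_integral => x _; apply: eq_integral => y _.
rewrite (IHn (fun t => f (tcons ((x : MR, y : MR), t))))//.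
apply: (measurableT_comp mf); apply: measurable_cons => //; exact: measurable_id.
Qed.

End leb2.

(** * Affine changes of variables on the line and complex dilations of the plane *)

Section lebesgue_affine.
Context {R : realType}.
Local Notation MR := (@MR R).
Local Notation leb := (@lebesgue_measure R).

Lemma measurable_MR (D : set MR) : measurable_fun D (idfun : MR -> R).
Proof. exact: measurable_id. Qed.

Definition affine (a b : R) (x : MR) : MR := a * x + b.

Lemma measurable_affine (a b : R) : measurable_fun [set: MR] (affine a b).
Proof.
have : measurable_fun [set: MR] (affine a b : MR -> R).
  apply: measurable_funD => //; apply: measurable_funM => //; exact: measurable_MR.
by [].
Qed.

(** By uniqueness of Lebesgue measure: the rescaled pushforward agrees with it on half-open
    intervals. *)
Lemma lebesgue_measure_affine (a b : R) (A : set MR) : 0 < a -> measurable A ->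
  (leb A = a%:E * leb (affine a b @^-1` A))%E.
Proof.
move=> a0 mA.
pose phi := affine a b.
have mphi : measurable_fun setT phi := measurable_affine a b.
pose mf := isMeasurableFun.Build _ _ _ _ phi mphi.
pose phim : {mfun MR >-> MR} := HB.pack phi mf.
pose a' : {nonneg R} := NngNum (ltW a0).
rewrite (@lebesgue_measure_unique R (mscale a' (pushforward leb phim)))//.
move=> _ [[l r]] _ <-.
rewrite [fst _]/= [snd _]/=.
pose J : set R := `](l - b) / a, (r - b) / a]%classic.
rewrite [RHS](_ : _ = (a%:E * leb J)%E); last first.
  rewrite /mscale /pushforward /=; congr (_ * leb _)%E.
  apply/seteqP; split => x; rewrite /J /= !in_itv/= /phi/affine ltr_pdivrMr// ler_pdivlMr//.
    by move=> /andP[? ?]; apply/andP; split; lra.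
  by move=> /andP[? ?]; apply/andP; split; lra.
rewrite /J !lebesgue_measure_itv/= !lte_fin ltr_pM2r ?invr_gt0// ltrD2r.
case: ifPn => _; last by rewrite mule0.
by rewrite -!EFinB -EFinM; congr EFin; field; rewrite gt_eqF.
Qed.

Lemma ge0_integral_quasi_invariant d (T : measurableType d)
    (mu : {measure set T -> \bar R}) (phi : T -> T) (k : R) :
  measurable_fun setT phi -> 0 <= k ->
  (forall A, measurable A -> mu A = k%:E * mu (phi @^-1` A))%E ->
  forall f : T -> \bar R, measurable_fun setT f -> (forall x, 0 <= f x)%E ->
    (\int[mu]_x f x = k%:E * \int[mu]_x f (phi x))%E.
Proof.
move=> mphi k0 muphi f mf f0.
pose mfx := isMeasurableFun.Build _ _ _ _ phi mphi.
pose phim : {mfun T >-> T} := HB.pack phi mfx.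
pose k' : {nonneg R} := NngNum k0.
rewrite -(ge0_integral_pushforward mphi mu measurableT mf (fun y _ => f0 y)).
rewrite -(ge0_integral_mscale (pushforward mu phim) measurableT k' mf (fun y _ => f0 y)).
by apply: eq_measure_integral => A mA _; rewrite muphi.
Qed.

Lemma lebesgue_integral_affine (a b : R) (f : MR -> \bar R) : a != 0 ->
  measurable_fun setT f -> (forall x, 0 <= f x)%E ->
  (\int[leb]_x f x = (`|a|)%:E * \int[leb]_x f (affine a b x))%E.
Proof.
move=> a_neq0 mf f0.
have pos c e g : 0 < c -> measurable_fun [set: MR] g -> (forall x, 0 <= g x)%E ->
    (\int[leb]_x g x = c%:E * \int[leb]_x g (affine c e x))%E.
  move=> c0; apply: ge0_integral_quasi_invariant (ltW c0) _ _.
    exact: measurable_affine.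
  by move=> A; exact: lebesgue_measure_affine.
have opp g : measurable_fun [set: MR] g -> (forall x, 0 <= g x)%E ->
    (\int[leb]_x g x = \int[leb]_x g (- (x : R))%R)%E.
  move=> mg g0; rewrite (@ge0_integral_quasi_invariant _ _ leb (affine (-1) 0) 1)//.
  - by rewrite mul1e; apply: eq_integral => x _; rewrite /affine mulN1r addr0.
  - exact: measurable_affine.
  - move=> A mA; rewrite mul1e -[LHS](lebesgue_measureN mA) /pushforward.
    by congr (leb _); apply/seteqP; split => x /=; rewrite /affine mulN1r addr0.
have [a0|a0] := ltP 0 a; first by rewrite gtr0_norm//; exact: pos.
have a0' : 0 < - a by rewrite oppr_gt0 lt_neqAle a_neq0.
have mfa : measurable_fun [set: MR] (f \o affine a b).
  by apply: measurableT_comp => //; exact: measurable_affine.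
rewrite ler0_norm// (pos (- a) b f)//; congr (_ * _)%E.
rewrite [RHS]opp//; apply: eq_integral => x _.
by rewrite /affine mulNr mulrN.
Qed.

Definition cmulRR (l : R * R) (z : MR * MR) : MR * MR :=
  (l.1 * z.1 - l.2 * z.2, l.2 * z.1 + l.1 * z.2).

Lemma measurable_cmulRR (l : R * R) : measurable_fun [set: MR * MR] (cmulRR l).
Proof.
have m1 : measurable_fun [set: MR * MR] (fst : _ -> R) by exact: measurable_fst.
have m2 : measurable_fun [set: MR * MR] (snd : _ -> R) by exact: measurable_snd.
have H1 : measurable_fun [set: MR * MR] (fun z : MR * MR => l.1 * z.1 - l.2 * z.2 : R).
  by apply: measurable_funB; exact: measurable_funM.
have H2 : measurable_fun [set: MR * MR] (fun z : MR * MR => l.2 * z.1 + l.1 * z.2 : R).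
  by apply: measurable_funD; exact: measurable_funM.
by apply/measurable_fun_pairP; split.
Qed.

Lemma integral_leb2_swap (f : MR * MR -> \bar R) :
  measurable_fun setT f -> (forall x, 0 <= f x)%E ->
  (\int[leb2]_z f z = \int[leb]_y \int[leb]_x f (x, y))%E.
Proof. by move=> mf f0; rewrite fubini_tonelli2. Qed.

Lemma measurable_integral_leb1 (f : MR * MR -> \bar R) :
  measurable_fun setT f -> (forall x, 0 <= f x)%E ->
  measurable_fun [set: MR] (fun x => \int[leb]_y f (x, y))%E.
Proof. by move=> mf f0; exact: measurable_fun_fubini_tonelli_F. Qed.

Lemma measurable_integral_leb2 (f : MR * MR -> \bar R) :
  measurable_fun setT f -> (forall x, 0 <= f x)%E ->
  measurable_fun [set: MR] (fun y => \int[leb]_x f (x, y))%E.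
Proof. by move=> mf f0; exact: measurable_fun_fubini_tonelli_G. Qed.

Lemma integral_leb2_cmul (l : R * R) (f : MR * MR -> \bar R) : l != (0, 0) ->
  measurable_fun setT f -> (forall x, 0 <= f x)%E ->
  (\int[leb2]_z f z = (l.1 ^+ 2 + l.2 ^+ 2)%:E * \int[leb2]_z f (cmulRR l z))%E.
Proof.
case: l => a b ab0 mf f0; rewrite /cmulRR/=.
have mcomp (h : MR * MR -> MR * MR) : measurable_fun setT h ->
    measurable_fun setT (fun z => f (h z)) by move=> mh; exact: measurableT_comp.
have mpair (g h : MR * MR -> R) : measurable_fun setT g -> measurable_fun setT h ->
    measurable_fun setT (fun z => (g z : MR, h z : MR)).
  by move=> mg mh; apply/measurable_fun_pairP; split.
have m1 : measurable_fun [set: MR * MR] (fst : _ -> R) by exact: measurable_fst.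
have m2 : measurable_fun [set: MR * MR] (snd : _ -> R) by exact: measurable_snd.
have mx (g : MR * MR -> \bar R) x : measurable_fun setT g ->
    measurable_fun [set: MR] (fun y : MR => g (x : MR, y)).
  by move=> mg; apply: measurableT_comp => //; exact: pair1_measurable.
have my (g : MR * MR -> \bar R) y : measurable_fun setT g ->
    measurable_fun [set: MR] (fun x : MR => g (x, y : MR)).
  by move=> mg; apply: measurableT_comp => //; exact: pair2_measurable.
(* When the real part vanishes it cannot serve as a pivot, and the map is a swap of the two axes
   followed by two scalings. *)
have [a0|a_neq0] := eqVneq a 0.
  have b_neq0 : b != 0 by apply: contra_neq ab0 => b0; rewrite a0 b0.
  pose h (z : MR * MR) := f (- b * z.2, b * z.1).
  have mh : measurable_fun setT h.
    apply: mcomp; apply: mpair; exact: measurable_funM.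
  transitivity ((`|b|)%:E * ((`|b|)%:E * \int[leb2]_z h z))%E; last first.
    rewrite muleA -EFinM -expr2 real_normK ?num_real//.
    congr (_%:E * _)%E; first by rewrite a0; ring.
    by apply: eq_integral => z _; rewrite /h; congr (f (_, _)); rewrite a0; ring.
  rewrite [in RHS]integral_leb2//; last by move=> z; exact: f0.
  rewrite integral_leb2_swap//.
  rewrite (@lebesgue_integral_affine b 0)//; last 2 first.
  - exact: measurable_integral_leb2.
  - by move=> x; exact: integral_ge0.
  congr (_ * _)%E; rewrite -ge0_integralZl//; last 2 first.
  - exact: (@measurable_integral_leb1 h mh (fun=> f0 _)).
  - by move=> x _; apply: integral_ge0 => y _; exact: f0.
  apply: eq_integral => x _; rewrite (@lebesgue_integral_affine (- b) 0) ?oppr_eq0//; last first.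
  - by apply: (my f).
  rewrite normrN; congr (_ * _)%E; apply: eq_integral => y _.
  by rewrite /h /affine /= !addr0.
(* Elimination: the matrix of the multiplication is a composite of two one-variable affine maps, of
   slope [k / a] in the second variable and [a] in the first; the product of the slopes is the
   determinant k. *)
pose k := a ^+ 2 + b ^+ 2.
have k0 : 0 < k by rewrite ltr_wpDr ?sqr_ge0// exprn_even_gt0.
pose h (z : MR * MR) := f (z.1, k / a * z.2 + b / a * z.1).
have mh : measurable_fun setT h.
  by apply: mcomp; apply: mpair => //; apply: measurable_funD; exact: measurable_funM.
have mg : measurable_fun setT (fun z : MR * MR => f (a * z.1 - b * z.2, b * z.1 + a * z.2)).
  by apply: mcomp; apply: mpair;[apply: measurable_funB|apply: measurable_funD]; exact: measurable_funM.
rewrite integral_leb2//.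
transitivity ((`|k / a|)%:E * \int[leb2]_z h z)%E.
  rewrite integral_leb2//; last by move=> z; exact: f0.
  rewrite -ge0_integralZl//; last 2 first.
  - exact: (@measurable_integral_leb1 h mh (fun=> f0 _)).
  - by move=> x _; apply: integral_ge0 => y _; exact: f0.
  apply: eq_integral => x _; rewrite (@lebesgue_integral_affine (k / a) (b / a * x))//; last 2 first.
  - by apply: mulf_neq0; [exact: lt0r_neq0|rewrite invr_eq0].
  - exact: mx.
rewrite integral_leb2_swap//; last by move=> z; exact: f0.
rewrite [in RHS]integral_leb2_swap//.
rewrite [X in _ = (X%:E * _)%E](_ : _ = `|k / a| * `|a|); last first.
  by rewrite -normrM divfK// gtr0_norm.
rewrite EFinM -muleA; congr (_ * _)%E; rewrite -ge0_integralZl//; last 2 first.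
- exact: (@measurable_integral_leb2 _ mg (fun=> f0 _)).
- by move=> x _; apply: integral_ge0 => y _; exact: f0.
apply: eq_integral => y _; rewrite (@lebesgue_integral_affine a (- b * y))//; last 2 first.
- exact: my.
- by move=> x; exact: f0.
congr (_ * _)%E; apply: eq_integral => x _; rewrite /h /affine /=.
by congr (f (_, _)); [ring | rewrite /k; field].
Qed.

End lebesgue_affine.

(** * Moduli and measurability of complex functions *)

Section cabs_theory.
Context {R : realType}.
Implicit Types u v : R[i].

(** The norm of [R[i]] is itself complex valued; this identity transports its properties to the
    real-valued [cabs]. *)
Lemma normc_cabs u : `|u| = (cabs u)%:C%C.
Proof. by rewrite normc_def. Qed.

Lemma cabs_ge0 u : 0 <= cabs u.
Proof. exact: sqrtr_ge0. Qed.

Lemma cabsM u v : cabs (u * v) = cabs u * cabs v.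
Proof. by apply: complexI; rewrite rmorphM/= -!normc_cabs normrM. Qed.

Lemma cabsV u : cabs u^-1 = (cabs u)^-1.
Proof. by apply: complexI; rewrite fmorphV/= -!normc_cabs normfV. Qed.

Lemma cabsX u m : cabs (u ^+ m) = cabs u ^+ m.
Proof. by apply: complexI; rewrite rmorphXn/= -!normc_cabs normrX. Qed.

Lemma cabs_exprz u (m : int) : cabs (u ^ m) = cabs u ^ m.
Proof. by case: m => m; rewrite ?NegzE -?exprnN ?cabsV cabsX. Qed.

Lemma cabs1 : cabs (1 : R[i]) = 1.
Proof. by apply: complexI; rewrite -normc_cabs normr1. Qed.

Lemma cabs0 : cabs (0 : R[i]) = 0.
Proof. by apply: complexI; rewrite -normc_cabs normr0. Qed.

Lemma cabs_eq0 u : (cabs u == 0) = (u == 0).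
Proof. by rewrite -[RHS]normr_eq0 normc_cabs (inj_eq (@complexI _) _ 0). Qed.

Lemma cabs_gt0 u : (0 < cabs u) = (u != 0).
Proof. by rewrite lt_neqAle eq_sym cabs_eq0 cabs_ge0 andbT. Qed.

Lemma cabs_real (x : R) : cabs x%:C%C = `|x|.
Proof. by rewrite /cabs/= expr0n addr0 sqrtr_sqr. Qed.

Lemma cabs_conj u : cabs u^* = cabs u.
Proof. by apply: complexI; rewrite -!normc_cabs norm_conjC. Qed.

Lemma cabs_prod (I : Type) (r : seq I) (P : pred I) (f : I -> R[i]) :
  cabs (\prod_(i <- r | P i) f i) = \prod_(i <- r | P i) cabs (f i).
Proof. by elim/big_rec2: _ => [|i y1 y2 _ <-]; rewrite ?cabs1// cabsM. Qed.

Lemma cabsD u v : cabs (u + v) <= cabs u + cabs v.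
Proof. by rewrite -lecR rmorphD/= -!normc_cabs ler_normD. Qed.

Lemma cabsN u : cabs (- u) = cabs u.
Proof. by apply: complexI; rewrite -!normc_cabs normrN. Qed.

Lemma cabs_sum (I : Type) (r : seq I) (P : pred I) (f : I -> R[i]) :
  cabs (\sum_(i <- r | P i) f i) <= \sum_(i <- r | P i) cabs (f i).
Proof.
elim/big_rec2: _ => [|i y1 y2 _ h]; first by rewrite cabs0.
by apply: (le_trans (cabsD _ _)); rewrite lerD2l.
Qed.

Lemma cabs_sqr u : cabs u ^+ 2 = complex.Re u ^+ 2 + complex.Im u ^+ 2.
Proof. by rewrite sqr_sqrtr// addr_ge0 ?sqr_ge0. Qed.

Lemma sqrr_cabs u : (cabs u ^+ 2)%:C%C = u * u^*.
Proof. by rewrite rmorphXn/= -normc_cabs normCK. Qed.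

Lemma Re_le_cabs u : `|complex.Re u| <= cabs u.
Proof. by rewrite -sqrtr_sqr ler_wsqrtr// lerDl sqr_ge0. Qed.

Lemma Im_le_cabs u : `|complex.Im u| <= cabs u.
Proof. by rewrite -sqrtr_sqr ler_wsqrtr// lerDr sqr_ge0. Qed.

Lemma cabs_le_ReIm u : cabs u <= `|complex.Re u| + `|complex.Im u|.
Proof.
rewrite /cabs -(ler_sqr _ _)// ?nnegrE ?sqrtr_ge0 ?addr_ge0//.
rewrite sqr_sqrtr ?addr_ge0 ?sqr_ge0// sqrrD !real_normK ?num_real//.
by rewrite addrAC lerDl mulrn_wge0// mulr_ge0.
Qed.

End cabs_theory.

Section complex_measurability.
Context {R : realType} {d : measure_display} {T : measurableType d}.
Implicit Types f g : T -> R[i].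

Definition cmeas f := measurable_fun [set: T] (fun x => complex.Re (f x)) /\
  measurable_fun [set: T] (fun x => complex.Im (f x)).

Lemma cmeas_cst (u : R[i]) : cmeas (fun=> u).
Proof. by split; exact: measurable_cst. Qed.

Lemma cmeasM f g : cmeas f -> cmeas g -> cmeas (fun x => f x * g x).
Proof.
move=> [f1 f2] [g1 g2]; split.
  rewrite (_ : (fun _ => _) = fun x => complex.Re (f x) * complex.Re (g x) -
     complex.Im (f x) * complex.Im (g x)).
    by apply: measurable_funB; exact: measurable_funM.
  by apply/funext => x; case: (f x) (g x) => [? ?] [? ?].
rewrite (_ : (fun _ => _) = fun x => complex.Re (f x) * complex.Im (g x) +
     complex.Im (f x) * complex.Re (g x)).
  by apply: measurable_funD; exact: measurable_funM.
by apply/funext => x; case: (f x) (g x) => [? ?] [? ?].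
Qed.

Lemma cmeasD f g : cmeas f -> cmeas g -> cmeas (fun x => f x + g x).
Proof.
move=> [f1 f2] [g1 g2]; split.
  rewrite (_ : (fun _ => _) = fun x => complex.Re (f x) + complex.Re (g x)).
    exact: measurable_funD.
  by apply/funext => x; case: (f x) (g x) => [? ?] [? ?].
rewrite (_ : (fun _ => _) = fun x => complex.Im (f x) + complex.Im (g x)).
  exact: measurable_funD.
by apply/funext => x; case: (f x) (g x) => [? ?] [? ?].
Qed.

Lemma cmeas_real (h : T -> R) : measurable_fun [set: T] h -> cmeas (fun x => (h x)%:C%C).
Proof. by move=> mh; split => //; exact: measurable_cst. Qed.

Lemma cmeasN f : cmeas f -> cmeas (fun x => - f x).
Proof.
move=> mf; under eq_fun do rewrite -mulN1r.
by apply: cmeasM => //; exact: cmeas_cst.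
Qed.

Lemma cmeas_conj f : cmeas f -> cmeas (fun x => (f x)^*).
Proof.
move=> [f1 f2]; split.
  rewrite (_ : (fun _ => _) = fun x => complex.Re (f x))//.
  by apply/funext => x; case: (f x).
rewrite (_ : (fun _ => _) = fun x => - complex.Im (f x)).
  exact: measurable_funN.
by apply/funext => x; case: (f x).
Qed.

(** The inverse is the power of exponent -1, an identity that holds for nonnegative arguments; this
    is why inverses of differences appear below with a maximum with 0. *)
Lemma measurable_inv (h : T -> R) : (forall x, 0 <= h x) -> measurable_fun [set: T] h ->
  measurable_fun [set: T] (fun x => (h x)^-1).
Proof.
move=> h0 mh; under eq_fun do rewrite -powR_inv1//.
by apply: (measurableT_comp (measurable_powR (-1))).
Qed.

Lemma measurable_cabs f : cmeas f -> measurable_fun [set: T] (fun x => cabs (f x)).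
Proof.
move=> [f1 f2]; rewrite (_ : (fun _ => _) = fun x =>
   (complex.Re (f x) ^+ 2 + complex.Im (f x) ^+ 2) `^ 2^-1).
  apply: (measurableT_comp (measurable_powR (2^-1))).
  by apply: measurable_funD; exact: measurable_funX.
by apply/funext => x; rewrite powR12_sqrt// addr_ge0 ?sqr_ge0.
Qed.

Lemma cmeasV f : cmeas f -> cmeas (fun x => (f x)^-1).
Proof.
move=> mf; rewrite (_ : (fun _ => _) = fun x => (f x)^* * ((cabs (f x) ^+ 2)^-1)%:C%C).
  apply: cmeasM; first exact: cmeas_conj.
  apply: cmeas_real; apply: measurable_inv => [x|]; first exact: sqr_ge0.
  by apply: measurable_funX; exact: measurable_cabs.
apply/funext => x; rewrite fmorphV/= sqrr_cabs invfM.
have [->|fx0] := eqVneq (f x) 0; first by rewrite invr0 mul0r mulr0.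
by rewrite mulrC mulfVK// conjC_eq0.
Qed.

Lemma cmeasX f m : cmeas f -> cmeas (fun x => f x ^+ m).
Proof.
move=> mf; elim: m => [|m IH]; first exact: cmeas_cst.
by under eq_fun do rewrite exprS; exact: cmeasM.
Qed.

Lemma cmeas_exprz f (m : int) : cmeas f -> cmeas (fun x => f x ^ m).
Proof.
case: m => m mf; first exact: cmeasX.
under eq_fun do rewrite NegzE -exprnN.
by apply: cmeasV; exact: cmeasX.
Qed.

Lemma cmeas_prod (I : Type) (r : seq I) (f : I -> T -> R[i]) :
  (forall i, cmeas (f i)) -> cmeas (fun x => \prod_(i <- r) f i x).
Proof.
move=> mf; elim: r => [|i r IH].
  by under eq_fun do rewrite big_nil; exact: cmeas_cst.
by under eq_fun do rewrite big_cons; exact: cmeasM.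
Qed.

Lemma cmeas_sum (I : Type) (r : seq I) (f : I -> T -> R[i]) :
  (forall i, cmeas (f i)) -> cmeas (fun x => \sum_(i <- r) f i x).
Proof.
move=> mf; elim: r => [|i r IH].
  by under eq_fun do rewrite big_nil; exact: cmeas_cst.
by under eq_fun do rewrite big_cons; exact: cmeasD.
Qed.

End complex_measurability.

Lemma cmeas_comp {R : realType} d d' (T : measurableType d) (T' : measurableType d')
    (f : T -> R[i]) (g : T' -> T) :
  cmeas f -> measurable_fun [set: T'] g -> cmeas (fun x => f (g x)).
Proof.
move=> [f1 f2] mg; split; first exact: (measurableT_comp f1 mg).
exact: (measurableT_comp f2 mg).
Qed.

(** * Coordinatewise dilations and the coordinate hyperplanes *)

Section coordinates.
Context {R : realType} {n : nat}.
Local Notation Cm := (@Cm R n).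

Lemma cmeas_coord (k : 'I_n) : cmeas (fun z : Cm => @Defs.coord R n z k).
Proof.
split.
  apply: (@measurableT_comp _ _ _ _ _ _ (fst : @MR R * @MR R -> R) _ (fun z => tnth z k)).
    exact: measurable_fst.
  exact: measurable_tnth.
apply: (@measurableT_comp _ _ _ _ _ _ (snd : @MR R * @MR R -> R) _ (fun z => tnth z k)).
  exact: measurable_snd.
exact: measurable_tnth.
Qed.

Lemma cmeas_mono (a : 'rV[int]_n) : cmeas (fun z : Cm => @mono R n a z).
Proof. by apply: cmeas_prod => k; apply: cmeas_exprz; exact: cmeas_coord. Qed.

(** Positive factors give the dilations that identify the measure, unimodular ones the rotations
    used in the angular average. *)
Definition csmul (l : 'I_n -> R[i]) (z : Cm) : Cm :=
  tmap (fun k => cmulRR (complex.Re (l k), complex.Im (l k))) z.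

Lemma coord_csmul l (z : Cm) k : @Defs.coord R n (csmul l z) k = l k * @Defs.coord R n z k.
Proof.
rewrite /Defs.coord /csmul tnth_mktuple /cmulRR/=; case: (l k) => a b /=.
by congr (_ +i* _)%C; rewrite addrC.
Qed.

Lemma measurable_csmul l : measurable_fun [set: Cm] (csmul l).
Proof. by apply: measurable_tmap => i; exact: measurable_cmulRR. Qed.

Lemma integral_csmul (l : 'I_n -> R[i]) (f : Cm -> \bar R) : (forall k, l k != 0) ->
  measurable_fun setT f -> (forall x, 0 <= f x)%E ->
  (\int[volC n]_z f z = (\prod_(k < n) cabs (l k) ^+ 2)%:E * \int[volC n]_z f (csmul l z))%E.
Proof.
move=> l0 mf f0; apply: integral_power_subst => //.
- by move=> i; exact: measurable_cmulRR.
- by move=> i; exact: sqr_ge0.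
- move=> i g mg g0; rewrite cabs_sqr; apply: integral_leb2_cmul => //.
  by move: (l0 i); case: (l i) => a b; apply: contra_neq => -[-> ->].
Qed.

(** Off the coordinate hyperplanes every Laurent monomial is defined and logarithmic coordinates
    make sense. *)
Definition nzero (z : Cm) := [forall k, @Defs.coord R n z k != 0].

Lemma measurable_nzero : measurable_fun [set: Cm] (fun z => (nzero z)%:R : R).
Proof.
(* Since [0^-1 = 0], the product of a modulus and its inverse is the indicator of being nonzero. *)
rewrite (_ : (fun _ => _) = fun z : Cm =>
    \prod_(k < n) (cabs (@Defs.coord R n z k) * (cabs (@Defs.coord R n z k))^-1)).
  apply: measurable_prod => k _; apply: measurable_funM.
    by apply: measurable_cabs; exact: cmeas_coord.
  apply: measurable_inv; first by move=> z; exact: cabs_ge0.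
  by apply: measurable_cabs; exact: cmeas_coord.
apply/funext => z; have [/forallP nz|/forallPn[k /negPn zk0]] := boolP (nzero z).
  by rewrite big1// => k _; rewrite divff// cabs_eq0.
by rewrite (bigD1 k)//= (eqP zk0) cabs0 !mul0r.
Qed.

Lemma nzero_null (f : Cm -> \bar R) : measurable_fun setT f -> (forall z, 0 <= f z)%E ->
  (\int[volC n]_z f z = \int[volC n]_z (f z * ((nzero z)%:R)%:E))%E.
Proof.
move=> mf f0.
pose N k := [set z : Cm | tnth z k = (0, 0)].
have mN k : measurable (N k).
  rewrite (_ : N k = (@tnth n (@MR R * @MR R)%type ^~ k) @^-1` ([set 0] `*` [set 0])).
    rewrite -[X in measurable X]setTI; apply: measurable_tnth => //.
    by apply: measurableX; exact: measurable_set1.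
  by apply/seteqP; split=> z; rewrite /N/=; case: (tnth z k) => x y /= []; move=> -> ->.
have N0 k : volC n (N k) = 0%E.
  (* The indicator of the hyperplane is a product of one-variable functions whose k-th factor is the
     indicator of a point, of integral 0. *)
  pose g (i : 'I_n) (x : @MR R * @MR R) : R := if i == k then \1_([set 0] `*` [set 0]) x else 1.
  have -> : volC n (N k) = (\int[volC n]_z (\prod_(i < n) g i (tnth z i))%:E)%E.
    transitivity (\int[volC n]_z (\1_(N k) z)%:E)%E; first by rewrite integral_indic// setIT.
    apply: eq_integral => z _; congr EFin.
    rewrite (bigD1 k)//= big1 ?mulr1 /g ?eqxx; last by move=> i /negPf ->.
    rewrite !indicE; congr ((_ : bool)%:R); apply/idP/idP; rewrite !inE /N/=.
      by move=> ->.
    by case: (tnth z k) => x y /= [-> ->].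
  rewrite integral_power_prod.
  - rewrite (bigD1 k)//= /g eqxx integral_indic//; last first.
      by apply: measurableX; exact: measurable_set1.
    rewrite setIT /leb2 /= /prod_measure product_measure1E//.
    rewrite [X in (X * _ * _)%E](_ : _ = 0%E) ?mul0e//.
    exact: lebesgue_measure_set1.
  - move=> i; rewrite /g; case: (i == k); last exact: measurable_cst.
    by apply: measurable_indic; apply: measurableX; exact: measurable_set1.
  - by move=> i x; rewrite /g; case: (i == k).
apply: ge0_ae_eq_integral => //.
- apply: emeasurable_funM => //; apply/measurable_EFinP; exact: measurable_nzero.
- by move=> z _; rewrite mule_ge0.
pose F (i : nat) : set Cm := if insub i is Some k then N k else set0.
apply: (@negligibleS _ _ _ _ (\bigcup_i F i)).
  move=> z /= h; apply: contrapT => hz; apply: h => _.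
  rewrite (_ : nzero z) ?mule1//; apply/forallP => k; apply/negP => /eqP zk.
  apply: hz; exists k => //; rewrite /F valK /N /=; move: zk; rewrite /Defs.coord.
  by case: (tnth z k) => x y /= [-> ->].
apply: negligible_bigcup => i; rewrite /F; case: insubP => [k _ _|_].
  by apply/(negligibleP _ (mN k)); exact: N0.
exact: negligible_set0.
Qed.

End coordinates.

(** * Integrals of nonnegative functions that need not be measurable *)

Section lower_integral.
Context {R : realType}.

(* The integral of a nonnegative function is a supremum over simple functions,
   hence monotone without any measurability assumption. *)
Lemma le_integral_nonmeasurable d (T : measurableType d) (mu : {measure set T -> \bar R})
    (f g : T -> \bar R) : (forall x, 0 <= f x)%E -> (forall x, f x <= g x)%E ->
  (\int[mu]_x f x <= \int[mu]_x g x)%E.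
Proof.
move=> f0 fg; have g0 x : (0 <= g x)%E := le_trans (f0 x) (fg x).
rewrite !ge0_integralTE//; apply: ereal_sup_le; apply: image_subset => h hf x.
exact: le_trans (hf x) (fg x).
Qed.

Lemma intCn_ge0 n (f : Cn R n -> \bar R) : (forall z, 0 <= f z)%E -> (0 <= intCn f)%E.
Proof.
elim: n f => [|n IHn] f f0 /=; first exact: f0.
by apply: integral_ge0 => x _; apply: integral_ge0 => y _; exact: IHn.
Qed.

Lemma le_intCn n (f g : Cn R n -> \bar R) : (forall z, 0 <= f z)%E ->
  (forall z, f z <= g z)%E -> (intCn f <= intCn g)%E.
Proof.
elim: n f g => [|n IHn] f g f0 fg /=; first exact: fg.
apply: le_integral_nonmeasurable => x.
  by apply: integral_ge0 => y _; exact: intCn_ge0.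
apply: le_integral_nonmeasurable => y; first exact: intCn_ge0.
exact: IHn.
Qed.

(** As [f] may be non-measurable, its values on the hyperplanes cannot be discarded directly.
    Raising [g] to [+oo] there gives a measurable majorant everywhere, with the same integral since
    the hyperplanes are null. *)
Lemma intCn_le_nzero n (f g : Cm n -> \bar R) : (forall z, 0 <= f z)%E ->
  measurable_fun setT g -> (forall z, 0 <= g z)%E ->
  (forall z, nzero z -> f z <= g z)%E -> (@intCn R n f <= \int[volC n]_z g z)%E.
Proof.
move=> f0 mg g0 fg.
pose h (z : @Cm R n) := (g z + +oo * (1 - (nzero z)%:R)%:E)%E.
have h0 z : (0 <= h z)%E.
  by rewrite adde_ge0// mule_ge0 ?lee_fin ?subr_ge0//; case: (nzero z).
have mh : measurable_fun setT h.
  apply: emeasurable_funD => //; apply: emeasurable_funM; first exact: measurable_cst.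
  apply/measurable_EFinP; apply: measurable_funB; first exact: measurable_cst.
  exact: measurable_nzero.
apply: (@le_trans _ _ (@intCn R n h)).
  apply: le_intCn => // z; rewrite /h; have [nz|nz] := boolP (nzero z).
    by rewrite subrr mule0 adde0; exact: fg.
  rewrite subr0 mule1 addey ?leey// gt_eqF// (lt_le_trans _ (g0 z))//.
rewrite intCnE// nzero_null// [leRHS]nzero_null//.
under eq_integral => z _ do
  (rewrite (_ : h z * _ = g z * (nzero z)%:R%:E)%E; last
   by rewrite /h; case: (nzero z); rewrite ?mule0// subrr mule0 adde0).
by [].
Qed.

Lemma intCnE_nzero n (f g : Cm n -> \bar R) : (forall z, 0 <= f z)%E ->
  measurable_fun setT g -> (forall z, 0 <= g z)%E ->
  (forall z, nzero z -> f z = g z)%E -> (@intCn R n f = \int[volC n]_z g z)%E.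
Proof.
move=> f0 mg g0 fg; apply/eqP; rewrite eq_le; apply/andP; split.
  by apply: intCn_le_nzero => // z /fg ->.
(* For the lower bound, [g] is instead set to 0 on the hyperplanes. *)
rewrite nzero_null// -intCnE//; last 2 first.
- apply: emeasurable_funM => //; apply/measurable_EFinP; exact: measurable_nzero.
- by move=> z; rewrite mule_ge0.
apply: le_intCn => z; first by rewrite mule_ge0.
by have [nz|nz] := boolP (nzero z); rewrite ?mule0 ?mule1// fg.
Qed.

End lower_integral.

(** * Logarithmic coordinates *)

Section tuples.
Context {R : realType}.
Local Notation MR := (@MR R).

Definition Rn n : measurableType _ := n.-tuple MR.
Definition volR n : {sigma_finite_measure set (Rn n) -> \bar R} :=
  power_measure (@lebesgue_measure R) n.

Definition addt n (u v : Rn n) : Rn n := [tuple (tnth u j + tnth v j : R) | j < n].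
Definition oppt n (u : Rn n) : Rn n := [tuple (- (tnth u j : R)) | j < n].

Lemma measurable_tnthR n (j : 'I_n) : measurable_fun [set: Rn n] (fun u => tnth u j : R).
Proof. exact: measurable_tnth. Qed.

Lemma measurable_mktuple d (T : measurableType d) n (f : 'I_n -> T -> R) :
  (forall j, measurable_fun [set: T] (f j)) ->
  measurable_fun [set: T] (fun x => [tuple (f j x : MR) | j < n] : Rn n).
Proof.
move=> mf; apply/measurable_fun_tnthP => j.
rewrite (_ : _ \o _ = (f j : T -> MR)); first exact: (mf j).
by apply/funext => x /=; rewrite tnth_mktuple.
Qed.

Lemma measurable_addt d (T : measurableType d) n (f g : T -> Rn n) :
  measurable_fun setT f -> measurable_fun setT g ->
  measurable_fun [set: T] (fun x => addt (f x) (g x)).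
Proof.
move=> mf mg; apply: measurable_mktuple => j; apply: measurable_funD.
  exact: (measurableT_comp (measurable_tnthR j)).
exact: (measurableT_comp (measurable_tnthR j)).
Qed.

Lemma measurable_oppt d (T : measurableType d) n (f : T -> Rn n) :
  measurable_fun setT f -> measurable_fun [set: T] (fun x => oppt (f x)).
Proof.
move=> mf; apply: measurable_mktuple => j; apply: measurable_funN.
exact: (measurableT_comp (measurable_tnthR j)).
Qed.

Lemma integral_addt n (t : Rn n) (f : Rn n -> \bar R) :
  measurable_fun setT f -> (forall u, 0 <= f u)%E ->
  (\int[volR n]_u f u = \int[volR n]_u f (addt u t))%E.
Proof.
move=> mf f0.
rewrite (@integral_power_subst _ _ _ _ n (fun j => affine 1 (tnth t j)) (fun=> 1))//.
- rewrite big1// mul1e; apply: eq_integral => u _; congr f.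
  by apply: eq_from_tnth => j; rewrite !tnth_mktuple /affine mul1r.
- by move=> j; exact: measurable_affine.
- by move=> j g mg g0; rewrite (@lebesgue_integral_affine _ 1 (tnth t j))// normr1.
Qed.

End tuples.

Section radial.
Context {R : realType} {n : nat} (A : 'M[int]_n).
Hypothesis detA : \det A != 0.
Local Notation MR := (@MR R).
Local Notation Cm := (@Cm R n).
Local Notation Rn := (@Rn R n).

Definition Areal : 'M[R]_n := map_mx intr A.
Definition Binv : 'M[R]_n := invmx Areal.

Lemma Areal_unit : Areal \in unitmx.
Proof. by rewrite unitmxE unitfE det_map_mx intr_eq0. Qed.

Lemma Areal_Binv j i : \sum_k (A j k)%:~R * Binv k i = (j == i)%:R.
Proof.
have /matrixP/(_ j i) := mulmxV Areal_unit; rewrite !mxE => <-.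
by apply: eq_bigr => k _; rewrite !mxE.
Qed.

Lemma Binv_Areal k i : \sum_j Binv k j * (A j i)%:~R = (k == i)%:R.
Proof.
have /matrixP/(_ k i) := mulVmx Areal_unit; rewrite !mxE => <-.
by apply: eq_bigr => j _; rewrite !mxE.
Qed.

Definition lnabs (z : Cm) (k : 'I_n) : R := ln (cabs (@Defs.coord R n z k)).

(* [tv z j = - ln |zeta_j|] for the monomial [zeta_j] in row [j] of [A], so that the
   polyhedron is the positive orthant in these coordinates. *)
Definition tv (z : Cm) : Rn := [tuple (- \sum_k (A j k)%:~R * lnabs z k : MR) | j < n].

(* Lebesgue measure has density [exp (- 2 * \sum_j gam j * t_j)], up to a constant, in
   the coordinates [tv] and the arguments of [z]. *)
Definition gam (j : 'I_n) : R := \sum_k Binv k j.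

Lemma measurable_lnabs k : measurable_fun [set: Cm] (fun z => lnabs z k).
Proof.
apply: (measurableT_comp (@measurable_ln R)).
by apply: measurable_cabs; exact: cmeas_coord.
Qed.

Lemma measurable_tv : measurable_fun [set: Cm] tv.
Proof.
apply: measurable_mktuple => j; apply: measurable_funN; apply: measurable_sum => k.
by apply: measurable_funM => //; exact: measurable_lnabs.
Qed.

Lemma lnabs_tv (z : Cm) k : lnabs z k = - \sum_j Binv k j * (tnth (tv z) j : R).
Proof.
under eq_bigr => j _ do rewrite tnth_mktuple mulrN mulr_sumr.
rewrite sumrN opprK exchange_big/=.
under eq_bigr => i _ do (under eq_bigr => j _ do rewrite mulrA; rewrite -mulr_suml Binv_Areal).
rewrite (bigD1 k)//= eqxx mul1r big1 ?addr0// => i ik.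
by rewrite eq_sym (negPf ik) mul0r.
Qed.

(** Lebesgue measure times this weight is invariant under all dilations by nonzero factors. On the
    hyperplanes the weight is 0, because [0^-1 = 0]. *)
Definition haar_weight (z : Cm) : R := \prod_k (cabs (@Defs.coord R n z k) ^+ 2)^-1.

Lemma haar_weight_ge0 z : 0 <= haar_weight z.
Proof. by apply: prodr_ge0 => k _; rewrite invr_ge0 sqr_ge0. Qed.

Lemma measurable_haar_weight : measurable_fun [set: Cm] haar_weight.
Proof.
apply: measurable_prod => k _; apply: measurable_inv => [z|]; first exact: sqr_ge0.
by apply: measurable_funX; apply: measurable_cabs; exact: cmeas_coord.
Qed.

Lemma haar_weight_nzero z : ~~ nzero z -> haar_weight z = 0.
Proof.
move=> /forallPn[k /negPn /eqP zk]; rewrite /haar_weight (bigD1 k)//= zk cabs0.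
by rewrite expr0n invr0 mul0r.
Qed.

Lemma haar_weight_tv z : nzero z -> haar_weight z = expR (\sum_j 2 * gam j * (tnth (tv z) j : R)).
Proof.
move=> /forallP nz.
have -> : \sum_j 2 * gam j * (tnth (tv z) j : R) = \sum_k (- 2 * lnabs z k).
  under [RHS]eq_bigr => k _ do rewrite lnabs_tv mulrNN mulr_sumr.
  rewrite exchange_big/=; apply: eq_bigr => j _.
  rewrite /gam mulr_sumr mulr_suml; apply: eq_bigr => k _; ring.
rewrite expR_sum; apply: eq_bigr => k _; rewrite mulNr expRN; congr (_^-1).
by rewrite expRM_natl lnK// posrE cabs_gt0.
Qed.

Lemma nzero_csmul l (z : Cm) : (forall k, l k != 0) -> nzero (csmul l z) = nzero z.
Proof. by move=> l0; apply: eq_forallb => k; rewrite coord_csmul mulf_eq0 negb_or l0. Qed.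

Lemma haar_weight_csmul l z : (forall k, l k != 0) ->
  (\prod_(k < n) cabs (l k) ^+ 2) * haar_weight (csmul l z) = haar_weight z.
Proof.
move=> l0; rewrite -big_split/=; apply: eq_bigr => k _.
by rewrite coord_csmul cabsM exprMn invfM mulVKf// sqrf_eq0 cabs_eq0.
Qed.

(** Every translation of the logarithmic coordinates comes from a positive dilation, the matrix
    being invertible. *)
Lemma tv_csmul_exp (y : Rn) (z : Cm) : nzero z ->
  tv (csmul (fun k => (expR (- \sum_j Binv k j * (tnth y j : R)))%:C%C) z) = addt (tv z) y.
Proof.
move=> /forallP nz; apply: eq_from_tnth => j; rewrite !tnth_mktuple.
have E k : lnabs (csmul (fun k => (expR (- \sum_j Binv k j * (tnth y j : R)))%:C%C) z) k =
    (- \sum_j Binv k j * (tnth y j : R)) + lnabs z k.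
  rewrite /lnabs coord_csmul cabsM cabs_real ger0_norm ?expR_ge0//.
  by rewrite lnM ?posrE ?expR_gt0 ?cabs_gt0// expRK.
under eq_bigr => k _ do rewrite E mulrDr.
rewrite big_split/= opprD addrC; congr (_ + _).
under eq_bigr => k _ do rewrite mulrN mulr_sumr.
rewrite sumrN opprK exchange_big/=.
under eq_bigr => i _ do (under eq_bigr => k _ do rewrite mulrA; rewrite -mulr_suml Areal_Binv).
rewrite (bigD1 j)//= eqxx mul1r big1 ?addr0// => i ij.
by rewrite eq_sym (negPf ij) mul0r.
Qed.

Local Notation V := (volC n).

Definition haar (H : Rn -> \bar R) := (\int[V]_z ((haar_weight z)%:E * H (tv z)))%E.

Lemma haar_addt (H : Rn -> \bar R) y : measurable_fun setT H -> (forall u, 0 <= H u)%E ->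
  haar (fun u => H (addt u y)) = haar H.
Proof.
move=> mH H0; rewrite /haar.
pose l k := (expR (- \sum_j Binv k j * (tnth y j : R)))%:C%C.
have l0 k : l k != 0 by rewrite -cabs_eq0 cabs_real normr_eq0 gt_eqF ?expR_gt0.
pose f z := ((haar_weight z)%:E * H (tv z))%E.
have mf : measurable_fun setT f.
  apply: emeasurable_funM; last by apply: measurableT_comp => //; exact: measurable_tv.
  by apply/measurable_EFinP; exact: measurable_haar_weight.
have f0 z : (0 <= f z)%E by rewrite mule_ge0 ?lee_fin ?haar_weight_ge0.
rewrite [RHS](@integral_csmul _ _ l f)// -ge0_integralZl//; last 2 first.
- exact: (measurableT_comp mf (measurable_csmul l)).
- by rewrite lee_fin prodr_ge0// => k _; exact: sqr_ge0.
apply: eq_integral => z _; rewrite /f muleA -EFinM haar_weight_csmul//.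
have [nz|nz] := boolP (nzero z); last by rewrite haar_weight_nzero// !mul0e.
by rewrite tv_csmul_exp.
Qed.

Definition unit_cube (u : Rn) : R := \prod_(j < n) \1_`[0, 1]%classic (tnth u j).

Lemma unit_cube_ge0 u : 0 <= unit_cube u.
Proof. exact: prodr_ge0. Qed.

Lemma measurable_unit_cube : measurable_fun setT unit_cube.
Proof.
apply: measurable_prod => j _.
have m1 : measurable_fun [set: MR] (\1_`[0%R, 1%R]%classic : MR -> R).
  by apply: measurable_indic; exact: measurable_itv.
exact: (measurableT_comp m1 (measurable_tnth j)).
Qed.

Lemma integral_unit_cube : (\int[volR n]_u (unit_cube u)%:E = 1)%E.
Proof.
rewrite (@integral_power_prod _ _ _ (@lebesgue_measure R) n
  (fun=> \1_`[0%R, 1%R]%classic : MR -> R)).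
- rewrite big1// => j _; rewrite integral_indic//.
  have E : @lebesgue_measure R `[0%R, 1%R]%classic = 1%E.
    by rewrite lebesgue_measure_itv/= lte_fin ltr01 sube0.
  by rewrite setIT; exact: E.
- move=> j; apply: measurable_indic; exact: measurable_itv.
- by [].
Qed.

(** The reflection appears when the roles of the translation and of [tv z] are exchanged in
    [haar_unique]. *)
Definition haar_const := haar (fun u => (unit_cube (oppt u))%:E).

(* Averaging over the group of positive scalings: both the weighted measure on C^n and
   Lebesgue measure on R^n are invariant, so they correspond up to a constant. *)
Lemma haar_unique (H : Rn -> \bar R) : measurable_fun setT H -> (forall u, 0 <= H u)%E ->
  haar H = (haar_const * \int[volR n]_u H u)%E.
Proof.
move=> mH H0.
have haar0 G : (forall u, 0 <= G u)%E -> (0 <= haar G)%E.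
  by move=> G0; apply: integral_ge0 => z _; rewrite mule_ge0// lee_fin haar_weight_ge0.
have mhw : measurable_fun setT (EFin \o haar_weight).
  by apply/measurable_EFinP; exact: measurable_haar_weight.
have muc : measurable_fun setT (EFin \o unit_cube).
  by apply/measurable_EFinP; exact: measurable_unit_cube.
pose F (p : Rn * Cm) := ((unit_cube p.1)%:E * ((haar_weight p.2)%:E * H (addt (tv p.2) p.1)))%E.
have mtv2 : measurable_fun [set: Rn * Cm] (fun p => tv p.2).
  by apply: (measurableT_comp measurable_tv); exact: measurable_snd.
have mF : measurable_fun setT F.
  apply: emeasurable_funM; first exact: (measurableT_comp muc measurable_fst).
  apply: emeasurable_funM; first exact: (measurableT_comp mhw measurable_snd).
  by apply: (measurableT_comp mH); apply: measurable_addt.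
have F0 p : (0 <= F p)%E.
  by rewrite !mule_ge0 ?lee_fin ?unit_cube_ge0 ?haar_weight_ge0.
pose G (p : Rn * Cm) := (H p.1 * ((haar_weight p.2)%:E *
    (unit_cube (addt p.1 (oppt (tv p.2))))%:E))%E.
have mG : measurable_fun setT G.
  apply: emeasurable_funM; first exact: (measurableT_comp mH measurable_fst).
  apply: emeasurable_funM; first exact: (measurableT_comp mhw measurable_snd).
  by apply: (measurableT_comp muc); apply: measurable_addt => //; exact: measurable_oppt.
have G0 p : (0 <= G p)%E.
  by rewrite !mule_ge0 ?lee_fin ?unit_cube_ge0 ?haar_weight_ge0.
(* The factor 1 is inserted as the integral of the cube, and [H] is translated by each [u] of the
   cube. *)
transitivity (\int[volR n]_u \int[V]_z F (u, z))%E.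
  rewrite -[LHS]mule1 -integral_unit_cube -ge0_integralZl//; last 2 first.
  - by move=> u _; rewrite lee_fin unit_cube_ge0.
  - exact: haar0.
  apply: eq_integral => u _; rewrite -(haar_addt u)// muleC -ge0_integralZl//.
  - apply: emeasurable_funM => //; apply: (measurableT_comp mH).
    by apply: measurable_addt => //; exact: measurable_tv.
  - by move=> z _; rewrite mule_ge0// lee_fin haar_weight_ge0.
  - by rewrite lee_fin unit_cube_ge0.
rewrite fubini_tonelli//.
(* Replacing [u] by [u - tv z] frees [H] from [z] and moves the dependence on [z] to the cube. *)
transitivity (\int[V]_z \int[volR n]_u G (u, z))%E.
  apply: eq_integral => z _; rewrite [RHS](integral_addt (tv z))//; last first.
    by apply: (measurableT_comp mG); exact: pair2_measurable.
  apply: eq_integral => u _; rewrite /F /G /=.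
  have -> : addt (addt u (tv z)) (oppt (tv z)) = u.
    by apply: eq_from_tnth => j; rewrite !tnth_mktuple addrK.
  have -> : addt u (tv z) = addt (tv z) u.
    by apply: eq_from_tnth => j; rewrite !tnth_mktuple addrC.
  by rewrite muleC -muleA muleCA.
rewrite -fubini_tonelli// -ge0_integralZl//; last by apply: haar0 => u; rewrite lee_fin unit_cube_ge0.
apply: eq_integral => u _; rewrite /haar_const.
have mG' : measurable_fun setT (fun v : Rn => (unit_cube (addt u (oppt v)))%:E).
  apply: (measurableT_comp muc); apply: measurable_addt => //.
  exact: measurable_oppt.
rewrite [X in (X * _)%E](_ : _ = haar (fun v => (unit_cube (addt u (oppt v)))%:E)).
  rewrite muleC -ge0_integralZl//.
  - apply: emeasurable_funM => //; apply: (measurableT_comp mG'); exact: measurable_tv.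
  - by move=> z _; rewrite mule_ge0 ?lee_fin ?unit_cube_ge0 ?haar_weight_ge0.
rewrite -(@haar_addt _ u mG'); last by move=> v; rewrite lee_fin unit_cube_ge0.
congr haar; apply/funext => v; congr (unit_cube _)%:E.
by apply: eq_from_tnth => j; rewrite !tnth_mktuple opprD addrA addrAC subrr sub0r.
Qed.

End radial.

(** * Geometry of the polyhedron: positivity of the inverse matrix and its columns *)

Section polyhedron.
Context {R : realType} {n : nat} (A : 'M[int]_n).
Hypothesis polA : monomial_polyhedron R A.
Local Notation MR := (@MR R).
Local Notation Cm := (@Cm R n).
Local Notation Rn := (@Rn R n).
Local Notation V := (volC n).
Local Notation B := (@Binv R n A).
Local Notation tv := (@tv R n A).
Local Notation gam := (@gam R n A).

Let detA : \det A != 0 := proj1 polA.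

Lemma cabs_mono (a : 'rV[int]_n) (z : Cm) : nzero z ->
  cabs (@mono R n a z) = expR (\sum_k (a ord0 k)%:~R * lnabs z k).
Proof.
move=> /forallP nz; rewrite cabs_prod expR_sum; apply: eq_bigr => k _.
by rewrite cabs_exprz -powR_intmul ?cabs_ge0// /powR cabs_eq0 (negPf (nz k)).
Qed.

Lemma cabs_mono_row j (z : Cm) : nzero z ->
  cabs (@mono R n (row j A) z) = expR (- (tnth (tv z) j : R)).
Proof.
move=> nz; rewrite cabs_mono// tnth_mktuple opprK; congr expR.
by apply: eq_bigr => k _; rewrite mxE.
Qed.

Lemma nzero_mono_defined a (z : Cm) : nzero z -> @mono_defined R n a z.
Proof. by move=> /forallP nz k _; exact: nz. Qed.

Lemma mpoly_nzero (z : Cm) : nzero z ->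
  @mpoly_set R n A z <-> forall j, 0 < (tnth (tv z) j : R).
Proof.
move=> nz; split => h j.
  by have [_] := h j; rewrite cabs_mono_row// expR_lt1 oppr_lt0.
by split; [exact: nzero_mono_defined|rewrite cabs_mono_row// expR_lt1 oppr_lt0].
Qed.

(** Points with positive real coordinates are enough to realise every value of the logarithmic
    coordinates. *)
Definition exp_point (x : 'I_n -> R) : Cm := [tuple ((expR (x k) : MR), (0 : MR)) | k < n].

Lemma coord_exp_point x k : @Defs.coord R n (exp_point x) k = (expR (x k))%:C%C.
Proof. by rewrite /Defs.coord tnth_mktuple. Qed.

Lemma nzero_exp_point x : nzero (exp_point x).
Proof.
apply/forallP => k; rewrite coord_exp_point -cabs_eq0 cabs_real normr_eq0.
by rewrite gt_eqF ?expR_gt0.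
Qed.

Lemma lnabs_exp_point x k : lnabs (exp_point x) k = x k.
Proof. by rewrite /lnabs coord_exp_point cabs_real ger0_norm ?expR_ge0// expRK. Qed.

Lemma exp_point_mpoly (y : 'I_n -> R) : (forall j, 0 < y j) ->
  @mpoly_set R n A (exp_point (fun k => - \sum_i B k i * y i)).
Proof.
move=> y0; apply/(mpoly_nzero (nzero_exp_point _)) => j; rewrite tnth_mktuple.
rewrite (_ : - _ = y j)//.
under eq_bigr => k _ do rewrite lnabs_exp_point mulrN mulr_sumr.
rewrite sumrN opprK exchange_big/=.
under eq_bigr => i _ do (under eq_bigr => k _ do rewrite mulrA; rewrite -mulr_suml Areal_Binv//).
rewrite (bigD1 j)//= eqxx mul1r big1 ?addr0// => i ij.
by rewrite eq_sym (negPf ij) mul0r.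
Qed.

(** Here boundedness enters. If [B k j] were negative, letting [t_j] grow with the other [t_i] fixed
    at 1 would make [|z_k|] unbounded in the polyhedron. *)
Lemma Binv_ge0 k j : 0 <= B k j.
Proof.
rewrite leNgt; apply/negP => Bneg.
have [_ [M bM]] := polA.
have h (y : 'I_n -> R) : (forall i, 0 < y i) -> - \sum_i B k i * y i <= ln M.
  move=> y0; have := bM _ (exp_point_mpoly y0) k.
  rewrite coord_exp_point cabs_real ger0_norm ?expR_ge0// => le.
  by rewrite -(expRK (- _)) ler_ln ?posrE ?expR_gt0// (lt_le_trans _ le)// expR_gt0.
pose S := \sum_i B k i.
(* With [t_j = 1 + T], [ln |z_k|] is [- S + |ln M + S| + 1], which exceeds [ln M]. *)
pose T := (`|ln M + S| + 1) / - B k j.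
have T0 : 0 < T by rewrite divr_gt0 ?oppr_gt0// ltr_wpDl.
have := h (fun i => 1 + T * (i == j)%:R).
have -> : \sum_i B k i * (1 + T * (i == j)%:R) = S + T * B k j.
  under eq_bigr => i _ do rewrite mulrDr mulr1.
  rewrite big_split/=; congr (_ + _); rewrite (bigD1 j)//= eqxx mulr1 mulrC big1 ?addr0//.
  by move=> i /negPf ->; rewrite !mulr0.
have -> : T * B k j = - (`|ln M + S| + 1).
  by rewrite /T invrN mulrN mulNr divfK// lt_eqF.
move=> /(_ _)/wrap[i|]; first by rewrite ltr_wpDr// mulr_ge0// ltW.
rewrite opprD opprK => le.
by have := ler_norm (ln M + S); lra.
Qed.

(** A sum of nonnegative entries that vanished would make a column of an invertible matrix zero. *)
Lemma gam_gt0 j : 0 < gam j.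
Proof.
have g0 : 0 <= gam j by apply: sumr_ge0 => k _; exact: Binv_ge0.
rewrite lt_neqAle g0 andbT eq_sym; apply/eqP => gz.
have Bz k : B k j = 0.
  apply/eqP; have /eqP := gz; rewrite psumr_eq0 => [|i _]; last exact: Binv_ge0.
  by move=> /allP/(_ k); rewrite mem_index_enum; apply.
have := Areal_Binv detA j j (R := R); rewrite big1 ?eqxx => [/eqP|k _]; last by rewrite Bz mulr0.
by rewrite eq_sym oner_eq0.
Qed.

(** If [A i k > 0], the off-diagonal entries of [B A = 1] in column k are vanishing sums of
    nonnegative terms, so column i of [B] is supported in row k; then [A B = 1] leaves no other
    nonzero entry in column k of [A]. Thus a sign condition on one exponent becomes a sign condition
    on a single coordinate [beta]. *)
Lemma column_ge0_single k : (forall j, 0 <= A j k) ->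
  exists j, 0 < A j k /\ forall i, i != j -> A i k = 0.
Proof.
move=> col0.
have [j Ajk] : exists j, A j k != 0.
  apply: contrapT => /forallNP hn.
  have := Binv_Areal detA k k (R := R); rewrite big1 ?eqxx => [/eqP|j _].
    by rewrite eq_sym oner_eq0.
  by have /negP/negPn/eqP -> := hn j; rewrite mulr0.
have supp i l : 0 < A i k -> l != k -> B l i = 0.
  move=> Aik lk; have := Binv_Areal detA l k (R := R); rewrite (negPf lk) => /eqP.
  rewrite psumr_eq0 => [|m _]; last by rewrite mulr_ge0 ?Binv_ge0// ler0z.
  move=> /allP/(_ i); rewrite mem_index_enum => /(_ isT).
  by rewrite mulf_eq0 intr_eq0 (gt_eqF Aik) orbF => /eqP.
have diag i l : 0 < A i k -> (A l k)%:~R * B k i = (l == i)%:R :> R.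
  move=> Aik; rewrite -(Areal_Binv detA l i) (bigD1 k)//= big1 ?addr0// => m mk.
  by rewrite (supp i m)// mulr0.
have Ajk0 : 0 < A j k by rewrite lt_neqAle eq_sym Ajk col0.
exists j; split => // i ij; apply/eqP; have /eqP := diag j i Ajk0.
rewrite (negPf ij) mulf_eq0 intr_eq0 => /orP[//|/eqP Bz].
have := diag j j Ajk0; rewrite Bz mulr0 eqxx => /eqP.
by rewrite eq_sym oner_eq0.
Qed.

End polyhedron.

(** * Positivity and finiteness of the constant relating the two measures *)

Section haar_constant.
Context {R : realType} {n : nat} (A : 'M[int]_n).
Hypothesis polA : monomial_polyhedron R A.
Local Notation MR := (@MR R).
Local Notation Cm := (@Cm R n).
Local Notation Rn := (@Rn R n).
Local Notation V := (volC n).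
Local Notation tv := (@tv R n A).
Local Notation gam := (@gam R n A).

Let detA : \det A != 0 := proj1 polA.

Lemma lebesgue_itvcc (a b : R) : a < b ->
  @lebesgue_measure R `[a, b]%classic = (b - a)%:E.
Proof. by move=> ab; rewrite lebesgue_measure_itv/= lte_fin ab -EFinB. Qed.

Lemma prode_fin_gt0 (I : Type) (r : seq I) (f : I -> \bar R) :
  (forall i, 0 < f i)%E -> (0 < \big[mule/1%E]_(i <- r) f i)%E.
Proof.
move=> f0; elim/big_ind: _ => //; exact: mule_gt0.
Qed.

Lemma haar_const_ge0 : (0 <= @haar_const R n A)%E.
Proof.
apply: integral_ge0 => z _; rewrite mule_ge0// lee_fin ?haar_weight_ge0//.
exact: unit_cube_ge0.
Qed.

(** If the constant were 0, [haar_unique] applied to the function 1 would make the Haar weight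
    integrate to 0. *)
Lemma haar_const_neq0 : @haar_const R n A != 0%E.
Proof.
apply/eqP => h0.
have := @haar_unique R n A detA (fun=> 1%E) (measurable_cst _) (fun=> lee01).
rewrite h0 mul0e => /eqP; rewrite gt_eqF//.
have mS : measurable (`[1%R, 2%R]%classic `*` `[1%R, 2%R]%classic : set (MR * MR)).
  by apply: measurableX; exact: measurable_itv.
(* On the square [[1, 2]^2] the squared modulus is at most 8, so each factor of the Haar weight is
   at least [8^-1]. *)
pose g (x : MR * MR) : R := 8^-1 * \1_(`[1%R, 2%R]%classic `*` `[1%R, 2%R]%classic) x.
have mg : measurable_fun setT g.
  by apply: measurable_funM => //; exact: measurable_indic.
have g0 x : 0 <= g x by rewrite /g mulr_ge0.
apply: (@lt_le_trans _ _ (\int[V]_z (\prod_(i < n) g (tnth z i))%:E)%E).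
  rewrite (@integral_power_prod _ _ _ leb2 n (fun=> g))//.
  apply: prode_fin_gt0 => i; rewrite /g.
  under eq_integral => x _ do rewrite EFinM.
  rewrite ge0_integralZl//; last by apply/measurable_EFinP; exact: measurable_indic.
  rewrite integral_indic// setIT /leb2/= /prod_measure product_measure1E; last 2 first.
  - exact: measurable_itv.
  - exact: measurable_itv.
  rewrite [X in (_ * (X * _))%E](_ : _ = 1%E) ?[X in (_ * (_ * X))%E](_ : _ = 1%E).
  - by rewrite !mule1 lte_fin invr_gt0.
  - by apply: (etrans (@lebesgue_itvcc 1 2 (ltr1n _ 2))); congr EFin; lra.
  - by apply: (etrans (@lebesgue_itvcc 1 2 (ltr1n _ 2))); congr EFin; lra.
apply: ge0_le_integral => //.
- by move=> z _; rewrite lee_fin prodr_ge0.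
- apply/measurable_EFinP; apply: measurable_prod => i _.
  exact: (measurableT_comp mg (measurable_tnth i)).
- apply: emeasurable_funM => //; apply/measurable_EFinP; exact: measurable_haar_weight.
- move=> z _; rewrite mule1 lee_fin; apply: ler_prod => i _; rewrite g0/= /g indicE.
  have [|_] := boolP (_ \in _); last by rewrite mulr0 invr_ge0 sqr_ge0.
  rewrite inE /= !in_itv/= => -[/andP[x1 x2] /andP[y1 y2]].
  rewrite mulr1 cabs_sqr /Defs.coord/=.
  have x4 : (tnth z i).1 ^+ 2 <= 4 :> R by nra.
  have y4 : (tnth z i).2 ^+ 2 <= 4 :> R by nra.
  have x0 : 1 <= (tnth z i).1 ^+ 2 :> R by nra.
  have y0 : 1 <= (tnth z i).2 ^+ 2 :> R by nra.
  rewrite lef_pV2 ?posrE; lra.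
Qed.

Definition cube12 (u : Rn) : R := \prod_(j < n) \1_`[1, 2]%classic (tnth u j).

Lemma haar_const_lty : (@haar_const R n A < +oo)%E.
Proof.
have m1 : measurable_fun [set: MR] (\1_`[1%R, 2%R]%classic : MR -> R).
  by apply: measurable_indic; exact: measurable_itv.
have mc : measurable_fun setT cube12.
  apply: measurable_prod => j _; exact: (measurableT_comp m1 (measurable_tnth j)).
have c0 u : 0 <= cube12 u by exact: prodr_ge0.
have := @haar_unique R n A detA (EFin \o cube12).
rewrite (@integral_power_prod _ _ _ (@lebesgue_measure R) n
  (fun=> \1_`[1%R, 2%R]%classic : MR -> R))//.
rewrite [X in (_ * X)%E]big1 => [|j _]; last first.
  rewrite integral_indic//.
  have E := @lebesgue_itvcc 1 2 (ltr1n _ 2).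
  by rewrite setIT; apply: (etrans E); congr EFin; lra.
rewrite mule1 => <-//; last by exact/measurable_EFinP.
have [_ [M bM]] := polA.
(* Where all [t_j] lie in [[1, 2]] the weight [exp (\sum_j 2 gam_j t_j)] is at most [K], and such
   points off the hyperplanes lie in the polyhedron, which is bounded. The test cube has volume
   1. *)
pose K := expR (\sum_j 4 * gam j).
pose M' := `|M| + 1.
have M'0 : - M' < M' by rewrite /M'; have := normr_ge0 M; lra.
have mS : measurable (`[- M', M']%classic `*` `[- M', M']%classic : set (MR * MR)).
  by apply: measurableX; exact: measurable_itv.
pose g (x : MR * MR) : R := \1_(`[- M', M']%classic `*` `[- M', M']%classic) x.
have mg : measurable_fun setT g by exact: measurable_indic.
have g0 x : 0 <= g x by [].
have mpg : measurable_fun setT (fun z : Cm => (\prod_(i < n) g (tnth z i))%:E).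
  apply/measurable_EFinP; apply: measurable_prod => i _.
  exact: (measurableT_comp mg (measurable_tnth i)).
apply: (@le_lt_trans _ _ (\int[V]_z (K%:E * (\prod_(i < n) g (tnth z i))%:E))%E).
  apply: ge0_le_integral => //.
  - by move=> z _; rewrite mule_ge0 ?lee_fin ?haar_weight_ge0.
  - apply: emeasurable_funM; first by apply/measurable_EFinP; exact: measurable_haar_weight.
    by apply: (measurableT_comp (f := EFin \o cube12)); [exact/measurable_EFinP|exact: measurable_tv].
  - exact: emeasurable_funM.
  - move=> z _; rewrite -!EFinM lee_fin.
    have [nz|nz] := boolP (nzero z); last first.
      by rewrite haar_weight_nzero// mul0r mulr_ge0 ?expR_ge0// prodr_ge0.
    have [hc|[j hj]] : (forall j, 1 <= (tnth (tv z) j : R) <= 2) \/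
        exists j, ~ (1 <= (tnth (tv z) j : R) <= 2).
      by have [|/existsNP] := pselect (forall j, 1 <= (tnth (tv z) j : R) <= 2); [left|right].
    - have inU : @mpoly_set R n A z.
        apply/(mpoly_nzero _ nz) => j; have /andP[h _] := hc j.
        exact: lt_le_trans h.
      have -> : cube12 (tv z) = 1.
        by apply: big1 => j _; rewrite indicE mem_set//= in_itv/=.
      have -> : \prod_(i < n) g (tnth z i) = 1.
        apply: big1 => k _; rewrite /g indicE mem_set//=; have := bM _ inU k => hk.
        have := le_trans (Re_le_cabs _) hk; have := le_trans (Im_le_cabs _) hk.
        rewrite /Defs.coord /= !in_itv/= !ler_norml => /andP[h1 h2] /andP[h3 h4].
        by have := ler_norm M; rewrite /M'; split; apply/andP; split; lra.
      rewrite !mulr1 (haar_weight_tv detA nz) ler_expR; apply: ler_sum => j _.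
      have /andP[_ h] := hc j; have := gam_gt0 polA j; nra.
    - rewrite (_ : cube12 _ = 0) ?mulr0 ?mulr_ge0 ?expR_ge0 ?prodr_ge0//.
      by rewrite /cube12 (bigD1 j)//= indicE memNset ?mul0r//= in_itv/=.
rewrite ge0_integralZl//; last 2 first.
- by move=> z _; rewrite lee_fin prodr_ge0.
- by rewrite lee_fin expR_ge0.
rewrite (@integral_power_prod _ _ _ leb2 n (fun=> g))//.
pose v := (M' - - M') * (M' - - M').
under eq_bigr => i _.
  rewrite integral_indic// setIT /leb2/= /prod_measure product_measure1E; last 2 first.
  - exact: measurable_itv.
  - exact: measurable_itv.
  rewrite [X in (X * _)%E](_ : _ = (M' - - M')%:E); last exact: lebesgue_itvcc.
  rewrite [X in (_ * X)%E](_ : _ = (M' - - M')%:E); last exact: lebesgue_itvcc.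
  rewrite -EFinM -/v.
  over.
by rewrite prodEFin -EFinM ltry.
Qed.

Definition kap : R := fine (@haar_const R n A).

Lemma haar_const_kap : @haar_const R n A = kap%:E.
Proof. by rewrite fineK// ge0_fin_numE ?haar_const_ge0// haar_const_lty. Qed.

Lemma kap_gt0 : 0 < kap.
Proof. by rewrite fine_gt0// haar_const_lty lt0e haar_const_neq0 haar_const_ge0. Qed.

Lemma integral_radial (H : Rn -> \bar R) : measurable_fun setT H -> (forall u, 0 <= H u)%E ->
  (\int[V]_z H (tv z) =
   kap%:E * \int[volR n]_u ((expR (- \sum_j 2 * gam j * (tnth u j : R)))%:E * H u))%E.
Proof.
move=> mH H0; rewrite -haar_const_kap -haar_unique//; last 2 first.
- apply: emeasurable_funM => //; apply/measurable_EFinP.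
  apply: (measurableT_comp (@measurable_expR R)); apply: measurable_funN.
  apply: measurable_sum => j; apply: measurable_funM => //; exact: measurable_tnthR.
- by move=> u; rewrite mule_ge0// lee_fin expR_ge0.
rewrite nzero_null//; last by apply: (measurableT_comp mH); exact: measurable_tv.
apply: eq_integral => z _; have [nz|nz] := boolP (nzero z); last first.
  by rewrite mule0 haar_weight_nzero// mul0e.
rewrite mule1 (haar_weight_tv detA nz) muleA -EFinM -expRD subrr expR0 mul1e.
by [].
Qed.

End haar_constant.

(** * Averages over arguments *)

Section roots_of_unity.
Context {R : realType}.
Local Notation C := R[i].

Lemma exists_prim_root K : (0 < K)%N -> exists w : C, K.-primitive_root w.
Proof.
move=> K0; pose p : {poly C} := 'X^K - 1.
have [r Dp] := closed_field_poly_normal p.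
rewrite (monicP _) ?monicXnsubC // scale1r in Dp.
have rn1 : all K.-unity_root r by apply/allP => z; rewrite -root_prod_XsubC -Dp.
have sz_r : (K < (size r).+1)%N by rewrite -(size_prod_XsubC r id) -Dp size_XnsubC.
have [|z _ hz] := hasP (has_prim_root K0 rn1 _ sz_r); last by exists z.
by rewrite -separable_prod_XsubC -Dp separable_Xn_sub_1 // pnatr_eq0 -lt0n.
Qed.

Lemma cabs_expr_eq1 (u : C) K : (0 < K)%N -> cabs (u ^+ K) = 1 -> cabs u = 1.
Proof. by move=> K0; rewrite cabsX => /eqP; rewrite pexpr_eq1 ?cabs_ge0// => /eqP. Qed.

Lemma prim_root_cabs K (w : C) : K.-primitive_root w -> cabs w = 1.
Proof.
move=> hw; apply: (@cabs_expr_eq1 _ K (prim_order_gt0 hw)).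
by rewrite (prim_expr_order hw) cabs1.
Qed.

Lemma cabs1_mulC (u : C) : cabs u = 1 -> u * u^* = 1.
Proof. by rewrite -sqrr_cabs => ->; rewrite expr1n. Qed.

(** Orthogonality of the characters of Z/K: the exponents stay below [K], so distinct ones give
    distinct characters and only the diagonal terms survive. *)
Lemma discrete_parseval K (w x : C) : K.-primitive_root w ->
  \sum_(m < K) cabs (\sum_(k < K) (w ^+ m * x) ^+ k) ^+ 2 =
  K%:R * \sum_(k < K) cabs x ^+ (2 * k).
Proof.
move=> hw; have K0 := prim_order_gt0 hw.
have ww := cabs1_mulC (prim_root_cabs hw).
have wcK : (w^*) ^+ K = 1 by rewrite -rmorphXn/= (prim_expr_order hw) rmorph1.
have orth (k l : 'I_K) : \sum_(m < K) (w ^+ k * (w^*) ^+ l) ^+ m = (k == l)%:R * K%:R.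
  have [->|kl] := eqVneq k l.
    by rewrite -exprMn ww expr1n; under eq_bigr do rewrite expr1n; rewrite sumr_const card_ord mul1r.
  set u := _ * _; have u1 : u != 1.
    apply: contra kl => /eqP u1; rewrite -val_eqE /=.
    have : w ^+ k == w ^+ l.
      rewrite -[X in X == _]mulr1 -(expr1n _ l) -ww exprMn mulrCA -/u u1 mulr1.
      by [].
    by rewrite (eq_prim_root_expr hw) !modn_small.
  rewrite mul0r; apply/eqP; have := subrX1 u K.
  rewrite /u exprMn -!exprM !(mulnC _ K) !exprM (prim_expr_order hw) wcK.
  rewrite !expr1n mulr1 subrr => /esym/eqP.
  by rewrite mulf_eq0 subr_eq0 -/u (negPf u1).
apply: complexI; rewrite rmorph_sum rmorphM rmorph_nat rmorph_sum/=.
transitivity (\sum_(k < K) \sum_(l < K)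
    (x ^+ k * (x^*) ^+ l) * \sum_(m < K) (w ^+ k * (w^*) ^+ l) ^+ m).
  under eq_bigr => m _ do rewrite sqrr_cabs rmorph_sum big_distrlr/=.
  rewrite exchange_big/=; apply: eq_bigr => k _; rewrite exchange_big/=.
  apply: eq_bigr => l _; rewrite mulr_sumr; apply: eq_bigr => m _.
  rewrite rmorphXn rmorphM rmorphXn/= !exprMn -!exprM (mulnC k) (mulnC l).
  by rewrite mulrACA mulrC.
rewrite mulr_sumr; apply: eq_bigr => k _.
rewrite (bigD1 k)//= orth eqxx mul1r big1 ?addr0 => [|l /negPf lk]; last first.
  by rewrite orth eq_sym lk mul0r mulr0.
by rewrite mulrC -exprMn rmorphXn exprM -rmorphXn/= sqrr_cabs.
Qed.

Lemma prod_exprz (I : Type) (r : seq I) (f : I -> C) (z : int) :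
  (\prod_(i <- r) f i) ^ z = \prod_(i <- r) f i ^ z.
Proof.
by elim/big_rec2: _ => [|i y1 y2 _ <-]; rewrite ?exp1rz// expfzMl.
Qed.

Lemma exprz_sum (I : Type) (r : seq I) (m : C) (f : I -> int) : m != 0 ->
  \prod_(i <- r) m ^ f i = m ^ (\sum_(i <- r) f i).
Proof.
by move=> m0; elim/big_rec2: _ => [|i y1 y2 _ ->]; rewrite ?expr0z// expfzDr.
Qed.

(* The homomorphism of the torus defined by [A] is onto: take [\det A]-th roots and
   compose with the homomorphism defined by the adjugate. *)
Lemma torus_onto n (A : 'M[int]_n) (om : 'I_n -> C) : \det A != 0 ->
  (forall j, cabs (om j) = 1) ->
  exists2 l : 'I_n -> C, (forall k, cabs (l k) = 1) &
    forall j, \prod_k l k ^ A j k = om j.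
Proof.
move=> d0 om1; set d := \det A in d0 *.
have [mu mu1 mud] : exists2 mu : 'I_n -> C, (forall j, cabs (mu j) = 1) &
    forall j, mu j ^ d = om j.
  have N0 : (0 < `|d|)%N by rewrite absz_gt0.
  (* Roots are taken of natural order, so the sign of the determinant is moved onto [om j]. *)
  exists (fun j => (`|d|%N).-root (om j ^ sgz d)) => j.
    apply: (cabs_expr_eq1 N0); rewrite rootCK// cabs_exprz om1.
    by rewrite exp1rz.
  rewrite [X in _ ^ X](intEsg d) mulrC -exprz_exp.
  rewrite (_ : (_ : C) ^ (`|d|%:Z) = om j ^ sgz d); last exact: (rootCK N0).
  rewrite exprz_exp mulz_sg d0 expr1z.
  by [].
have mu0 j : mu j != 0 by rewrite -cabs_eq0 mu1 oner_eq0.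
exists (fun k => \prod_i mu i ^ (\adj A k i)) => [k|j].
  by rewrite cabs_prod big1// => i _; rewrite cabs_exprz mu1 exp1rz.
under eq_bigr => k _ do (rewrite prod_exprz; under eq_bigr => i _ do rewrite exprz_exp mulrC).
rewrite exchange_big/=.
transitivity (\prod_i mu i ^ (d * (j == i)%:R)).
  apply: eq_bigr => i _; rewrite exprz_sum//; congr (_ ^ _).
  by have /matrixP/(_ j i) := mul_mx_adj A; rewrite !mxE mulr_natr.
rewrite (bigD1 j)//= eqxx mulr1 mud big1 ?mulr1// => i ij.
by rewrite eq_sym (negPf ij) mulr0 expr0z.
Qed.

End roots_of_unity.

Lemma sume_const {R : realType} (I : Type) (r : seq I) (c : \bar R) : (0 <= c)%E ->
  (\sum_(i <- r) c = (size r)%:R%:E * c)%E.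
Proof.
move=> c0; elim: r => [|i r IH]; first by rewrite big_nil mul0e.
by rewrite big_cons IH /= -natr1 EFinD ge0_muleDl ?lee_fin// mul1e addeC.
Qed.

Section angular_average.
Context {R : realType} {n : nat}.
Local Notation Cm := (@Cm R n).
Local Notation V := (volC n).
Variables (rad : Cm -> R) (X : 'I_n -> Cm -> R[i]).
Hypothesis mrad : measurable_fun setT rad.
Hypothesis rad_ge0 : forall z, 0 <= rad z.
Hypothesis mX : forall j, cmeas (X j).
Hypothesis X_lt1 : forall z j, rad z != 0 -> cabs (X j z) < 1.
(** The arguments of the [X j] can be turned independently by a rotation that preserves [rad]; for
    the kernel this is provided by [torus_onto]. *)
Hypothesis rotation : forall om : 'I_n -> R[i], (forall j, cabs (om j) = 1) ->
  exists2 l : 'I_n -> R[i], (forall k, cabs (l k) = 1) &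
    forall z, rad (csmul l z) = rad z /\ forall j, X j (csmul l z) = om j * X j z.

Let geom K (x : R[i]) := \sum_(k < K) x ^+ k.

(** Truncating [1 / (1 - X)] to [K] terms makes the average over K-th roots of unity an instance of
    [discrete_parseval]; the limit is taken afterwards. *)
Let trunc K (z : Cm) : R := rad z * \prod_j cabs (geom K (X j z)) ^+ 2.

Let mtrunc K : measurable_fun setT (trunc K).
Proof.
apply: measurable_funM => //; apply: measurable_prod => j _; apply: measurable_funX.
by apply: measurable_cabs; apply: cmeas_sum => k; exact: cmeasX.
Qed.

Let trunc_ge0 K z : 0 <= trunc K z.
Proof. by apply: mulr_ge0 => //; apply: prodr_ge0 => j _; exact: sqr_ge0. Qed.

Let majorant (z : Cm) : R := rad z * \prod_j (1 - cabs (X j z))^-1.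

Let mmajorant : measurable_fun setT majorant.
Proof.
(* The maximum with 0 makes the argument of [measurable_inv] nonnegative everywhere, and changes
   nothing where [rad z] is nonzero. *)
rewrite (_ : majorant = fun z => rad z * \prod_j (Num.max 0 (1 - cabs (X j z)))^-1).
  apply: measurable_funM => //; apply: measurable_prod => j _.
  apply: measurable_inv => [z|]; first by rewrite le_max lexx.
  apply: measurable_maxr; first exact: measurable_cst.
  by apply: measurable_funB; [exact: measurable_cst|exact: measurable_cabs].
apply/funext => z; rewrite /majorant; have [->|rz] := eqVneq (rad z) 0; first by rewrite !mul0r.
congr (_ * _); apply: eq_bigr => j _; congr (_^-1).
by rewrite max_r// subr_ge0 ltW// X_lt1.
Qed.

Let integral_trunc_rotate K (om : 'I_n -> R[i]) : (forall j, cabs (om j) = 1) ->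
  (\int[V]_z (trunc K z)%:E =
   \int[V]_z (rad z * \prod_j cabs (geom K (om j * X j z)) ^+ 2)%:E)%E.
Proof.
move=> /rotation[l l1 hl].
rewrite (@integral_csmul _ _ l (EFin \o trunc K)); last 3 first.
- by move=> k; rewrite -cabs_eq0 l1 oner_eq0.
- by apply/measurable_EFinP.
- by move=> z; rewrite lee_fin.
rewrite big1 ?mul1e => [|k _]; last by rewrite l1 expr1n.
apply: eq_integral => z _; rewrite /trunc/=; have [-> hX] := hl z.
by congr (_ * _)%:E; apply: eq_bigr => j _; rewrite hX.
Qed.

(** Each of the [K^n] rotations by K-th roots of unity preserves the integral. Their sum, taken
    under the integral, is a product over j of the sums computed by Parseval. *)
Let integral_trunc K : (0 < K)%N ->
  (\int[V]_z (trunc K z)%:E =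
   \int[V]_z (rad z * \prod_j \sum_(k < K) cabs (X j z) ^+ (2 * k))%:E)%E.
Proof.
move=> K0; have [w hw] := @exists_prim_root R K K0.
pose T := {ffun 'I_n -> 'I_K}.
pose Fm (m : T) z := rad z * \prod_j cabs (geom K (w ^+ m j * X j z)) ^+ 2.
have mFm m : measurable_fun setT (Fm m).
  apply: measurable_funM => //; apply: measurable_prod => j _; apply: measurable_funX.
  apply: measurable_cabs; apply: cmeas_sum => k; apply: cmeasX.
  by apply: cmeasM => //; exact: cmeas_cst.
have Fm0 m z : 0 <= Fm m z.
  by apply: mulr_ge0 => //; apply: prodr_ge0 => j _; exact: sqr_ge0.
pose N := #|T|; have N0 : (0 < N)%N by rewrite /N card_ffun !card_ord expn_gt0 K0.
have NE : N = (K ^ n)%N by rewrite /N card_ffun !card_ord.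
have E1 : (\int[V]_z (\sum_(m : T) Fm m z)%:E = \sum_(m : T) \int[V]_z (trunc K z)%:E)%E.
  under eq_integral => z _ do rewrite -sumEFin.
  rewrite ge0_integral_sum//; last 2 first.
  - by move=> m; apply/measurable_EFinP; exact: (mFm m).
  - by move=> m z _; rewrite lee_fin.
  apply: eq_bigr => m _; rewrite (integral_trunc_rotate _ (om := fun j => w ^+ m j))//.
  by move=> j; rewrite cabsX (prim_root_cabs hw) expr1n.
have E2 z : \sum_(m : T) Fm m z = N%:R * (rad z * \prod_j \sum_(k < K) cabs (X j z) ^+ (2 * k)).
  rewrite /Fm -mulr_sumr mulrCA; congr (_ * _).
  rewrite -(bigA_distr_bigA (fun j (i : 'I_K) => cabs (geom K (w ^+ i * X j z)) ^+ 2))/=.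
  under eq_bigr => j _ do rewrite /geom (discrete_parseval _ hw).
  by rewrite big_split/= prodr_const card_ord NE natrX.
move: E1; under eq_integral => z _ do rewrite E2 EFinM.
rewrite sume_const; last by apply: integral_ge0 => z _; rewrite lee_fin.
rewrite -sum1_size sum1_card -/N ge0_integralZl//; last 2 first.
- apply/measurable_EFinP; apply: measurable_funM => //; apply: measurable_prod => j _.
  apply: measurable_sum => k; apply: measurable_funX; exact: measurable_cabs.
- move=> z _; rewrite lee_fin mulr_ge0// prodr_ge0// => j _; apply: sumr_ge0 => k _.
  by rewrite exprn_ge0// cabs_ge0.
move=> h; apply/esym.
have := congr1 (fun x => (N%:R^-1)%:E * x)%E h.
by rewrite !muleA -!EFinM mulVf ?pnatr_eq0 -?lt0n// !mul1e.
Qed.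

Let geom_norm_le K z j : rad z != 0 ->
  \sum_(k < K) cabs (X j z) ^+ (2 * k) <= (1 - cabs (X j z))^-1.
Proof.
move=> rz; have r1 := X_lt1 j rz; set r := cabs _ in r1 *; have r0 : 0 <= r := cabs_ge0 _.
apply: (@le_trans _ _ (\sum_(k < K) r ^+ k)).
  apply: ler_sum => k _; rewrite mulnC exprM expr2.
  by rewrite ler_piMl ?exprn_ge0// exprn_ile1// ltW.
have h : 0 < 1 - r by rewrite subr_gt0.
rewrite -(ler_pM2l h) divff ?gt_eqF//.
rewrite -[leLHS]opprK -mulNr opprB -subrX1 opprB.
by rewrite lerBlDr lerDl exprn_ge0.
Qed.

Let geom_cvg (x : R[i]) : cabs x < 1 ->
  (fun K => cabs (geom K x) ^+ 2) @ \oo --> (cabs (1 - x) ^+ 2)^-1.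
Proof.
move=> x1.
have x1' : 1 - x != 0.
  apply/eqP => /(canRL (subrK _)); rewrite add0r => x1E.
  by move: x1; rewrite -x1E cabs1 ltxx.
have geomE K : geom K x = (1 - x ^+ K) / (1 - x).
  by apply: (canRL (mulfK x1')); rewrite /geom mulrC -[LHS]opprK -mulNr opprB -subrX1 opprB.
have lim1 : (fun K => cabs (1 - x ^+ K)) @ \oo --> (1 : R).
  have hr : (fun K => cabs x ^+ K) @ \oo --> (0 : R).
    by apply: cvg_expr; rewrite ger0_norm ?cabs_ge0.
  apply: (@squeeze_cvgr _ _ _ _ (fun K => 1 - cabs x ^+ K) (fun K => 1 + cabs x ^+ K)).
  - apply: nearW => K; rewrite -cabsX; apply/andP; split.
      have := cabsD (1 - x ^+ K) (x ^+ K); rewrite subrK cabs1; lra.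
    by have := cabsD 1 (- x ^+ K); rewrite cabs1 cabsN.
  - by rewrite -[X in _ --> X]subr0; apply: cvgB => //; exact: cvg_cst.
  - by rewrite -[X in _ --> X]addr0; apply: cvgD => //; exact: cvg_cst.
rewrite (_ : (fun K => _) = fun K => cabs (1 - x ^+ K) ^+ 2 * (cabs (1 - x) ^+ 2)^-1); last first.
  by apply/funext => K; rewrite geomE cabsM cabsV exprMn exprVn.
rewrite -[X in _ --> X]mul1r -(expr1n R 2); apply: cvgM; last exact: cvg_cst.
by rewrite !expr2; exact: cvgM.
Qed.

Lemma integral_angular_le :
  (\int[V]_z (rad z * \prod_j (cabs (1 - X j z) ^+ 2)^-1)%:E <=
   \int[V]_z (rad z * \prod_j (1 - cabs (X j z))^-1)%:E)%E.
Proof.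
have cvg_trunc z : (fun K => (trunc K z)%:E) @ \oo -->
    (rad z * \prod_j (cabs (1 - X j z) ^+ 2)^-1)%:E.
  apply: cvg_EFin; first exact: nearW.
  have [r0|r0] := eqVneq (rad z) 0.
    rewrite r0 mul0r (_ : (fun K => _) = fun=> 0); first exact: cvg_cst.
    by apply/funext => K; rewrite /trunc /= r0 mul0r.
  apply: cvgM; first exact: cvg_cst.
  apply: cvg_big => [|j _]; first exact: mul_continuous.
  exact/geom_cvg/X_lt1.
(* The sequence is shifted because the average over K-th roots of unity requires [K > 0]. *)
have cvg_truncS z : (fun K => (trunc K.+1 z)%:E) @ \oo -->
    (rad z * \prod_j (cabs (1 - X j z) ^+ 2)^-1)%:E.
  by have := cvg_trunc z; rewrite -(cvg_shiftS (fun K => (trunc K z)%:E)).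
apply: (@le_trans _ _ (\int[V]_z limn_einf (fun K => (trunc K.+1 z)%:E))%E).
  rewrite le_eqVlt; apply/orP; left; apply/eqP; apply: eq_integral => z _.
  by rewrite (cvg_limn_einf_sup (cvg_truncS z)).
apply: (le_trans (fatou _ _ _ _)) => //.
- by move=> K; exact/measurable_EFinP.
- by move=> K z _; rewrite lee_fin.
(* The lower limit is a limit of infima over tails, each at most its first term, so a bound uniform
   in [K] is enough. *)
rewrite limn_einf_lim; apply: lime_le; first exact: is_cvg_einfs.
apply: nearW => K; apply: (@le_trans _ _ (\int[V]_z (trunc K.+1 z)%:E)%E).
  by apply: ereal_inf_lbound; exists K => /=.
rewrite integral_trunc//; apply: ge0_le_integral => //.
- move=> z _; rewrite lee_fin mulr_ge0// prodr_ge0// => j _; apply: sumr_ge0 => k _.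
  by rewrite exprn_ge0// cabs_ge0.
- apply/measurable_EFinP; apply: measurable_funM => //; apply: measurable_prod => j _.
  apply: measurable_sum => k; apply: measurable_funX; exact: measurable_cabs.
- exact/measurable_EFinP.
- move=> z _; rewrite lee_fin; have [->|rz] := eqVneq (rad z) 0; first by rewrite !mul0r.
  apply: ler_wpM2l => //; apply: ler_prod => j _; rewrite geom_norm_le// andbT.
  by apply: sumr_ge0 => k _; rewrite exprn_ge0// cabs_ge0.
Qed.

End angular_average.

(** * One-variable integrals *)

Section one_dimensional.
Context {R : realType}.
Local Notation leb := (@lebesgue_measure R).

Lemma powR_continuous (r a : R) : 0 < a -> {for a, continuous (fun t : R => t `^ r)}.
Proof.
move=> a0; apply/differentiable_continuous/derivable1_diffP.
by apply: derivable_powR; rewrite in_itv/= a0.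
Qed.

Lemma integral_powR_itv (r a b : R) : 0 < a -> a < b -> r + 1 != 0 ->
  (\int[leb]_(t in `[a, b]) (t `^ r)%:E =
   ((b `^ (r + 1) - a `^ (r + 1)) / (r + 1))%:E)%E.
Proof.
move=> a0 ab r1.
pose F t : R := (r + 1)^-1 * t `^ (r + 1).
have dF x : 0 < x -> derivable F x 1.
  move=> x0; apply: derivableM; first exact: derivable_cst.
  by apply: derivable_powR; rewrite in_itv/= x0.
have cF x : 0 < x -> {for x, continuous F}.
  by move=> x0; apply/differentiable_continuous/derivable1_diffP/dF.
have b0 : 0 < b := lt_trans a0 ab.
rewrite (@continuous_FTC2 _ _ F)//.
- by rewrite -EFinB /F -mulrBr mulrC.
- apply: continuous_in_subspaceT => x; rewrite inE/= in_itv/= => /andP[ax _].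
  by apply: powR_continuous; exact: lt_le_trans ax.
- split.
  + by move=> x; rewrite in_itv/= => /andP[ax _]; apply: dF; exact: lt_trans ax.
  + by apply: cvg_at_right_filter; exact: cF.
  + by apply: cvg_at_left_filter; exact: cF.
- move=> x; rewrite in_itv/= => /andP[ax _]; have x0 := lt_trans a0 ax.
  rewrite /F derive1E deriveZ; last by apply: derivable_powR; rewrite in_itv/= x0.
  rewrite -derive1E powR_derive1; last by rewrite in_itv/= x0.
  by rewrite addrK /GRing.scale/= mulrA mulVf// mul1r.
Qed.

Local Notation MR := (@MR R).

Lemma measurable_ltb d (T : measurableType d) (f g : T -> R) :
  measurable_fun setT f -> measurable_fun setT g ->
  measurable_fun [set: T] (fun x => (f x < g x)%R%:R : R).
Proof.
move=> mf mg; rewrite (_ : (fun _ => _) = fun x => if f x < g x then 1 else 0).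
  apply: measurable_fun_ifT; [exact: measurable_fun_ltr|exact: measurable_cst..].
by apply/funext => x; case: ifP.
Qed.

Lemma measurable_powRMR (r : R) : measurable_fun [set: MR] (fun t : MR => (t : R) `^ r : R).
Proof. exact: measurable_powR. Qed.

Lemma ge0_integral_mkcond_bool (D : set MR) (b : MR -> bool) (f : MR -> R) :
  measurable D -> (forall t, D t <-> b t) ->
  (\int[leb]_t ((b t)%:R * f t)%:E = \int[leb]_(t in D) (f t)%:E)%E.
Proof.
move=> mD Db; rewrite [RHS]integral_mkcond; apply: eq_integral => t _.
rewrite patchE; case: ifPn => [|]; rewrite ?inE ?notin_setE => h.
  by have /Db -> := h; rewrite mul1r.
by case E : (b t); [exfalso; apply: h; apply/Db|rewrite mul0r].
Qed.

Lemma integral_exhaustion_le (F : nat -> set MR) (f : MR -> R) (C : \bar R) :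
  nondecreasing_seq F -> (forall k, measurable (F k)) ->
  measurable_fun setT f -> (forall t, 0 <= f t) ->
  (forall k, \int[leb]_(t in F k) (f t)%:E <= C)%E ->
  (\int[leb]_(t in \bigcup_k F k) (f t)%:E <= C)%E.
Proof.
move=> ndF mF mf f0 bd.
have cv := @ge0_nondecreasing_set_cvg_integral _ _ _ F (EFin \o f) leb ndF mF.
have {}cv := cv (fun k => measurable_funTS ((measurable_EFinP _ _).2 mf)).
have {}cv := cv (fun k x _ => f0 x).
rewrite -(cvg_lim _ cv)//; apply: lime_le; first by apply/cvg_ex; eexists; exact: cv.
exact: nearW.
Qed.

Lemma integral_powR01_le (s : R) : 0 < s < 1 ->
  (\int[leb]_t ((0 < (t : R) <= 1)%R%:R * (t : R) `^ (- s))%:E <= ((1 - s)^-1)%:E)%E.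
Proof.
move=> /andP[s0 s1].
(* Starting at [k + 2] keeps every interval nondegenerate, as [integral_powR_itv] requires. *)
pose F (k : nat) : set MR := `[k.+2%:R^-1, 1]%classic.
have FU : \bigcup_k F k = `]0%R, 1%R]%classic.
  apply/seteqP; split => [t [k _]|t]; rewrite /F /= !in_itv/=.
    by move=> /andP[h ->]; rewrite andbT (lt_le_trans _ h)// invr_gt0.
  move=> /andP[t0 t1]; exists (Num.truncn t^-1) => //=; rewrite in_itv/= t1 andbT.
  rewrite -[leRHS]invrK lef_pV2 ?posrE ?invr_gt0 ?ltr0n//.
  apply: ltW; apply: lt_trans (truncnS_gt _) _.
  by rewrite ltr_nat.
rewrite (@ge0_integral_mkcond_bool `]0%R, 1%R]%classic)//.
rewrite -FU; apply: integral_exhaustion_le => //.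
- apply/nondecreasing_seqP => k; apply/subsetPset => t; rewrite /F /= !in_itv/=.
  move=> /andP[h ->]; rewrite andbT (le_trans _ h)// lef_pV2 ?posrE ?ltr0n//.
  by rewrite ler_nat.
- by move=> k; exact: measurable_itv.
- by move=> t; exact: powR_ge0.
- move=> k; rewrite integral_powR_itv//; last 2 first.
  + by rewrite invf_lt1 ?ltr0n// ltr1n.
  + by rewrite addrC subr_eq0 gt_eqF.
  rewrite lee_fin powR1 [- s + 1]addrC ler_piMl ?invr_ge0 ?subr_ge0 ?(ltW s1)//.
Qed.

Lemma integral_powR1y_le (s : R) : 0 < s ->
  (\int[leb]_t ((1 <= (t : R))%R%:R * (t : R) `^ (- s - 1))%:E <= (s^-1)%:E)%E.
Proof.
move=> s0.
pose F (k : nat) : set MR := `[1, k.+2%:R]%classic.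
have FU : \bigcup_k F k = `[1%R, +oo[%classic.
  apply/seteqP; split => [t [k _]|t]; rewrite /F /= !in_itv/=.
    by move=> /andP[-> _].
  rewrite andbT => t1; exists (Num.truncn t) => //=; rewrite in_itv/= t1/=.
  by apply: ltW; apply: lt_trans (truncnS_gt _) _; rewrite ltr_nat.
rewrite (@ge0_integral_mkcond_bool `[1%R, +oo[%classic); last 2 first.
- exact: measurable_itv.
- by move=> t /=; rewrite in_itv/= andbT.
rewrite -FU; apply: integral_exhaustion_le => //.
- apply/nondecreasing_seqP => k; apply/subsetPset => t; rewrite /F /= !in_itv/=.
  by move=> /andP[-> h] /=; rewrite (le_trans h)// ler_nat.
- by move=> k; exact: measurable_itv.
- by move=> t; exact: powR_ge0.
- move=> k; rewrite integral_powR_itv//; last 2 first.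
  + by rewrite ltr1n.
  + by rewrite subrK oppr_eq0 gt_eqF.
  rewrite lee_fin subrK powR1 invrN mulrN -mulNr opprB ler_piMl ?invr_ge0 ?(ltW s0)//.
Qed.

Lemma integral_expR_pos (c : R) : 0 < c ->
  (\int[leb]_t ((0 < (t : R))%R%:R * expR (- (c * t)))%:E = (c^-1)%:E)%E.
Proof.
move=> c0.
have me : measurable_fun [set: MR] (fun t : MR => expR (- (c * (t : R))) : R).
  apply: (measurableT_comp (@measurable_expR R)); apply: measurable_funN.
  by apply: measurable_funM => //; exact: measurable_MR.
rewrite (@ge0_integral_mkcond_bool `]0%R, +oo[%classic); last 2 first.
- exact: measurable_itv.
- by move=> t /=; rewrite in_itv/= andbT.
rewrite integral_itv_obnd_cbnd; last by apply/measurable_EFinP; exact: measurable_funTS.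
have := integral_exponential_pdf c0.
rewrite [X in X = _ -> _](_ : _ = (c%:E * \int[leb]_(x in `[0%R, +oo[) (expR (- (c * x)))%:E)%E).
  move=> /(congr1 (fun x => (c^-1)%:E * x)%E).
  by rewrite muleA -EFinM mulVf ?gt_eqF// mul1e mule1.
rewrite -ge0_integralZl//; last 2 first.
- by apply/measurable_EFinP; exact: measurable_funTS.
- by rewrite lee_fin ltW.
rewrite [RHS]integral_mkcond; apply: eq_integral => x _.
by rewrite /exponential_pdf !patchE; case: ifP => _ //; rewrite mulNr.
Qed.

Lemma integral_expR_neg (c : R) : c <= 0 ->
  (\int[leb]_t ((0 < (t : R))%R%:R * expR (- (c * t)))%:E = +oo)%E.
Proof.
move=> c0.
have me : measurable_fun [set: MR] (fun t : MR => expR (- (c * (t : R))) : R).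
  apply: (measurableT_comp (@measurable_expR R)); apply: measurable_funN.
  by apply: measurable_funM => //; exact: measurable_MR.
rewrite (@ge0_integral_mkcond_bool `]0%R, +oo[%classic); last 2 first.
- exact: measurable_itv.
- by move=> t /=; rewrite in_itv/= andbT.
apply/eqP; rewrite -leye_eq.
apply: (@le_trans _ _ (\int[leb]_(x in `]0%R, +oo[) (cst 1%E) x)%E).
  have E : leb `]0%R, +oo[%classic = +oo%E by rewrite lebesgue_measure_itv/= ltry.
  rewrite integral_cst; last exact: measurable_itv.
  by rewrite mul1e leye_eq; apply/eqP; exact: E.
apply: ge0_le_integral => //; first by apply/measurable_EFinP; exact: measurable_funTS.
move=> t /=; rewrite in_itv/= andbT => t0; rewrite lee_fin -expR0 ler_expR.
by rewrite oppr_ge0 mulr_le0_ge0// ltW.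
Qed.

Lemma measurable_posb : measurable_fun [set: MR] (fun t : MR => (0 < (t : R))%R%:R : R).
Proof. apply: measurable_ltb; [exact: measurable_cst|exact: measurable_MR]. Qed.

(* A Hilbert-type kernel: after scaling, t^-s / (x + t) integrates to a multiple of x^-s. *)
Lemma integral_hilbert_le (s x : R) : 0 < s < 1 -> 0 < x ->
  (\int[leb]_t ((0 < (t : R))%R%:R * ((t : R) `^ (- s) / (x + t)))%:E <=
   (((1 - s)^-1 + s^-1) * x `^ (- s))%:E)%E.
Proof.
move=> s01 x0; have /andP[s0 s1] := s01.
pose f (y : R) (t : MR) : R := (0 < (t : R))%R%:R * ((t : R) `^ (- s) / (y + t)).
have fE y t : f y t = (0 < (t : R))%R%:R * ((t : R) `^ (- s) * (Num.max 0 (y + t))^-1) \/ y < 0.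
  have [y0|y0] := ltP y 0; [by right|left; rewrite /f].
  have [t0|t0] := ltP 0 (t : R); last by rewrite !mul0r.
  by rewrite max_r// addr_ge0// ltW.
have mf y : 0 <= y -> measurable_fun [set: MR] (f y).
  move=> y0; rewrite (_ : f y = fun t => (0 < (t : R))%R%:R * ((t : R) `^ (- s) * (Num.max 0 (y + t))^-1)).
    apply: measurable_funM; first exact: measurable_posb.
    apply: measurable_funM; first exact: measurable_powRMR.
    apply: measurable_inv => [t|]; first by rewrite le_max lexx.
    apply: measurable_maxr; first exact: measurable_cst.
    by apply: measurable_funD; [exact: measurable_cst|exact: measurable_MR].
  by apply/funext => t; case: (fE y t) => // h; move: y0; rewrite leNgt h.
have f0 y t : 0 <= y -> 0 <= f y t.
  move=> y0; rewrite /f; have [t0|t0] := ltP 0 (t : R); last by rewrite mul0r.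
  by rewrite mul1r divr_ge0 ?powR_ge0// addr_ge0// ltW.
rewrite (@lebesgue_integral_affine _ x 0 (EFin \o f x)) ?gt_eqF//; last 2 first.
- by apply/measurable_EFinP; apply: mf; exact: ltW.
- by move=> t; rewrite lee_fin; apply: f0; exact: ltW.
rewrite gtr0_norm//.
have E t : f x (affine x 0 t) = x^-1 * x `^ (- s) * f 1 t.
  rewrite /f /affine addr0 pmulr_rgt0//; have [t0|t0] := ltP 0 (t : R); last by rewrite !mul0r mulr0.
  have -> : x + x * t = x * (1 + t) by rewrite mulrDr mulr1.
  by rewrite !mul1r powRM ?(ltW x0) ?(ltW t0)// invfM mulrACA [x `^ _ * _]mulrC.
under eq_integral => t _ do rewrite /= E EFinM.
rewrite ge0_integralZl//; last 3 first.
- by apply/measurable_EFinP; exact: mf.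
- by move=> t _; rewrite lee_fin f0.
- by rewrite lee_fin mulr_ge0 ?powR_ge0// invr_ge0 ltW.
rewrite muleA -EFinM mulrA divff ?gt_eqF// mul1r EFinM muleC.
apply: lee_wpmul2r; first by rewrite lee_fin powR_ge0.
(* After scaling to [x = 1], the denominator [1 + t] is at least 1 on [(0, 1]] and at least [t]
   beyond; the two pieces give the two summands of the constant. *)
pose g0 (t : MR) : R := (0 < (t : R) <= 1)%R%:R * (t : R) `^ (- s).
pose g1 (t : MR) : R := (1 <= (t : R))%R%:R * (t : R) `^ (- s - 1).
have mle1 : measurable_fun [set: MR] (fun t : MR => (1 <= (t : R))%R%:R : R).
  rewrite (_ : (fun _ => _) = fun t : MR => 1 - ((t : R) < 1)%R%:R).
    apply: measurable_funB; first exact: measurable_cst.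
    by apply: measurable_ltb; [exact: measurable_MR|exact: measurable_cst].
  by apply/funext => t; rewrite ltNge; case: (_ <= _); rewrite ?subr0 ?subrr.
have mg1 : measurable_fun setT g1.
  by apply: measurable_funM => //; exact: measurable_powRMR.
have mg0 : measurable_fun setT g0.
  apply: measurable_funM; last exact: measurable_powRMR.
  rewrite (_ : (fun _ => _) = fun t : MR => (0 < (t : R))%R%:R * (1 - (1 < (t : R))%R%:R)).
    apply: measurable_funM; first exact: measurable_posb.
    apply: measurable_funB; first exact: measurable_cst.
    by apply: measurable_ltb; [exact: measurable_cst|exact: measurable_MR].
  by apply/funext => t; rewrite leNgt; case: (0 < _); case: (1 < _); rewrite /= ?subr0 ?subrr ?mulr0 ?mulr1.
have g00 t : 0 <= g0 t by rewrite mulr_ge0 ?powR_ge0.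
have g10 t : 0 <= g1 t by rewrite mulr_ge0 ?powR_ge0.
apply: (@le_trans _ _ (\int[leb]_t ((g0 t)%:E + (g1 t)%:E))%E).
  apply: ge0_le_integral => //.
  - by move=> t _; rewrite lee_fin f0.
  - by apply/measurable_EFinP; exact: mf.
  - by apply: emeasurable_funD; exact/measurable_EFinP.
  - move=> t _; rewrite -EFinD lee_fin /f.
    have [t0|t0] := ltP 0 (t : R); last by rewrite mul0r addr_ge0.
    rewrite mul1r; have [t1|t1] := leP (t : R) 1.
      rewrite /g0 t0 t1 mul1r ler_wpDr// ler_piMr ?powR_ge0// invf_le1; lra.
    rewrite /g1 (ltW t1) mul1r ler_wpDl//.
    rewrite powRD; last by apply/implyP => _; rewrite gt_eqF.
    rewrite powR_inv1 ?(ltW t0)//.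
    by apply: ler_wpM2l; rewrite ?powR_ge0// lef_pV2 ?posrE; lra.
rewrite ge0_integralD//; last 4 first.
- by move=> t _; rewrite lee_fin.
- by apply/measurable_EFinP.
- by move=> t _; rewrite lee_fin.
- by apply/measurable_EFinP.
by rewrite EFinD leeD// ?integral_powR01_le ?integral_powR1y_le.
Qed.

End one_dimensional.

Section schur_kernel.
Context {R : realType}.
Local Notation leb := (@lebesgue_measure R).
Local Notation MR := (@MR R).

Lemma measurable_expR_lin d (T : measurableType d) (f : T -> R) (a : R) :
  measurable_fun setT f -> measurable_fun [set: T] (fun t => expR (- (a * f t)) : R).
Proof.
move=> mf; apply: (measurableT_comp (@measurable_expR R)); apply: measurable_funN.
by apply: measurable_funM.
Qed.

(** From [exp x >= 1 + x]; the right side is [(1 - (1 + x)^-1)^-1]. *)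
Lemma inv_1_sub_expR_le (x : R) : 0 < x -> (1 - expR (- x))^-1 <= 1 + x^-1.
Proof.
move=> x0.
have e1 : 0 < 1 - expR (- x) by rewrite subr_gt0 expR_lt1 oppr_lt0.
have h : expR (- x) <= (1 + x)^-1.
  rewrite expRN lef_pV2 ?posrE ?expR_gt0//; first exact: expR_ge1Dx.
  by rewrite addr_gt0.
have -> : 1 + x^-1 = (1 - (1 + x)^-1)^-1.
  by field; rewrite ?gt_eqF//; lra.
have h1 : (1 + x)^-1 < 1 by rewrite invf_lt1; lra.
by rewrite lef_pV2 ?posrE//; lra.
Qed.

(** The inverse factor is at most 1 plus a multiple of [1 / (x + t)]. The second part is the Hilbert
    kernel and gives [x^(-s)]; the first gives only a constant, which [x^(-s) exp (b x)] absorbs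
    because [b > 0]. *)
Lemma integral_schur_le (a b s al be : R) : 0 < a -> 0 < b -> 0 < s < 1 -> 0 < al -> 0 < be ->
  exists2 M : R, 0 <= M & forall x, 0 < x ->
  (\int[leb]_t ((0 < (t : R))%R%:R * (expR (- (a * t)) * ((t : R) `^ (- s) *
       (1 - expR (- (al * x + be * t)))^-1)))%:E <=
   (M * (x `^ (- s) * expR (b * x)))%:E)%E.
Proof.
move=> a0 b0 s01 al0 be0; have /andP[s0 s1] := s01.
(* This gives [al x + be t >= m (x + t)]. *)
pose m := Num.min al be; have m0 : 0 < m by rewrite lt_min al0.
pose C0 := (1 - s)^-1 + a^-1.
pose C1 := (1 - s)^-1 + s^-1.
have C00 : 0 <= C0 by rewrite addr_ge0// invr_ge0 ?subr_ge0 ltW.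
have C10 : 0 <= C1 by rewrite addr_ge0// invr_ge0 ?subr_ge0 ltW.
(* The factor [1 + b^-1] comes from [x^s <= 1 + x <= (1 + b^-1) (1 + b x) <= (1 + b^-1) exp (b
   x)]. *)
pose M := C0 * (1 + b^-1) + m^-1 * C1.
exists M; first by rewrite addr_ge0// mulr_ge0// ?addr_ge0// invr_ge0 ltW.
move=> x x0.
pose g0 (t : MR) : R := (0 < (t : R) <= 1)%R%:R * (t : R) `^ (- s).
pose g1 (t : MR) : R := (0 < (t : R))%R%:R * expR (- (a * t)).
pose g2 (t : MR) : R := (0 < (t : R))%R%:R * ((t : R) `^ (- s) / (x + t)).
have g00 t : 0 <= g0 t by rewrite mulr_ge0 ?powR_ge0.
have g10 t : 0 <= g1 t by rewrite mulr_ge0 ?expR_ge0.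
have g20 t : 0 <= g2 t.
  rewrite /g2; have [t0|t0] := ltP 0 (t : R); last by rewrite mul0r.
  by rewrite mul1r divr_ge0 ?powR_ge0// addr_ge0// ltW.
have mg0 : measurable_fun setT g0.
  apply: measurable_funM; last exact: measurable_powRMR.
  rewrite (_ : (fun _ => _) = fun t : MR => (0 < (t : R))%R%:R * (1 - (1 < (t : R))%R%:R)).
    apply: measurable_funM; first exact: measurable_posb.
    apply: measurable_funB; first exact: measurable_cst.
    by apply: measurable_ltb; [exact: measurable_cst|exact: measurable_MR].
  by apply/funext => t; rewrite leNgt; case: (0 < _); case: (1 < _); rewrite /= ?subr0 ?subrr ?mulr0 ?mulr1.
have mg1 : measurable_fun setT g1.
  apply: measurable_funM; first exact: measurable_posb.
  by apply: measurable_expR_lin; exact: measurable_MR.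
have mmax (h : MR -> R) : measurable_fun setT h ->
    measurable_fun setT (fun t => (Num.max 0 (h t))^-1).
  move=> mh; apply: measurable_inv => [t|]; first by rewrite le_max lexx.
  by apply: measurable_maxr => //; exact: measurable_cst.
have mg2 : measurable_fun setT g2.
  rewrite (_ : g2 = fun t => (0 < (t : R))%R%:R * ((t : R) `^ (- s) * (Num.max 0 (x + t))^-1)).
    apply: measurable_funM; first exact: measurable_posb.
    apply: measurable_funM; first exact: measurable_powRMR.
    by apply: mmax; apply: measurable_funD; [exact: measurable_cst|exact: measurable_MR].
  apply/funext => t; rewrite /g2; have [t0|t0] := ltP 0 (t : R); last by rewrite !mul0r.
  by rewrite max_r// addr_ge0// ltW.
pose F (t : MR) : R := (0 < (t : R))%R%:R * (expR (- (a * t)) * ((t : R) `^ (- s) *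
       (1 - expR (- (al * x + be * t)))^-1)).
have ex0 (t : R) : 0 < t -> 0 < al * x + be * t.
  by move=> t0; rewrite addr_gt0// mulr_gt0.
have mF : measurable_fun setT F.
  rewrite (_ : F = fun t => (0 < (t : R))%R%:R * (expR (- (a * t)) * ((t : R) `^ (- s) *
       (Num.max 0 (1 - expR (- (al * x + be * t))))^-1))).
    apply: measurable_funM; first exact: measurable_posb.
    apply: measurable_funM; first by apply: measurable_expR_lin; exact: measurable_MR.
    apply: measurable_funM; first exact: measurable_powRMR.
    apply: mmax; apply: measurable_funB; first exact: measurable_cst.
    apply: (measurableT_comp (@measurable_expR R)); apply: measurable_funN.
    apply: measurable_funD; first exact: measurable_cst.
    by apply: measurable_funM => //; exact: measurable_MR.
  apply/funext => t; rewrite /F; have [t0|t0] := ltP 0 (t : R); last by rewrite !mul0r.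
  by rewrite max_r// subr_ge0 expR_le1 oppr_le0 ltW// ex0.
have F0 t : 0 <= F t.
  rewrite /F; have [t0|t0] := ltP 0 (t : R); last by rewrite !mul0r.
  by rewrite mul1r !mulr_ge0 ?expR_ge0 ?powR_ge0// invr_ge0 subr_ge0 expR_le1 oppr_le0 ltW// ex0.
have FM t : F t <= g0 t + g1 t + m^-1 * g2 t.
  rewrite /F; have [t0|t0] := ltP 0 (t : R); last first.
    by rewrite mul0r !addr_ge0// mulr_ge0// invr_ge0 ltW.
  rewrite mul1r.
  have e1 : expR (- (a * t)) <= 1 by rewrite expR_le1 oppr_le0 mulr_ge0// ltW.
  have p0 : 0 <= (t : R) `^ (- s) := powR_ge0 _ _.
  have xt : 0 < x + t by rewrite addr_gt0.
  have le1 : (1 - expR (- (al * x + be * t)))^-1 <= 1 + m^-1 / (x + t).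
    apply: (le_trans (inv_1_sub_expR_le (ex0 _ t0))); rewrite lerD2l -invfM.
    rewrite lef_pV2 ?posrE ?ex0// ?mulr_gt0// mulrDr lerD// ler_pM2r//.
      by rewrite ge_min lexx.
    by rewrite ge_min lexx orbT.
  apply: (@le_trans _ _ (expR (- (a * t)) * ((t : R) `^ (- s) * (1 + m^-1 / (x + t))))).
    by rewrite ler_wpM2l ?expR_ge0// ler_wpM2l.
  rewrite [_ `^ _ * _]mulrDr mulr1 mulrDr; apply: lerD.
    rewrite /g0 /g1 t0/=; have [t1|t1] := leP (t : R) 1.
      by rewrite !mul1r; apply: ler_wpDr; rewrite ?expR_ge0// ler_piMl.
    rewrite mul0r add0r mul1r ler_piMr ?expR_ge0//.
    rewrite powRN invf_le1 ?powR_gt0// -(powRr0 (t : R)) ler_powR// ?(ltW t1)// ltW//.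
  rewrite /g2 t0 mul1r; apply: (@le_trans _ _ ((t : R) `^ (- s) * (m^-1 / (x + t)))).
    by rewrite ler_piMl// mulr_ge0// divr_ge0 ?invr_ge0 ?ltW.
  by rewrite mulrCA.
have E0 : (\int[leb]_t (g0 t)%:E <= ((1 - s)^-1)%:E)%E by exact: integral_powR01_le.
have E1 : (\int[leb]_t (g1 t)%:E <= (a^-1)%:E)%E by rewrite integral_expR_pos.
have E2 : (\int[leb]_t (g2 t)%:E <= (C1 * x `^ (- s))%:E)%E by exact: integral_hilbert_le.
apply: (@le_trans _ _ (\int[leb]_t ((g0 t + g1 t)%:E + (m^-1)%:E * (g2 t)%:E))%E).
  apply: ge0_le_integral => //.
  - by move=> t _; rewrite lee_fin; exact: F0.
  - by apply/measurable_EFinP.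
  - apply: emeasurable_funD; first by apply/measurable_EFinP; exact: measurable_funD.
    by apply: emeasurable_funM => //; exact/measurable_EFinP.
  - by move=> t _; rewrite -EFinM -EFinD lee_fin; exact: FM.
have mg2' : measurable_fun setT (EFin \o g2) by exact/measurable_EFinP.
rewrite ge0_integralD//; last 4 first.
- by move=> t _; rewrite lee_fin addr_ge0.
- by apply/measurable_EFinP; exact: measurable_funD.
- by move=> t _; rewrite -EFinM lee_fin mulr_ge0// invr_ge0 ltW.
- by apply: emeasurable_funM.
under eq_integral => t _ do rewrite EFinD.
rewrite ge0_integralD//; last 4 first.
- by move=> t _; rewrite lee_fin.
- by apply/measurable_EFinP.
- by move=> t _; rewrite lee_fin.
- by apply/measurable_EFinP.
rewrite ge0_integralZl//; last 2 first.
- by move=> t _; rewrite lee_fin.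
- by rewrite lee_fin invr_ge0 ltW.
apply: (@le_trans _ _ (C0%:E + (m^-1)%:E * (C1 * x `^ (- s))%:E)%E).
  rewrite /C0 EFinD; apply: leeD; first exact: leeD.
  by apply: lee_wpmul2l; rewrite ?lee_fin ?invr_ge0 ?(ltW m0).
rewrite -EFinM -EFinD lee_fin /M [leRHS]mulrDl; apply: lerD.
  rewrite -[leLHS]mulr1 -mulrA; apply: ler_wpM2l => //.
  have xs : x `^ s <= 1 + x.
    have [x1|x1] := leP x 1.
      rewrite ler_wpDr ?(ltW x0)// -(powRr0 x) ger_powR ?x0//; exact: ltW.
    by rewrite ler_wpDl// ler1_powR// ltW.
  rewrite powRN mulrCA -ler_pdivrMl ?invr_gt0 ?powR_gt0// invrK mulr1.
  apply: (le_trans xs); apply: (@le_trans _ _ ((1 + b^-1) * (1 + b * x))).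
    rewrite mulrDl mul1r mulrDr mulr1 mulKf ?gt_eqF//.
    by apply: lerD; rewrite ?lerDl ?lerDr ?invr_ge0 ?mulr_ge0 // ltW.
  by apply: ler_wpM2l; rewrite ?expR_ge1Dx// addr_ge0// invr_ge0 ltW.
rewrite -mulrA; apply: ler_wpM2l; first by rewrite invr_ge0 ltW.
rewrite [leRHS]mulrA ler_peMr ?mulr_ge0 ?powR_ge0//.
by rewrite -expR0 ler_expR mulr_ge0// ltW.
Qed.

End schur_kernel.

(** This lets a point of the polyhedron be moved onto the hyperplane [z_k = 0]: the k-th factor
    stays 1 if its exponent is 0, and otherwise the monomial vanishes. *)
Lemma cabs_prod_exprz_lt1 {R : realType} n (u v : 'I_n -> R[i]) (a : 'I_n -> int) k :
  (forall i, i != k -> v i = u i) -> v k = 0 -> 0 <= a k ->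
  cabs (\prod_i u i ^ a i) < 1 -> cabs (\prod_i v i ^ a i) < 1.
Proof.
move=> uv vk ak; rewrite [X in cabs X < 1 -> _](bigD1 k)//= [X in _ -> cabs X < 1](bigD1 k)//=.
have -> : \prod_(i < n | i != k) v i ^ a i = \prod_(i < n | i != k) u i ^ a i.
  by apply: eq_bigr => i ik; rewrite uv.
rewrite vk; have [->|a0] := eqVneq (a k) 0; first by rewrite !expr0z.
by rewrite exp0rz (negPf a0) mul0r cabs0 ltr01.
Qed.

(** * Norms of monomials and the exponent set *)

Section monomial_norms.
Context {R : realType} {n : nat} (A : 'M[int]_n) (p : R).
Hypothesis polA : monomial_polyhedron R A.
Hypothesis p1 : 1 < p.
Local Notation MR := (@MR R).
Local Notation Cm := (@Cm R n).
Local Notation Rn := (@Rn R n).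
Local Notation V := (volC n).
Local Notation B := (@Binv R n A).
Local Notation tv := (@tv R n A).
Local Notation gam := (@gam R n A).
Local Notation kap := (@kap R n A).
Local Notation U := (@mpoly_set R n A).

Let detA : \det A != 0 := proj1 polA.
Let p0 : 0 < p := lt_trans ltr01 p1.

Definition beta (a : 'rV[int]_n) (j : 'I_n) : R := \sum_k (a ord0 k)%:~R * B k j.

(** The rate of decay in [t_j] of [|e_a|^p] times the density of Lebesgue measure. *)
Definition cexp (a : 'rV[int]_n) (j : 'I_n) : R := p * beta a j + 2 * gam j.

Lemma cabs_mono_tv a (z : Cm) : nzero z ->
  cabs (@mono R n a z) = expR (- \sum_j beta a j * (tnth (tv z) j : R)).
Proof.
move=> nz; rewrite cabs_mono//; congr expR.
under eq_bigr => k _ do rewrite (lnabs_tv detA) mulrN mulr_sumr.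
rewrite sumrN; congr (- _); rewrite exchange_big/=; apply: eq_bigr => j _.
by rewrite /beta mulr_suml; apply: eq_bigr => k _; rewrite mulrA.
Qed.

Lemma row_eq_sum_beta (a : 'rV[int]_n) k : (a ord0 k)%:~R = \sum_j beta a j * (A j k)%:~R.
Proof.
under eq_bigr => j _ do rewrite mulr_suml.
rewrite exchange_big/=.
under eq_bigr => i _ do (under eq_bigr => j _ do rewrite -mulrA; rewrite -mulr_sumr (Binv_Areal detA)).
rewrite (bigD1 k)//= eqxx mulr1 big1 ?addr0// => i ik.
by rewrite (negPf ik) mulr0.
Qed.

Definition posind (u : Rn) : R := \prod_j (0 < (tnth u j : R))%R%:R.

Lemma posind_ge0 u : 0 <= posind u.
Proof. exact: prodr_ge0. Qed.

Lemma posindE u : (forall j, 0 < (tnth u j : R)) -> posind u = 1.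
Proof. by move=> h; apply: big1 => j _; rewrite h. Qed.

Lemma posind0 u : ~ (forall j, 0 < (tnth u j : R)) -> posind u = 0.
Proof. by move=> /existsNP[j /negP/negPf hj]; rewrite /posind (bigD1 j)//= hj mul0r. Qed.

Lemma measurable_posind : measurable_fun setT posind.
Proof.
by apply: measurable_prod => j _; apply: (measurableT_comp measurable_posb (measurable_tnth j)).
Qed.

Lemma posind_tv (z : Cm) : nzero z -> posind (tv z) = (`[< U z >])%:R.
Proof.
move=> nz; case: asboolP => [/(mpoly_nzero _ nz)|hz]; first exact: posindE.
by apply: posind0 => h; apply: hz; apply/(mpoly_nzero _ nz).
Qed.

Lemma measurable_tnth_tv j : measurable_fun [set: Cm] (fun z => tnth (tv z) j : R).
Proof. exact: (measurableT_comp (measurable_tnthR j) (measurable_tv A)). Qed.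

Lemma integral_polyhedron_prod (g : 'I_n -> MR -> R) :
  (forall j, measurable_fun setT (g j)) -> (forall j t, 0 <= g j t) ->
  (\int[V]_z (posind (tv z) * \prod_j g j (tnth (tv z) j))%:E =
   kap%:E * \big[mule/1]_j \int[@lebesgue_measure R]_t
     ((0 < (t : R))%R%:R * (expR (- (2 * gam j * t)) * g j t))%:E)%E.
Proof.
move=> mg g0.
pose H (u : Rn) := (posind u * \prod_j g j (tnth u j))%:E.
have mH : measurable_fun setT H.
  apply/measurable_EFinP; apply: measurable_funM; first exact: measurable_posind.
  by apply: measurable_prod => j _; exact: (measurableT_comp (mg j) (measurable_tnth j)).
have H0 u : (0 <= H u)%E by rewrite lee_fin mulr_ge0 ?posind_ge0// prodr_ge0.
rewrite (integral_radial polA (H := H))//; congr (_ * _)%E.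
pose h j (t : MR) : R := (0 < (t : R))%R%:R * (expR (- (2 * gam j * t)) * g j t).
rewrite -(@integral_power_prod _ _ _ (@lebesgue_measure R) n h).
- apply: eq_integral => u _; rewrite /H -EFinM; congr EFin.
  rewrite -sumrN expR_sum /posind -!big_split/=; apply: eq_bigr => j _.
  by rewrite mulrCA.
- move=> j; apply: measurable_funM; first exact: measurable_posb.
  apply: measurable_funM => //; apply: measurable_expR_lin; exact: measurable_MR.
- by move=> j t; rewrite mulr_ge0// mulr_ge0// expR_ge0.
Qed.

Lemma intOn_mono a :
  (intOn U (fun z => ((cabs (@mono R n a z)) `^ p)%:E) =
   kap%:E * \big[mule/1]_j \int[@lebesgue_measure R]_t
     ((0 < (t : R))%R%:R * expR (- (cexp a j * t)))%:E)%E.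
Proof.
pose g j (t : MR) : R := expR (- (p * beta a j * t)).
have mg j : measurable_fun setT (g j) by apply: measurable_expR_lin; exact: measurable_MR.
have g0 j t : 0 <= g j t by exact: expR_ge0.
transitivity (\int[V]_z (posind (tv z) * \prod_j g j (tnth (tv z) j))%:E)%E.
  apply: intCnE_nzero.
  - by move=> z; case: asboolP => // _; rewrite lee_fin powR_ge0.
  - apply/measurable_EFinP; apply: measurable_funM.
      exact: (measurableT_comp measurable_posind (measurable_tv A)).
    by apply: measurable_prod => j _; exact: (measurableT_comp (mg j) (measurable_tnth_tv j)).
  - by move=> z; rewrite lee_fin mulr_ge0 ?posind_ge0// prodr_ge0.
  - move=> z nz; rewrite posind_tv//; case: asboolP => _; last by rewrite mul0r.
    rewrite mul1r cabs_mono_tv// -expR_sum; congr EFin.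
    rewrite /powR gt_eqF ?expR_gt0// expRK; congr expR.
    by rewrite mulrN mulr_sumr -sumrN; apply: eq_bigr => j _; rewrite mulrA.
rewrite integral_polyhedron_prod//; congr (_ * _)%E; apply: eq_bigr => j _.
apply: eq_integral => t _; rewrite /g -expRD; congr (_ * expR _)%:E.
by rewrite /cexp; ring.
Qed.

Lemma intOn_mono_fin a : (forall j, 0 < cexp a j) ->
  (intOn U (fun z => ((cabs (@mono R n a z)) `^ p)%:E) = (kap * \prod_j (cexp a j)^-1)%:E)%E.
Proof.
move=> c0; rewrite intOn_mono EFinM -prodEFin; congr (_ * _)%E.
by apply: eq_bigr => j _; rewrite integral_expR_pos.
Qed.

Lemma intOn_mono_lty a :
  (intOn U (fun z => ((cabs (@mono R n a z)) `^ p)%:E) < +oo)%E <-> forall j, 0 < cexp a j.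
Proof.
split=> [|c0]; last by rewrite intOn_mono_fin// ltry.
rewrite intOn_mono => h j; rewrite ltNge; apply/negP => cj.
move: h; rewrite (bigD1 j)//= integral_expR_neg//.
(* The other factors are positive, so the infinite one is not cancelled by the convention that 0
   times [+oo] is 0. *)
have pr0 : (0 < \big[mule/1]_(i < n | i != j) \int[@lebesgue_measure R]_t
     ((0 < (t : R))%R%:R * expR (- (cexp a i * t)))%:E)%E.
  elim/big_ind: _ => //; first exact: mule_gt0.
  move=> i _; have [ci|ci] := ltP 0 (cexp a i).
    by rewrite integral_expR_pos// lte_fin invr_gt0.
  by rewrite integral_expR_neg.
by rewrite gt0_mulye// gt0_muley ?ltxx// lte_fin kap_gt0.
Qed.

(** These are the k for which the hyperplane [z_k = 0] meets the polyhedron, hence those for which a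
    negative exponent is forbidden. *)
Definition nonneg_col k := forall i, 0 <= A i k.

Lemma Sp_iff a : @Sp R n p U a <->
  (forall j, 0 < cexp a j) /\ (forall k, nonneg_col k -> 0 <= a ord0 k).
Proof.
split=> [[adef afin]|[c0 acol]].
  split; first exact/intOn_mono_lty.
  move=> k colk; rewrite leNgt; apply/negP => ak.
  (* All [t_j] equal 1 at this point of the polyhedron; replacing its k-th coordinate by 0 gives a
     point of the polyhedron where [e_a] is undefined. *)
  pose z0 : Cm := exp_point (fun k => - \sum_i B k i * 1).
  have z0U : U z0 by exact: exp_point_mpoly.
  pose z : Cm := [tuple if i == k then ((0 : MR), (0 : MR)) else tnth z0 i | i < n].
  have zk : @Defs.coord R n z k = 0 by rewrite /Defs.coord tnth_mktuple eqxx.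
  have zi i : i != k -> @Defs.coord R n z i = @Defs.coord R n z0 i.
    by move=> ik; rewrite /Defs.coord tnth_mktuple (negPf ik).
  have zU : U z.
    move=> j; split.
      move=> i; rewrite mxE => Aji; have ik : i != k.
        by apply: contraL Aji => /eqP ->; rewrite -leNgt.
      rewrite zi//; have [d _] := z0U j; apply: d; by rewrite mxE.
    have [_] := z0U j; apply: (cabs_prod_exprz_lt1 (k := k)) => //.
    by rewrite mxE; exact: colk.
  by have := adef _ zU k ak; rewrite zk eqxx.
split; last exact/intOn_mono_lty.
move=> z zU k ak; apply/eqP => zk.
have colk : nonneg_col k.
  move=> i; rewrite leNgt; apply/negP => Aik.
  by have [d _] := zU i; have := d k; rewrite mxE zk eqxx => /(_ Aik).
by have := acol k colk; rewrite leNgt ak.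
Qed.

(** Membership in S_p decouples into one such condition on each [beta a j], thanks to
    [column_ge0_single]. Each condition is closed upwards, which is what produces translates of
    N^n. *)
Definition admissible (j : 'I_n) (b : R) : Prop :=
  0 < p * b + 2 * gam j /\ ((exists k, nonneg_col k /\ 0 < A j k) -> 0 <= b).

Lemma admissible_le j b b' : b <= b' -> admissible j b -> admissible j b'.
Proof.
move=> bb' [h1 h2]; split=> [|/h2 b0]; last exact: le_trans b0 bb'.
by apply: lt_le_trans h1 _; rewrite lerD2r ler_pM2l.
Qed.

Lemma Sp_admissible a : @Sp R n p U a <-> forall j, admissible j (beta a j).
Proof.
have colE k : nonneg_col k -> exists2 j, 0 < A j k & (a ord0 k)%:~R = beta a j * (A j k)%:~R.
  move=> /(column_ge0_single polA)[j [Ajk h]]; exists j => //.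
  rewrite row_eq_sum_beta (bigD1 j)//= big1 ?addr0// => i ij.
  by rewrite h// mulr0.
rewrite Sp_iff; split=> [[c0 acol] j|adm].
  split; first exact: c0.
  move=> [k [colk Ajk]]; have := acol k colk; rewrite -(ler0z R).
  have [i [Aik h]] := column_ge0_single polA colk.
  have ij : i = j.
    by apply/eqP/negPn/negP => ij; move: Ajk; rewrite h ?ltxx// eq_sym.
  rewrite row_eq_sum_beta (bigD1 j)//= big1 ?addr0 => [|l lj]; last first.
    by rewrite h ?ij// mulr0.
  by rewrite pmulr_lge0// ltr0z.
split=> [j|k colk]; first by have [] := adm j.
have [j Ajk aE] := colE k colk.
rewrite -(ler0z R) aE pmulr_lge0 ?ltr0z//.
by have [_] := adm j; apply; exists k.
Qed.

Lemma beta_shift a (m : 'rV[int]_n) j : beta (a + m *m A) j = beta a j + (m ord0 j)%:~R.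
Proof.
rewrite /beta; under eq_bigr => k _ do rewrite !mxE rmorphD rmorph_sum/= mulrDl mulr_suml.
rewrite big_split/=; congr (_ + _); rewrite exchange_big/=.
under eq_bigr => i _ do (under eq_bigr => k _ do rewrite rmorphM/= -mulrA;
  rewrite -mulr_sumr (Areal_Binv detA)).
rewrite (bigD1 j)//= eqxx mulr1 big1 ?addr0// => i ij.
by rewrite (negPf ij) mulr0.
Qed.

Lemma beta_inj a b : (forall j, beta a j = beta b j) -> a = b.
Proof.
move=> h; apply/rowP => k; apply/eqP; rewrite -(eqr_int R) !row_eq_sum_beta.
by apply/eqP/eq_bigr => j _; rewrite h.
Qed.

(** The corner of a translate: no single coordinate of [beta] can be lowered by 1 within S_p. *)
Definition minimal_rep (a : 'rV[int]_n) : Prop :=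
  forall j, admissible j (beta a j) /\ ~ admissible j (beta a j - 1).

Definition natrow (m : {ffun 'I_n -> nat}) : 'rV[int]_n := \row_j (m j)%:Z.

Lemma Sp_decomp a : @Sp R n p U a ->
  exists r m, minimal_rep r /\ a = r + natrow m *m A.
Proof.
move=> /Sp_admissible adm.
(* Admissibility bounds [beta a j] below by [- 2 gam_j / p], so 1 can be subtracted only finitely
   often; the minimal m is the number of times it can. *)
have ex j : exists m : nat, `[< ~ admissible j (beta a j - m.+1%:R) >].
  pose x := beta a j + 2 * gam j / p.
  exists (Num.truncn `|x|); apply/asboolP => -[h _]; move: h; apply/negP.
  rewrite -leNgt mulrBr; have xs : x < (Num.truncn `|x|).+1%:R.
    by apply: le_lt_trans (ler_norm _) _; exact: truncnS_gt.
  have : p * x <= p * (Num.truncn `|x|).+1%:R by rewrite ler_pM2l// ltW.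
  rewrite /x mulrDr [p * (_ / p)]mulrC divfK ?gt_eqF//; lra.
pose m : {ffun 'I_n -> nat} := [ffun j => ex_minn (ex j)].
exists (a - natrow m *m A), m; split; last by rewrite subrK.
move=> j; have -> : beta (a - natrow m *m A) j = beta a j - (m j)%:R.
  have := beta_shift (a - natrow m *m A) (natrow m) j; rewrite subrK mxE => ->.
  by rewrite addrK.
rewrite /m ffunE; case: ex_minnP => k /asboolP hk kmin; split; last first.
  by rewrite -addrA -opprD natr1.
case: k hk kmin => [|k] hk kmin; first by rewrite subr0; exact: adm.
apply: contrapT => h; have := kmin k; rewrite ltnn => /(_ _)/wrap[].
  exact/asboolP.
by [].
Qed.

(** If [m j < m' j], then [beta r j - 1 >= beta r' j] is still admissible, against the minimality of
    [r]. *)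
Lemma decomp_inj r r' m m' : minimal_rep r -> minimal_rep r' ->
  r + natrow m *m A = r' + natrow m' *m A -> r = r' /\ m = m'.
Proof.
move=> hr hr' E.
have bE j : beta r j + (m j)%:R = beta r' j + (m' j)%:R.
  by have := congr1 (fun a => beta a j) E; rewrite !beta_shift !mxE.
have lt_contra (s s' : 'rV[int]_n) (k k' : {ffun 'I_n -> nat}) j :
    minimal_rep s -> minimal_rep s' -> beta s j + (k j)%:R = beta s' j + (k' j)%:R ->
    ~ (k j < k' j)%N.
  move=> hs hs' e lt; have [_ ns] := hs j; apply: ns.
  have [as' _] := hs' j; apply: admissible_le as'.
  have : (k j)%:R + 1 <= (k' j)%:R :> R by rewrite natr1 ler_nat.
  by lra.
have mm : m = m'.
  apply/ffunP => j; apply/eqP; rewrite eqn_leq; apply/andP.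
  split; rewrite leqNgt; apply/negP; first exact: (lt_contra r' r m' m j hr' hr (esym (bE j))).
  exact: (lt_contra r r' m m' j hr hr' (bE j)).
split=> //; apply: beta_inj => j; have := bE j; rewrite mm; exact: addIr.
Qed.

Lemma minimal_rep_Sp r m : minimal_rep r -> @Sp R n p U (r + natrow m *m A).
Proof.
move=> hr; apply/Sp_admissible => j; have [h _] := hr j.
apply: admissible_le h; rewrite beta_shift mxE lerDl; exact: ler0n.
Qed.

Lemma normpp_rep r m : minimal_rep r ->
  @normpp R n p U (r + natrow m *m A) = kap * \prod_j (cexp r j + p * (m j)%:R)^-1.
Proof.
move=> hr; have c0 j : 0 < cexp (r + natrow m *m A) j.
  by have /Sp_admissible/(_ j)[] := minimal_rep_Sp m hr.
rewrite /normpp intOn_mono_fin//=; congr (_ * _); apply: eq_bigr => j _.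
by rewrite /cexp beta_shift mxE mulrDr addrAC.
Qed.

Lemma minimal_rep_cexp_gt0 r j : minimal_rep r -> 0 < cexp r j.
Proof. by move=> /(_ j)[[]]. Qed.

(** Each [beta r j] lies between [- 2 gam_j / p] and 1, since a value above 1 could be lowered; the
    exponents are then bounded through [r = beta(r) A]. *)
Lemma minimal_rep_bounded : exists N : nat, forall r, minimal_rep r -> forall k, (`|r ord0 k| <= N)%N.
Proof.
pose L : R := 1 + \sum_j 2 * gam j / p.
have L0 : 0 <= \sum_j 2 * gam j / p.
  by apply: sumr_ge0 => j _; rewrite divr_ge0 ?mulr_ge0 ?(ltW (gam_gt0 polA j)) ?(ltW p0).
pose M := \sum_j \sum_k L * `|(A j k)%:~R| : R.
exists (Num.truncn M).+1 => r hr k.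
have bb j : `|beta r j| <= L.
  have [[b1 _] nb] := hr j.
  have g0 := gam_gt0 polA j.
  have gp : 2 * gam j / p <= \sum_j 2 * gam j / p.
    rewrite [leRHS](bigD1 j)//= lerDl; apply: sumr_ge0 => i _.
    by rewrite divr_ge0 ?mulr_ge0 ?(ltW (gam_gt0 polA i)) ?(ltW p0).
  rewrite ler_norml; apply/andP; split.
    have : - (2 * gam j / p) <= beta r j.
      by rewrite -mulNr ler_pdivrMr//; lra.
    by rewrite /L; lra.
  have : beta r j <= 1; last by rewrite /L; lra.
  rewrite leNgt; apply/negP => b; apply: nb; split; last by move=> _; lra.
  have : 0 < p * (beta r j - 1) by rewrite mulr_gt0// subr_gt0.
  by lra.
have : (`|r ord0 k|%N)%:R <= M.
  rewrite natr_absz intr_norm row_eq_sum_beta.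
  apply: (le_trans (ler_norm_sum _ _ _)); apply: ler_sum => j _.
  rewrite normrM; apply: (@le_trans _ _ (L * `|(A j k)%:~R|)).
    by apply: ler_wpM2r.
  rewrite [leRHS](bigD1 k)//= lerDl; apply: sumr_ge0 => i _.
  by rewrite mulr_ge0// addr_ge0.
move=> h; rewrite -(ler_nat R); apply: (le_trans h); apply: ltW; exact: truncnS_gt.
Qed.

End monomial_norms.

(** * Pointwise bound for the kernel *)

Section arithmetic_geometric_series.
Context {R : realType}.

(** Kept free of division, so that it is a ring identity usable over both the reals and the complex
    numbers. *)
Lemma arith_geom_closed (F : comNzRingType) (c p x : F) M :
  (1 - x) ^+ 2 * \sum_(m < M) (c + p * m%:R) * x ^+ m =
  c * (1 - x) + p * x - x ^+ M * ((c + p * M%:R) * (1 - x) + p * x).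
Proof.
elim: M => [|M IH]; first by rewrite big_ord0; ring.
rewrite big_ord_recr/= mulrDr IH -natr1 [x ^+ M.+1]exprS.
by move: (x ^+ M) (M%:R : F) => y N; ring.
Qed.

Variables (c p : R).
Hypotheses (c0 : 0 <= c) (p0 : 0 <= p).

Lemma arith_geom_le (r : R) M : 0 <= r -> r < 1 ->
  \sum_(m < M) (c + p * m%:R) * r ^+ m <= (c + p) / (1 - r) ^+ 2.
Proof.
move=> r0 r1; have h : 0 < (1 - r) ^+ 2 by rewrite exprn_gt0// subr_gt0.
rewrite ler_pdivlMr// mulrC arith_geom_closed.
have t1 : 0 <= r ^+ M * ((c + p * M%:R) * (1 - r) + p * r).
  have cM : 0 <= c + p * M%:R by rewrite addr_ge0// mulr_ge0.
  have r1' : 0 <= 1 - r by rewrite subr_ge0 ltW.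
  by rewrite mulr_ge0 ?exprn_ge0// addr_ge0// mulr_ge0.
have t2 : c * (1 - r) <= c by rewrite ler_piMr// lerBlDr lerDl.
have t3 : p * r <= p by rewrite ler_piMr// ltW.
lra.
Qed.

Lemma arith_geom_cvg0 (r : R) : 0 <= r -> r < 1 ->
  (fun M : nat => (c + p * M%:R) * r ^+ M) @ \oo --> (0 : R).
Proof.
move=> r0 r1; apply: cvg_series_cvg_0; apply: nondecreasing_is_cvgn.
  apply/nondecreasing_seqP => M; rewrite /series/= big_nat_recr//= lerDl.
  by rewrite mulr_ge0 ?exprn_ge0// addr_ge0 ?mulr_ge0 ?ler0n.
exists ((c + p) / (1 - r) ^+ 2) => _ [M _ <-].
by rewrite /series/= big_mkord; exact: arith_geom_le.
Qed.

End arithmetic_geometric_series.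

(** The denominator must be [|1 - x|^2] and not [(1 - |x|)^2], or the angular average would gain
    nothing. In the closed form, [2 c] comes from [|1 - x| <= 2], [p] from [p x], and 1 from the
    remainder of order [x^M], which tends to 0; hence large [M] only. *)
Lemma arith_geom_cabs_le {R : realType} (c p : R) (x : R[i]) :
  0 <= c -> 0 <= p -> cabs x < 1 ->
  exists M0, forall M, (M0 <= M)%N ->
  cabs (\sum_(m < M) ((c + p * m%:R)%:C%C * x ^+ m)) <= (2 * c + p + 1) / cabs (1 - x) ^+ 2.
Proof.
move=> c0 p0 x1; set r := cabs x in x1; have r0 : 0 <= r := cabs_ge0 _.
have c0' : 0 <= 2 * c + p by rewrite addr_ge0// mulr_ge0.
have p0' : 0 <= 2 * p by rewrite mulr_ge0.
have /cvgrPdist_le/(_ 1 ltr01)[M0 _ hM0] := arith_geom_cvg0 c0' p0' r0 x1.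
exists M0 => M MM0; have := hM0 M MM0; rewrite /= sub0r normrN => hM.
have x1' : 0 < cabs (1 - x) ^+ 2.
  rewrite exprn_gt0// cabs_gt0 subr_eq0; apply/eqP => x1E.
  by move: x1; rewrite /r -x1E cabs1 ltxx.
rewrite ler_pdivlMr// mulrC -cabsX -cabsM.
under eq_bigr => m _ do rewrite rmorphD rmorphM rmorph_nat/=.
rewrite arith_geom_closed.
have C1 : cabs (1 - x) <= 2.
  have := cabsD 1 (- x); rewrite cabs1 cabsN; have := ltW x1; rewrite /r; lra.
have cabsR (y : R) : 0 <= y -> cabs y%:C%C = y by move=> y0; rewrite cabs_real ger0_norm.
have T1 : cabs (c%:C%C * (1 - x)) <= c * 2 by rewrite cabsM cabsR// ler_wpM2l.
have T2 : cabs (p%:C%C * x) <= p by rewrite cabsM cabsR// ler_piMr// ltW.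
have T3 : cabs ((c%:C%C + p%:C%C * M%:R) * (1 - x)) <= (c + p * M%:R) * 2.
  have -> : c%:C%C + p%:C%C * M%:R = (c + p * M%:R)%:C%C.
    by rewrite rmorphD rmorphM rmorph_nat.
  have cp : 0 <= c + p * M%:R by rewrite addr_ge0// mulr_ge0.
  by rewrite cabsM cabsR// ler_wpM2l.
apply: (le_trans (cabsD _ _)); rewrite cabsN cabsM cabsX -/r.
have T4 : r ^+ M * cabs ((c%:C%C + p%:C%C * M%:R) * (1 - x) + p%:C%C * x) <= 1.
  apply: (@le_trans _ _ (r ^+ M * (2 * c + p + 2 * p * M%:R))); last first.
    by rewrite mulrC; apply: le_trans (ler_norm _) hM.
  apply: ler_wpM2l; first exact: exprn_ge0.
  by apply: (le_trans (cabsD _ _)); lra.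
have := cabsD (c%:C%C * (1 - x)) (p%:C%C * x); lra.
Qed.

(** The kernel is summed over boxes, but its terms factor on other finite sets. Sandwiching a box
    between two of those bounds the discrepancy by a tail of the absolute sums. *)
Lemma cabs_sum_between {R : realType} (I : eqType) (s1 s2 s3 : seq I) (f : I -> R[i]) :
  uniq s1 -> uniq s2 -> uniq s3 -> {subset s1 <= s2} -> {subset s2 <= s3} ->
  cabs (\sum_(x <- s2) f x) <= cabs (\sum_(x <- s1) f x) +
    (\sum_(x <- s3) cabs (f x) - \sum_(x <- s1) cabs (f x)).
Proof.
move=> u1 u2 u3 s12 s23.
have split_sum (V : nmodType) (g : I -> V) s : uniq s -> {subset s1 <= s} ->
    \sum_(x <- s) g x = \sum_(x <- s1) g x + \sum_(x <- s | x \notin s1) g x.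
  move=> us s1s; rewrite (bigID (mem s1))/=; congr (_ + _).
  rewrite -big_filter; apply: perm_big; apply: uniq_perm => //; first exact: filter_uniq.
  by move=> x; rewrite mem_filter /=; case: (boolP (x \in s1)) => // /s1s ->.
rewrite (split_sum _ f s2)// (split_sum _ (fun x => cabs (f x)) s3)//; last first.
  by move=> x /s12/s23.
rewrite addrAC subrr add0r; apply: (le_trans (cabsD _ _)); rewrite lerD2l.
apply: (le_trans (cabs_sum _ _ _)).
rewrite -[leLHS]big_filter -[leRHS]big_filter; set t2 := [seq x <- s2 | _]; set t3 := [seq x <- s3 | _].
have ut2 : uniq t2 by exact: filter_uniq.
have ut3 : uniq t3 by exact: filter_uniq.
have t23 : {subset t2 <= t3}.
  by move=> x; rewrite !mem_filter => /andP[-> /s23 ->].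
rewrite [leRHS](bigID (mem t2))/= -[X in _ <= X + _]big_filter.
have -> : \sum_(x <- [seq x <- t3 | mem t2 x]) cabs (f x) = \sum_(x <- t2) cabs (f x).
  apply: perm_big; apply: uniq_perm => //; first exact: filter_uniq.
  by move=> x; rewrite mem_filter /=; case: (boolP (x \in t2)) => // /t23 ->.
by rewrite lerDl sumr_ge0// => x _; exact: cabs_ge0.
Qed.

Lemma exprz_natz {R : realType} (u : R[i]) (m : nat) : u ^ m%:Z = u ^+ m.
Proof. by []. Qed.

Lemma powR_exprn {R : realType} (x a : R) m : 0 <= x -> (x ^+ m) `^ a = (x `^ a) ^+ m.
Proof. by move=> x0; rewrite -powR_mulrn// powRAC powR_mulrn// powR_ge0. Qed.

Lemma expR_powR {R : realType} (x a : R) : expR x `^ a = expR (a * x).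
Proof. by rewrite /powR gt_eqF ?expR_gt0// expRK. Qed.

Lemma mulrACA3 (F : comNzRingType) (a b c d e f : F) :
  a * b * (c * d) * (e * f) = a * c * e * (b * d * f).
Proof. by ring. Qed.

Section kernel_bound.
Context {R : realType} {n : nat} (A : 'M[int]_n) (p : R).
Hypothesis polA : monomial_polyhedron R A.
Hypothesis p1 : 1 < p.
Local Notation MR := (@MR R).
Local Notation Cm := (@Cm R n).
Local Notation tv := (@tv R n A).
Local Notation kap := (@kap R n A).
Local Notation U := (@mpoly_set R n A).
Local Notation cexp := (@cexp R n A p).
Local Notation beta := (@beta R n A).
Local Notation minimal_rep := (@minimal_rep R n A p).

Let detA : \det A != 0 := proj1 polA.
Let p0 : 0 < p := lt_trans ltr01 p1.

Definition zeta (j : 'I_n) (z : Cm) : R[i] := @mono R n (row j A) z.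

(* [kerX] is the ratio of the geometric series in direction [row j A] that appears in
   the kernel once the norms are factored out; [kerE] is its first term. *)
Definition kerX (j : 'I_n) (z w : Cm) : R[i] :=
  zeta j z * (zeta j w)^* * ((cabs (zeta j w)) `^ (p - 2))%:C%C.

Definition kerE (r : 'rV[int]_n) (z w : Cm) : R[i] :=
  @mono R n r z * (@mono R n r w)^* * ((cabs (@mono R n r w)) `^ (p - 2))%:C%C.

Definition natrowf M (m : {ffun 'I_n -> 'I_M}) : {ffun 'I_n -> nat} := [ffun j => m j : nat].

Lemma mono_shift r m (z : Cm) : nzero z ->
  @mono R n (r + natrow m *m A) z = @mono R n r z * \prod_j zeta j z ^+ m j.
Proof.
move=> /forallP nz; rewrite /zeta /mono.
under [X in _ = _ * X]eq_bigr => j _ do rewrite -exprz_natz prod_exprz.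
rewrite exchange_big/= -big_split/=; apply: eq_bigr => k _.
rewrite !mxE expfzDr ?nz//; congr (_ * _).
under [RHS]eq_bigr => j _ do rewrite exprz_exp mxE.
rewrite exprz_sum ?nz//; congr (_ ^ _); apply: eq_bigr => j _.
by rewrite mxE mulrC.
Qed.

Lemma conj_prod (I : Type) (s : seq I) (f : I -> R[i]) :
  (\prod_(i <- s) f i)^* = \prod_(i <- s) (f i)^*.
Proof. exact: rmorph_prod. Qed.

Lemma prod_powR (I : Type) (s : seq I) (f : I -> R) (a : R) : (forall i, 0 <= f i) ->
  (\prod_(i <- s) f i) `^ a = \prod_(i <- s) f i `^ a.
Proof.
move=> f0; elim: s => [|i s IH]; first by rewrite !big_nil powR1.
by rewrite !big_cons powRM ?IH// prodr_ge0.
Qed.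

Lemma kerE_shift r m (z w : Cm) : nzero z -> nzero w ->
  kerE (r + natrow m *m A) z w = kerE r z w * \prod_j kerX j z w ^+ m j.
Proof.
move=> nz nw; rewrite /kerE !mono_shift// rmorphM/= cabsM powRM ?cabs_ge0//.
rewrite rmorphM/= [\prod_j kerX j z w ^+ m j](_ : _ = (\prod_j zeta j z ^+ m j) *
   (\prod_j zeta j w ^+ m j)^* * ((cabs (\prod_j zeta j w ^+ m j)) `^ (p - 2))%:C%C); last first.
  rewrite conj_prod cabs_prod prod_powR => [|j]; last exact: cabs_ge0.
  rewrite rmorph_prod -!big_split/=; apply: eq_bigr => j _.
  rewrite /kerX !exprMn rmorphXn cabsX; congr (_ * _).
  rewrite -rmorphXn/=; congr (_%:C)%C.
  by rewrite powR_exprn// cabs_ge0.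
exact: mulrACA3.
Qed.

Lemma mbk_termE r m (z w : Cm) : minimal_rep r -> nzero z -> nzero w ->
  @mbk_term R n p U (r + natrow m *m A) z w =
  kap^-1%:C%C * (kerE r z w * \prod_j ((cexp r j + p * (m j)%:R)%:C%C * kerX j z w ^+ m j)).
Proof.
move=> hr nz nw; rewrite /mbk_term normpp_rep// -/(kerE _ z w) kerE_shift//.
rewrite big_split/= -rmorph_prod -fmorphV/= invfM -prodfV.
under [X in kap^-1 * X]eq_bigr => j _ do rewrite invrK.
rewrite rmorphM/=; move: (kerE _ _ _) => E.
rewrite mulrACA [E * _]mulrC -mulrA [in LHS](mulrC (\prod_j kerX j z w ^+ m j)).
by rewrite mulrCA [E * _]mulrC.
Qed.

Lemma cabs_zeta j (z : Cm) : nzero z -> cabs (zeta j z) = expR (- (tnth (tv z) j : R)).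
Proof. exact: cabs_mono_row. Qed.

Lemma cabs_mulpow (u : R[i]) : u != 0 -> cabs u * cabs u `^ (p - 2) = cabs u `^ (p - 1).
Proof.
rewrite -cabs_gt0 => u0; rewrite -{1}(powRr1 (ltW u0)) -powRD; last first.
  by apply/implyP => _; rewrite gt_eqF.
by congr (_ `^ _); ring.
Qed.

Lemma cabs_kerX j (z w : Cm) : nzero z -> nzero w ->
  cabs (kerX j z w) = expR (- (tnth (tv z) j + (p - 1) * tnth (tv w) j : R)).
Proof.
move=> nz nw; rewrite /kerX !cabsM cabs_conj cabs_real ger0_norm ?powR_ge0//.
have zw0 : zeta j w != 0 by rewrite -cabs_gt0 cabs_zeta// expR_gt0.
move: (cabs_mulpow zw0) (cabs_zeta j nz) (cabs_zeta j nw).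
move: (zeta j z) (zeta j w) => u v e1 e2 e3.
rewrite -mulrA e1 e2 e3 expR_powR -expRD.
by congr expR; ring.
Qed.

Lemma cabs_kerE r (z w : Cm) : nzero z -> nzero w ->
  cabs (kerE r z w) = expR (- \sum_j (beta r j * (tnth (tv z) j : R) +
                                     (p - 1) * beta r j * (tnth (tv w) j : R))).
Proof.
move=> nz nw; rewrite /kerE !cabsM cabs_conj cabs_real ger0_norm ?powR_ge0//.
have zw0 : @mono R n r w != 0 by rewrite -cabs_gt0 (cabs_mono_tv polA _ nw) expR_gt0.
move: (cabs_mulpow zw0) (cabs_mono_tv polA r nz) (cabs_mono_tv polA r nw).
move: (@mono R n r z) (@mono R n r w) => u v e1 e2 e3.
rewrite -mulrA e1 e2 e3 expR_powR -expRD.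
congr expR; rewrite big_split/= opprD; congr (_ + _).
by rewrite mulrN mulr_sumr; congr (- _); apply: eq_bigr => j _; rewrite mulrA.
Qed.

Lemma cabs_kerX_lt1 j (z w : Cm) : nzero z -> nzero w ->
  0 < (tnth (tv z) j : R) -> 0 < (tnth (tv w) j : R) -> cabs (kerX j z w) < 1.
Proof.
move=> nz nw tz tw; rewrite cabs_kerX// expR_lt1 oppr_lt0 addr_gt0// mulr_gt0// subr_gt0//.
Qed.

(* S_p is the disjoint union of the translates [r + N^n A] over these finitely many [r]. *)
Definition reps_bound : nat := sval (cid (minimal_rep_bounded polA p1)).

Definition reps : seq 'rV[int]_n :=
  undup [seq a <- [seq @box_index n reps_bound t | t <- enum {: n.-tuple 'I_(reps_bound + reps_bound).+1}]
        | `[< minimal_rep a >]].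

Lemma box_indexP N (a : 'rV[int]_n) : (forall k, (`|a ord0 k| <= N)%N) ->
  exists t, a = @box_index n N t.
Proof.
move=> aN; have lt k : (absz (a ord0 k + N%:Z)%R < (N + N).+1)%N by have := aN k; lia.
exists [tuple Ordinal (lt k) | k < n]; apply/rowP => k; rewrite mxE tnth_mktuple/=.
have aN0 : 0 <= a ord0 k + N%:Z by have := aN k; lia.
by rewrite gez0_abs// addrK.
Qed.

Lemma box_index_inj N : injective (@box_index n N).
Proof.
move=> s t /rowP e; apply: eq_from_tnth => k; apply: val_inj => /=.
by have := e k; rewrite !mxE; lia.
Qed.

Lemma mem_reps r : reflect (minimal_rep r) (r \in reps).
Proof.
apply: (iffP idP); rewrite /reps mem_undup mem_filter; first by move=> /andP[/asboolP].
move=> hr; apply/andP; split; first exact/asboolP.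
rewrite /reps_bound; case: cid => N /= hN.
have [t ->] := box_indexP (hN r hr).
by apply/mapP; exists t => //; rewrite mem_enum.
Qed.

(** The numerator of [arith_geom_cabs_le] with [c = cexp r j]. *)
Definition kercst (r : 'rV[int]_n) (j : 'I_n) : R := 2 * cexp r j + p + 1.

Definition kerG (z w : Cm) : R :=
  kap^-1 * \sum_(r <- reps) (cabs (kerE r z w) *
     \prod_j (kercst r j / cabs (1 - kerX j z w) ^+ 2)).

Section fixed_points.
Variables (z w : Cm).
Hypotheses (nz : nzero z) (nw : nzero w).
Hypotheses (tz : forall j, 0 < (tnth (tv z) j : R)) (tw : forall j, 0 < (tnth (tv w) j : R)).

Let f (a : 'rV[int]_n) := @mbk_term R n p U a z w.
Let X j := kerX j z w.

Let X1 j : cabs (X j) < 1.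
Proof. exact: cabs_kerX_lt1. Qed.

(** Finite parts of S_p on which the sum of the kernel is, for each [r], a product of one-variable
    sums. *)
Let cube M : seq 'rV[int]_n :=
  [seq r + natrow (natrowf m) *m A | r <- reps, m <- enum {: {ffun 'I_n -> 'I_M}}].

Let natrowf_inj M : injective (@natrowf M).
Proof. by move=> a b /ffunP e; apply/ffunP => j; apply: val_inj; have := e j; rewrite !ffunE. Qed.

Let cube_uniq M : uniq (cube M).
Proof.
apply: allpairs_uniq; [exact: undup_uniq|exact: enum_uniq|].
move=> [r m] [r' m'] /allpairsP[[a b] [/= ha _ [-> ->]]] /allpairsP[[a' b'] [/= ha' _ [-> ->]]] /= e.
have [-> /natrowf_inj ->//] := decomp_inj polA p1 (elimT (mem_reps _) ha) (elimT (mem_reps _) ha') e.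
Qed.

Let cubeP M a : reflect (exists r (m : {ffun 'I_n -> nat}), [/\ minimal_rep r, (forall j, (m j < M)%N) &
   a = r + natrow m *m A]) (a \in cube M).
Proof.
apply: (iffP allpairsP) => [[[r m] [/mem_reps hr _ ->]]|[r [m [hr mM ->]]]].
  by exists r, (natrowf m); split => // j; rewrite ffunE.
pose m' : {ffun 'I_n -> 'I_M} := [ffun j => Ordinal (mM j)].
exists (r, m'); split => //=; [exact/mem_reps|by rewrite mem_enum|].
by congr (_ + natrow _ *m _); apply/ffunP => j; rewrite !ffunE.
Qed.

Let cube_sum (V : comNzRingType) (g : 'rV[int]_n -> V) (e : 'rV[int]_n -> V)
    (h : 'rV[int]_n -> 'I_n -> nat -> V) M :
  (forall r m, minimal_rep r -> g (r + natrow m *m A) = e r * \prod_j h r j (m j)) ->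
  \sum_(a <- cube M) g a = \sum_(r <- reps) e r * \prod_j \sum_(i < M) h r j i.
Proof.
move=> gE; rewrite big_allpairs_dep/= big_seq [RHS]big_seq; apply: eq_bigr => r /mem_reps hr.
rewrite big_enum/= bigA_distr_bigA mulr_sumr; apply: eq_bigr => m _.
by rewrite gE//; congr (_ * _); apply: eq_bigr => j _; rewrite ffunE.
Qed.

Let kap0 : 0 < kap. Proof. exact: kap_gt0. Qed.

Let cube_sum_f M : \sum_(a <- cube M) f a =
  \sum_(r <- reps) (kap^-1%:C%C * kerE r z w) *
     \prod_j \sum_(i < M) ((cexp r j + p * (i : nat)%:R)%:C%C * X j ^+ i).
Proof.
apply: (cube_sum (g := f) (e := fun r => kap^-1%:C%C * kerE r z w)
  (h := fun r j i => (cexp r j + p * i%:R)%:C%C * X j ^+ i)) => r m hr.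
by rewrite /f mbk_termE// mulrA.
Qed.

Let cube_sum_abs M : \sum_(a <- cube M) cabs (f a) =
  \sum_(r <- reps) (kap^-1 * cabs (kerE r z w)) *
     \prod_j \sum_(i < M) ((cexp r j + p * (i : nat)%:R) * cabs (X j) ^+ i).
Proof.
apply: (cube_sum (g := fun a => cabs (f a)) (e := fun r => kap^-1 * cabs (kerE r z w))
  (h := fun r j i => (cexp r j + p * i%:R) * cabs (X j) ^+ i)) => r m hr.
rewrite /f mbk_termE//; move: (kerE r z w) => E.
rewrite cabsM [cabs (E * _)]cabsM cabs_real ger0_norm ?invr_ge0 ?(ltW kap0)// mulrA cabs_prod.
congr (_ * _); apply: eq_bigr => j _; rewrite cabsM cabsX cabs_real ger0_norm//.
by rewrite addr_ge0 ?mulr_ge0 ?(ltW p0)// ltW//; exact: (minimal_rep_cexp_gt0 _ hr).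
Qed.

Let cube_sum_f_le : exists M0, forall M, (M0 <= M)%N -> cabs (\sum_(a <- cube M) f a) <= kerG z w.
Proof.
have one r j : exists M0, minimal_rep r -> forall M, (M0 <= M)%N ->
    cabs (\sum_(i < M) ((cexp r j + p * (i : nat)%:R)%:C%C * X j ^+ i)) <=
    kercst r j / cabs (1 - X j) ^+ 2.
  have [hr|hr] := pselect (minimal_rep r); last by exists 0.
  have [M0 hM0] := arith_geom_cabs_le (ltW (minimal_rep_cexp_gt0 j hr)) (ltW p0) (X1 j).
  by exists M0.
pose M0 r j := sval (cid (one r j)).
exists (\max_(r <- reps) \max_j M0 r j) => M hM.
rewrite cube_sum_f /kerG mulr_sumr; apply: (le_trans (cabs_sum _ _ _)).
rewrite big_seq [leRHS]big_seq; apply: ler_sum => r hr.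
move: (kerE r z w) => E.
rewrite cabsM [cabs (_ * E)]cabsM cabs_real ger0_norm ?invr_ge0 ?(ltW kap0)// -mulrA.
rewrite ler_wpM2l ?invr_ge0 ?(ltW kap0)// ler_wpM2l ?cabs_ge0// cabs_prod.
apply: ler_prod => j _; rewrite cabs_ge0/=.
apply: (svalP (cid (one r j))); first exact/mem_reps.
apply: leq_trans hM; apply: leq_trans (leq_bigmax_seq _ hr _) => //.
exact: (leq_bigmax j).
Qed.

Let cube_sub M M' : (M <= M')%N -> {subset cube M <= cube M'}.
Proof.
move=> MM' a /cubeP[r [m [hr mM ->]]]; apply/cubeP; exists r, m; split => // j.
exact: leq_trans (mM j) MM'.
Qed.

(** The absolute sums over cubes increase with [M] and are bounded by [arith_geom_le], hence
    converge. *)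
Let cube_cauchy (e : R) : 0 < e -> exists M1, forall M M', (M1 <= M)%N -> (M <= M')%N ->
  \sum_(a <- cube M') cabs (f a) - \sum_(a <- cube M) cabs (f a) <= e.
Proof.
move=> e0; pose T M := \sum_(a <- cube M) cabs (f a).
have c0 r j : minimal_rep r -> 0 <= cexp r j by move=> /minimal_rep_cexp_gt0/ltW.
have t0 r j (i : nat) : minimal_rep r -> 0 <= (cexp r j + p * i%:R) * cabs (X j) ^+ i.
  by move=> hr; rewrite mulr_ge0 ?exprn_ge0 ?cabs_ge0// addr_ge0 ?c0// mulr_ge0// ltW.
have ndT : nondecreasing_seq T.
  apply/nondecreasing_seqP => M; rewrite /T !cube_sum_abs big_seq [leRHS]big_seq.
  apply: ler_sum => r /mem_reps hr.
  rewrite ler_wpM2l ?mulr_ge0 ?cabs_ge0 ?invr_ge0 ?(ltW kap0)//.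
  apply: ler_prod => j _; rewrite sumr_ge0 => [|i _]; last exact: t0.
  by rewrite big_ord_recr/= lerDl t0.
have bdT : has_ubound (range T).
  exists (\sum_(r <- reps) (kap^-1 * cabs (kerE r z w)) *
     \prod_j ((cexp r j + p) / (1 - cabs (X j)) ^+ 2)) => _ [M _ <-].
  rewrite /T cube_sum_abs big_seq [leRHS]big_seq; apply: ler_sum => r /mem_reps hr.
  rewrite ler_wpM2l ?mulr_ge0 ?cabs_ge0 ?invr_ge0 ?(ltW kap0)//.
  apply: ler_prod => j _; rewrite sumr_ge0 => [|i _]; last exact: t0.
  by rewrite arith_geom_le ?c0 ?cabs_ge0 ?ltW.
have cvT := nondecreasing_cvgn ndT bdT.
have /cvgrPdist_le/(_ e e0)[M1 _ hM1] := cvT.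
exists M1 => M M' M1M MM'; rewrite -/(T M) -/(T M').
have := hM1 M M1M => /=; have := nondecreasing_cvgn_le ndT (cvgP _ cvT) M'.
rewrite (cvg_lim _ cvT)// => h1 h2; have := le_trans (ler_norm _) h2; lra.
Qed.

Let Sp_cube (s : seq 'rV[int]_n) M : (forall a, a \in s -> @Sp R n p U a) ->
  exists2 M', (M <= M')%N & {subset s <= cube M'}.
Proof.
elim: s => [|a s IH] hs; first by exists M.
have hs' b : b \in s -> @Sp R n p U b by move=> hb; apply: hs; rewrite inE hb orbT.
have [M1 MM1 sM1] := IH hs'.
have [r [m [hr aE]]] := Sp_decomp polA p1 (hs a (mem_head a s)).
exists (maxn M1 (\max_j (m j).+1)); first by rewrite (leq_trans MM1)// leq_maxl.
move=> b; rewrite inE => /predU1P[->|/sM1]; last by apply: cube_sub; exact: leq_maxl.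
apply/cubeP; exists r, m; split => // j.
by apply: leq_trans (leq_maxr _ _); exact: (leq_bigmax j).
Qed.

Let box N : seq 'rV[int]_n :=
  [seq @box_index n N t | t <- enum {: n.-tuple 'I_(N + N).+1} & `[< @Sp R n p U (@box_index n N t) >]].

Let mbk_partialE N : @mbk_partial R n p U z w N = \sum_(a <- box N) f a.
Proof. by rewrite /mbk_partial /box big_map big_filter big_enum_cond. Qed.

(** A large box contains a cube whose sum is bounded by [kerG], and lies in a larger cube; the terms
    outside the smaller cube contribute at most [e]. *)
Lemma mbk_partial_le (e : R) : 0 < e ->
  exists N0, forall N, (N0 <= N)%N -> cabs (@mbk_partial R n p U z w N) <= kerG z w + e.
Proof.
move=> e0; have [M0 hM0] := cube_sum_f_le; have [M1 hM1] := cube_cauchy e0.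
pose M := maxn M0 M1.
exists (\max_(a <- cube M) \max_k `|a ord0 k|%N) => N hN.
have cN : {subset cube M <= box N}.
  move=> a aM; have [t aE] : exists t, a = @box_index n N t.
    apply: box_indexP => k; apply: leq_trans hN.
    by apply: leq_trans (leq_bigmax_seq _ aM _) => //; exact: (leq_bigmax k).
  rewrite aE; apply: map_f; rewrite mem_filter mem_enum andbT; apply/asboolP.
  by rewrite -aE; have /cubeP[r [m [hr _ ->]]] := aM; exact: minimal_rep_Sp.
have bSp a : a \in box N -> @Sp R n p U a.
  by move=> /mapP[t]; rewrite mem_filter => /andP[/asboolP h _] ->.
have [M' MM' bM'] := @Sp_cube (box N) M bSp.
have ub : uniq (box N).
  by rewrite (map_inj_uniq (@box_index_inj N)) filter_uniq// enum_uniq.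
rewrite mbk_partialE.
apply: (le_trans (cabs_sum_between f (cube_uniq M) ub (cube_uniq M') cN bM')).
apply: lerD; first by apply: hM0; exact: leq_maxl.
by apply: hM1 => //; exact: leq_maxr.
Qed.

(* [limn] is 0 on a divergent sequence, so convergence of the real and imaginary parts
   of the partial sums need not be known. *)
Lemma mbk_le : cabs (@mbk R n p U z w) <= 2 * kerG z w.
Proof.
have G0 : 0 <= kerG z w.
  have [M0 hM0] := cube_sum_f_le; exact: le_trans (cabs_ge0 _) (hM0 M0 (leqnn _)).
have lim_le (u : nat -> R) : (forall N, `|u N| <= cabs (@mbk_partial R n p U z w N)) ->
    `|limn u| <= kerG z w.
  move=> hu; have [cu|/dvgP ->] := pselect (cvgn u); last by rewrite normr0.
  apply/ler_addgt0Pr => e e0; have [N0 hN0] := mbk_partial_le e0.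
  have near_le : \forall N \near \oo, `|u N| <= kerG z w + e.
    by exists N0 => // N hN; apply: le_trans (hu N) (hN0 N hN).
  rewrite ler_norml; apply/andP; split.
    by apply: limr_ge => //; apply: filterS near_le => N; rewrite ler_norml => /andP[].
  by apply: limr_le => //; apply: filterS near_le => N; rewrite ler_norml => /andP[].
apply: (le_trans (cabs_le_ReIm _)); rewrite mulr_natl mulr2n; apply: lerD.
  by apply: lim_le => N; exact: Re_le_cabs.
by apply: lim_le => N; exact: Im_le_cabs.
Qed.

End fixed_points.
End kernel_bound.

(** * Schur's test *)

Section schur_test.
Context {R : realType} {d : measure_display} {T : measurableType d}.
Variable mu : {sigma_finite_measure set T -> \bar R}.
Variables (p q M : R) (S : T -> bool) (K : T * T -> R) (theta : T -> R).
Hypotheses (p0 : 0 < p) (q0 : 0 < q) (pq : p^-1 + q^-1 = 1) (M0 : 0 <= M).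
Hypothesis mS : measurable_fun setT (fun z => (S z)%:R : R).
Hypothesis mK : measurable_fun setT K.
Hypothesis mtheta : measurable_fun setT theta.
Hypothesis K0 : forall x, 0 <= K x.
Hypothesis KS : forall z w, ~~ (S z && S w) -> K (z, w) = 0.
Hypothesis theta0 : forall z, S z -> 0 < theta z.
Hypothesis schur_l : forall z, S z ->
  (\int[mu]_w (K (z, w) * theta w `^ p^-1)%:E <= (M * theta z `^ p^-1)%:E)%E.
Hypothesis schur_r : forall w, S w ->
  (\int[mu]_z (K (z, w) * theta z `^ q^-1)%:E <= (M * theta w `^ q^-1)%:E)%E.

Let mpow (r : R) (f : T -> R) : measurable_fun setT f ->
  measurable_fun setT (fun z => f z `^ r).
Proof. by move=> mf; exact: (measurableT_comp (measurable_powR r) mf). Qed.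

Let pq1 : p / q + 1 = p.
Proof.
have -> : q^-1 = 1 - p^-1 by rewrite -pq addrAC subrr add0r.
by rewrite mulrBr mulr1 divff ?gt_eqF// subrK.
Qed.

(** Hoelder's inequality for the splitting [K f = (K^(1/q) theta^(1/(pq))) (K^(1/p) theta^(-1/(pq))
    f)]; the first Schur condition bounds the q-norm of the first factor. *)
Let holder_step (f : T -> R) z : measurable_fun setT f -> (forall w, 0 <= f w) -> S z ->
  ((\int[mu]_w (K (z, w) * f w)%:E) `^ p <=
   ((M * theta z `^ p^-1) `^ (p / q))%:E *
   \int[mu]_w (K (z, w) * theta w `^ (- q^-1) * f w `^ p)%:E)%E.
Proof.
move=> mf f0 Sz.
have mKz : measurable_fun setT (fun w => K (z, w)).
  by apply: (measurableT_comp mK); exact: pair1_measurable.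
pose g1 w := K (z, w) `^ q^-1 * theta w `^ (p * q)^-1.
pose g2 w := K (z, w) `^ p^-1 * (theta w `^ (- (p * q)^-1) * f w).
have mg1 : measurable_fun setT g1 by apply: measurable_funM; exact: mpow.
have mg2 : measurable_fun setT g2.
  by apply: measurable_funM; [exact: mpow|apply: measurable_funM => //; exact: mpow].
have g10 w : 0 <= g1 w by rewrite mulr_ge0 ?powR_ge0.
have g20 w : 0 <= g2 w by rewrite mulr_ge0 ?powR_ge0// mulr_ge0 ?powR_ge0.
have h := hoelder mu mg1 mg2 q0 p0 (etrans (addrC _ _) pq).
have E1 : ('N[mu]_1[EFin \o (g1 \* g2)%R] = \int[mu]_w (K (z, w) * f w)%:E)%E.
  rewrite Lnorm1; apply: eq_integral => w _.
  rewrite gee0_abs; last by rewrite lee_fin; apply: mulr_ge0; [exact: g10|exact: g20].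
  congr EFin; rewrite /g1 /g2 /=.
  (* Positivity of [theta] is known only on [S]; elsewhere [K] vanishes and so do both sides. *)
  have [Sw|Sw] := boolP (S w); last first.
    have -> : K (z, w) = 0 by rewrite KS// negb_and Sw orbT.
    by rewrite !powR0 ?invr_eq0 ?gt_eqF// !mul0r.
  rewrite mulrACA -powRD; last first.
    by apply/implyP; rewrite addrC pq oner_eq0.
  rewrite addrC pq powRr1//; congr (_ * _); rewrite mulrA -powRD.
    by rewrite subrr powRr0 mul1r.
  by apply/implyP => _; rewrite gt_eqF// theta0.
have E2 : ('N[mu]_p%:E[EFin \o g2] `^ p = \int[mu]_w (K (z, w) * theta w `^ (- q^-1) * f w `^ p)%:E)%E.
  rewrite powR_Lnorm ?gt_eqF//; apply: eq_integral => w _.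
  rewrite gee0_abs ?lee_fin//=; congr EFin; rewrite /g2 !powRM ?powR_ge0 ?mulr_ge0 ?powR_ge0//.
  rewrite -!powRrM mulVf ?gt_eqF// powRr1// mulrA; congr (_ * _ `^ _ * _).
  by rewrite invfM mulNr -mulrA [q^-1 * p]mulrC mulKf ?gt_eqF.
have E3 : ('N[mu]_q%:E[EFin \o g1] `^ q <= (M * theta z `^ p^-1)%:E)%E.
  rewrite powR_Lnorm ?gt_eqF//; apply: le_trans (schur_l Sz).
  rewrite le_eqVlt; apply/orP; left; apply/eqP; apply: eq_integral => w _.
  rewrite gee0_abs ?lee_fin//=; congr EFin; rewrite /g1 powRM ?powR_ge0//.
  rewrite -!powRrM mulVf ?gt_eqF// powRr1//; congr (_ * _ `^ _).
  by rewrite invfM -mulrA mulVf ?gt_eqF// mulr1.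
rewrite -E1 -E2.
have h2 := gt0_ler_poweR (ltW p0) _ _ h.
apply: (le_trans (h2 _ _)); rewrite ?in_itv/= ?leey ?Lnorm_ge0 ?mule_ge0 ?Lnorm_ge0//.
rewrite poweRM ?Lnorm_ge0//; apply: lee_wpmul2r; first exact: poweR_ge0.
have -> : ('N[mu]_q%:E[EFin \o g1] `^ p = ('N[mu]_q%:E[EFin \o g1] `^ q) `^ (p / q))%E.
  by rewrite -poweRrM mulrC divfK ?gt_eqF.
rewrite -poweR_EFin; apply: gt0_ler_poweR => //.
- by rewrite divr_ge0 ?ltW.
- by rewrite in_itv/= leey poweR_ge0.
- by rewrite in_itv/= leey lee_fin mulr_ge0 ?powR_ge0.
Qed.

Lemma schur_test (f : T -> R) : measurable_fun setT f -> (forall w, 0 <= f w) ->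
  (\int[mu]_z ((\int[mu]_w (K (z, w) * f w)%:E) `^ p) <=
   (M `^ p)%:E * \int[mu]_w ((S w)%:R * f w `^ p)%:E)%E.
Proof.
move=> mf f0.
(* The power [p / q] of the first Schur bound turns [theta z ^ (1/p)] into [theta z ^ (1/q)], the
   weight of the second condition, which applies once the integrals are exchanged. *)
pose G (x : T * T) : R := theta x.1 `^ q^-1 * (K x * (theta x.2 `^ (- q^-1) * f x.2 `^ p)).
have mt1 : measurable_fun [set: T * T] (fun x => theta x.1).
  exact: (measurableT_comp mtheta measurable_fst).
have mt2 : measurable_fun [set: T * T] (fun x => theta x.2).
  exact: (measurableT_comp mtheta measurable_snd).
have mf2 : measurable_fun [set: T * T] (fun x => f x.2).
  exact: (measurableT_comp mf measurable_snd).
have mG : measurable_fun setT G.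
  apply: measurable_funM; first exact: (measurableT_comp (measurable_powR q^-1) mt1).
  apply: measurable_funM => //; apply: measurable_funM.
    exact: (measurableT_comp (measurable_powR (- q^-1)) mt2).
  exact: (measurableT_comp (measurable_powR p) mf2).
have G0 x : 0 <= G x by rewrite /G !mulr_ge0 ?powR_ge0.
have mGE : measurable_fun setT (EFin \o G) by exact/measurable_EFinP.
have Mpq : 0 <= M `^ (p / q) by exact: powR_ge0.
apply: (@le_trans _ _ ((M `^ (p / q))%:E * \int[mu]_z \int[mu]_w (G (z, w))%:E)%E).
  rewrite -ge0_integralZl//; last 2 first.
  - exact: (@measurable_fun_fubini_tonelli_F _ _ _ _ _ mu _ mGE (fun x => G0 x)).
  - by move=> z _; apply: integral_ge0 => w _; rewrite lee_fin.
  apply: le_integral_nonmeasurable => z; first exact: poweR_ge0.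
  have mGz : measurable_fun setT (fun w => (G (z, w))%:E).
    by apply: (measurableT_comp mGE); exact: pair1_measurable.
  have [Sz|Sz] := boolP (S z); last first.
    rewrite [X in (X `^ p)%E](_ : _ = 0%E).
      by rewrite poweR0r ?gt_eqF// mule_ge0// integral_ge0// => w _; rewrite lee_fin.
    by apply: integral0_eq => w _; rewrite KS ?negb_and ?Sz// mul0r.
  apply: (le_trans (holder_step mf f0 Sz)).
  rewrite powRM ?powR_ge0// -powRrM mulrA mulVf ?gt_eqF// mul1r EFinM -muleA.
  apply: lee_wpmul2l; first by rewrite lee_fin.
  rewrite -ge0_integralZl//.
  - rewrite le_eqVlt; apply/orP; left; apply/eqP; apply: eq_integral => w _.
    by rewrite -EFinM /G/= !mulrA.
  - apply/measurable_EFinP; apply: measurable_funM; last exact: mpow.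
    apply: measurable_funM; last exact: mpow.
    by apply: (measurableT_comp mK); exact: pair1_measurable.
  - by move=> w _; rewrite lee_fin !mulr_ge0 ?powR_ge0.
  - by rewrite lee_fin powR_ge0.
rewrite (@fubini_tonelli _ _ _ _ _ mu mu (EFin \o G))//.
(* One factor for each Schur condition. *)
have -> : M `^ p = M `^ (p / q) * M.
  rewrite -{1}pq1 powRD ?powRr1//; apply/implyP; rewrite pq1; by rewrite gt_eqF.
rewrite EFinM -muleA; apply: lee_wpmul2l; first by rewrite lee_fin.
have mSf : measurable_fun setT (fun w => ((S w)%:R * f w `^ p)%:E).
  by apply/measurable_EFinP; apply: measurable_funM => //; exact: mpow.
rewrite -ge0_integralZl//; last by move=> w _; rewrite lee_fin mulr_ge0 ?powR_ge0.
apply: le_integral_nonmeasurable => w; first by apply: integral_ge0 => z _; rewrite lee_fin.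
have [Sw|Sw] := boolP (S w); last first.
  rewrite integral0_eq => [|z _]; first by rewrite mul0r mule0.
  by rewrite /G/= KS ?negb_and ?Sw ?orbT// mul0r mulr0.
have -> : (\int[mu]_x (EFin \o G) (x, w) =
   \int[mu]_z ((theta w `^ (- q^-1) * f w `^ p)%:E * (K (z, w) * theta z `^ q^-1)%:E))%E.
  by apply: eq_integral => z _; rewrite -EFinM /G/=; congr EFin; ring.
rewrite ge0_integralZl//; last 3 first.
- apply/measurable_EFinP; apply: measurable_funM; last exact: mpow.
  by apply: (measurableT_comp mK); exact: pair2_measurable.
- by move=> z _; rewrite lee_fin mulr_ge0 ?powR_ge0.
- by rewrite lee_fin mulr_ge0 ?powR_ge0.
apply: (@le_trans _ _ ((theta w `^ (- q^-1) * f w `^ p)%:E * (M * theta w `^ q^-1)%:E)%E).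
  by apply: lee_wpmul2l; [rewrite lee_fin mulr_ge0 ?powR_ge0|exact: schur_r].
rewrite -!EFinM lee_fin mul1r powRN.
have : theta w `^ q^-1 != 0 by rewrite gt_eqF// powR_gt0// theta0.
move: (theta w `^ q^-1) => a a0.
by rewrite [leLHS](_ : _ = M * f w `^ p)//; field.
Qed.

End schur_test.

Lemma lee_prod_fin {R : realType} (I : Type) (r : seq I) (f : I -> \bar R) (g : I -> R) :
  (forall i, 0 <= f i)%E -> (forall i, f i <= (g i)%:E)%E ->
  (\big[mule/1]_(i <- r) f i <= (\prod_(i <- r) g i)%:E)%E.
Proof.
move=> f0 fg; elim: r => [|i r IH]; first by rewrite !big_nil.
by rewrite !big_cons EFinM; apply: lee_pmul => //; exact: prodEFin_ge0.
Qed.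

(** * The common estimate behind both Schur conditions *)

Section one_sided_estimate.
Context {R : realType} {n : nat} (A : 'M[int]_n).
Hypothesis polA : monomial_polyhedron R A.
Local Notation MR := (@MR R).
Local Notation Cm := (@Cm R n).
Local Notation V := (volC n).
Local Notation tv := (@tv R n A).
Local Notation gam := (@gam R n A).
Local Notation kap := (@kap R n A).

(* The power [2 * gam j] cancels the density of Lebesgue measure, and [1 / t] makes the
   Hilbert-type kernels [1 / (y + t)] satisfy Schur's test. *)
Definition theta (j : 'I_n) (t : R) : R := expR (2 * gam j * t) * t `^ (-1).

Lemma theta_powR j t a : theta j t `^ a = expR (2 * gam j * a * t) * t `^ (- a).
Proof.
rewrite /theta powRM ?expR_ge0 ?powR_ge0// expR_powR -powRrM mulN1r.
by congr (expR _ * _); ring.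
Qed.

Lemma theta_gt0 j t : 0 < t -> 0 < theta j t.
Proof. by move=> t0; rewrite mulr_gt0 ?expR_gt0 ?powR_gt0. Qed.

(** The factor [nzero v] is there because on the hyperplanes [tv] only reflects default values of
    [ln]. *)
Definition inU (v : Cm) : R := posind (tv v) * (nzero v)%:R.

Lemma inU_ge0 v : 0 <= inU v.
Proof. by rewrite mulr_ge0 ?posind_ge0. Qed.

Lemma measurable_inU : measurable_fun setT inU.
Proof.
apply: measurable_funM; last exact: measurable_nzero.
exact: (measurableT_comp measurable_posind (measurable_tv A)).
Qed.

Lemma inU_neq0 v : inU v != 0 -> nzero v /\ forall j, 0 < (tnth (tv v) j : R).
Proof.
rewrite /inU; have [nz|nz] := boolP (nzero v); last by rewrite mulr0 eqxx.
rewrite mulr1 => h; split=> // j; rewrite ltNge; apply/negP => tj; move: h.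
by rewrite posind0 ?eqxx// => /(_ j); rewrite ltNge tj.
Qed.

Lemma inU1 v : nzero v -> (forall j, 0 < (tnth (tv v) j : R)) -> inU v = 1.
Proof. by move=> nz h; rewrite /inU nz posindE// mulr1. Qed.

Lemma tv_csmul_unimodular (l : 'I_n -> R[i]) v : (forall k, cabs (l k) = 1) ->
  tv (csmul l v) = tv v.
Proof.
move=> l1; apply: eq_from_tnth => j; rewrite !tnth_mktuple; congr (- _).
by apply: eq_bigr => k _; rewrite /lnabs coord_csmul cabsM l1 mul1r.
Qed.

Lemma inU_csmul_unimodular (l : 'I_n -> R[i]) v : (forall k, cabs (l k) = 1) ->
  inU (csmul l v) = inU v.
Proof.
move=> l1; rewrite /inU tv_csmul_unimodular// nzero_csmul// => k.
by rewrite -cabs_eq0 l1 oner_eq0.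
Qed.

Lemma measurable_prod_theta a :
  measurable_fun setT (fun v : Cm => \prod_j theta j (tnth (tv v) j : R) `^ a).
Proof.
apply: measurable_prod => j _; under eq_fun do rewrite theta_powR.
apply: measurable_funM.
  apply: (measurableT_comp (@measurable_expR R)); apply: measurable_funM => //.
  exact: measurable_tnth_tv.
exact: (measurableT_comp (measurable_powR (- a)) (measurable_tnth_tv A j)).
Qed.

(** Integration over [w] uses [sg = 1/p], [al = 1], [be = p - 1], [by_ = beta r],
    [bt = (p - 1) beta r]; integration over [z] uses [1/q] and exchanges [al] with [be] and [by_]
    with [bt]. *)
Variables (sg al be : R) (bt by_ : 'I_n -> R).
Hypotheses (sg01 : 0 < sg < 1) (al0 : 0 < al) (be0 : 0 < be).
Hypothesis at0 : forall j, 0 < 2 * gam j * (1 - sg) + bt j.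
Hypothesis ay0 : forall j, 0 < by_ j + 2 * gam j * sg.

Definition rad_weight (y : 'I_n -> R) (v : Cm) : R :=
  inU v * (expR (- \sum_j (by_ j * y j + bt j * (tnth (tv v) j : R))) *
           \prod_j theta j (tnth (tv v) j : R) `^ sg).

Lemma rad_weight_ge0 y v : 0 <= rad_weight y v.
Proof.
rewrite !mulr_ge0 ?inU_ge0 ?expR_ge0// prodr_ge0// => j _; exact: powR_ge0.
Qed.

Lemma measurable_rad_weight y : measurable_fun setT (rad_weight y).
Proof.
apply: measurable_funM; first exact: measurable_inU.
apply: measurable_funM; last exact: measurable_prod_theta.
apply: (measurableT_comp (@measurable_expR R)); apply: measurable_funN.
apply: measurable_sum => j; apply: measurable_funD; first exact: measurable_cst.
by apply: measurable_funM => //; exact: measurable_tnth_tv.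
Qed.

Let inv1 (x : R) : R := (Num.max 0 (1 - expR (- x)))^-1.

Let inv1E x : 0 < x -> inv1 x = (1 - expR (- x))^-1.
Proof. by move=> x0; rewrite /inv1 max_r// subr_ge0 expR_le1 oppr_le0 ltW. Qed.

Let g (y : 'I_n -> R) (j : 'I_n) (t : MR) : R :=
  expR (- (by_ j * y j + bt j * t)) * theta j t `^ sg * inv1 (al * y j + be * t).

Let g_ge0 y j t : 0 <= g y j t.
Proof. by rewrite !mulr_ge0 ?expR_ge0 ?powR_ge0// invr_ge0 le_max lexx. Qed.

Let measurable_g y j : measurable_fun setT (g y j).
Proof.
have mlin (a b : R) : measurable_fun [set: MR] (fun t : MR => a + b * (t : R) : R).
  apply: measurable_funD; first exact: measurable_cst.
  by apply: measurable_funM => //; exact: measurable_MR.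
apply: measurable_funM; first apply: measurable_funM.
- apply: (measurableT_comp (@measurable_expR R)); apply: measurable_funN; exact: mlin.
- rewrite (_ : (fun _ => _) = fun t : MR => expR (2 * gam j * sg * (t : R)) * (t : R) `^ (- sg)).
    apply: measurable_funM; last exact: measurable_powRMR.
    apply: (measurableT_comp (@measurable_expR R)); apply: measurable_funM => //.
  by apply/funext => t; rewrite theta_powR.
- apply: measurable_inv => [t|]; first by rewrite le_max lexx.
  apply: measurable_maxr; first exact: measurable_cst.
  apply: measurable_funB; first exact: measurable_cst.
  apply: (measurableT_comp (@measurable_expR R)); apply: measurable_funN; exact: mlin.
Qed.

(** After the angular average the integrand is a product of functions of single [t_j], and each
    factor is an instance of [integral_schur_le] with [a = 2 gam_j (1 - sg) + bt j] and
    [b = by_ j + 2 gam_j sg]. The growth [exp (b y_j)] times the prefactor [exp (- by_ j y_j)] is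
    the exponential in [theta j (y j) ^ sg]. *)
Lemma one_sided_estimate : exists2 M : R, 0 <= M &
  forall (y : 'I_n -> R) (X : 'I_n -> Cm -> R[i]),
  (forall j, 0 < y j) -> (forall j, cmeas (X j)) ->
  (forall j v, nzero v -> cabs (X j v) = expR (- (al * y j + be * (tnth (tv v) j : R)))) ->
  (forall om : 'I_n -> R[i], (forall j, cabs (om j) = 1) ->
    exists2 l : 'I_n -> R[i], (forall k, cabs (l k) = 1) &
      forall v j, X j (csmul l v) = om j * X j v) ->
  (\int[V]_v (rad_weight y v * \prod_j (cabs (1 - X j v) ^+ 2)^-1)%:E <=
   (M * \prod_j theta j (y j) `^ sg)%:E)%E.
Proof.
have hM j := integral_schur_le (at0 j) (ay0 j) sg01 al0 be0.
pose M j := s2val (cid2 (hM j)).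
have M0 j : 0 <= M j := s2valP (cid2 (hM j)).
have MP j := s2valP' (cid2 (hM j)).
exists (kap * \prod_j M j); first by rewrite mulr_ge0 ?(ltW (kap_gt0 polA))// prodr_ge0.
move=> y X y0 mX absX rotX.
have absX_lt1 v j : rad_weight y v != 0 -> cabs (X j v) < 1.
  rewrite /rad_weight mulf_eq0 negb_or => /andP[/inU_neq0[nz tpos] _].
  by rewrite absX// expR_lt1 oppr_lt0 addr_gt0// mulr_gt0.
apply: le_trans (integral_angular_le (measurable_rad_weight y) (rad_weight_ge0 y) mX absX_lt1 _) _.
  move=> om om1; have [l l1 lX] := rotX om om1; exists l; first exact: l1.
  move=> v; split; last exact: lX.
  by rewrite /rad_weight (inU_csmul_unimodular v l1) (tv_csmul_unimodular v l1).
apply: (@le_trans _ _ (\int[V]_v (posind (tv v) * \prod_j g y j (tnth (tv v) j))%:E)%E).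
  apply: le_integral_nonmeasurable => v.
    have [->|rz] := eqVneq (rad_weight y v) 0; first by rewrite mul0r.
    rewrite lee_fin mulr_ge0 ?rad_weight_ge0// prodr_ge0// => j _.
    by rewrite invr_ge0 subr_ge0 ltW// absX_lt1.
  have G0 : 0 <= posind (tv v) * \prod_j g y j (tnth (tv v) j).
    by rewrite mulr_ge0 ?posind_ge0// prodr_ge0.
  rewrite lee_fin; have [->|rz] := eqVneq (rad_weight y v) 0; first by rewrite mul0r.
  move: (rz); rewrite {1}/rad_weight mulf_eq0 negb_or => /andP[/inU_neq0[nz tpos] _].
  rewrite /rad_weight inU1// posindE// !mul1r -sumrN expR_sum -!big_split/=.
  rewrite le_eqVlt; apply/orP; left; apply/eqP; apply: eq_bigr => j _.
  rewrite /g absX// inv1E//.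
  by rewrite addr_gt0// mulr_gt0.
rewrite (integral_polyhedron_prod polA)//.
rewrite -mulrA EFinM; apply: lee_wpmul2l; first by rewrite lee_fin (ltW (kap_gt0 polA)).
rewrite -big_split/=; apply: lee_prod_fin => j.
  apply: integral_ge0 => t _; rewrite lee_fin mulr_ge0// mulr_ge0 ?expR_ge0//.
pose h (t : MR) : R := (0 < (t : R))%R%:R * (expR (- ((2 * gam j * (1 - sg) + bt j) * t)) *
  ((t : R) `^ (- sg) * (1 - expR (- (al * y j + be * t)))^-1)).
have h0 t : 0 <= h t.
  rewrite /h; have [t0|t0] := ltP 0 (t : R); last by rewrite mul0r.
  rewrite mul1r !mulr_ge0 ?expR_ge0 ?powR_ge0// invr_ge0 subr_ge0 expR_le1 oppr_le0.
  by rewrite addr_ge0// mulr_ge0// ltW.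
have E t : (0 < (t : R))%R%:R * (expR (- (2 * gam j * t)) * g y j t) =
    expR (- (by_ j * y j)) * h t :> R.
  rewrite /h; have [t0|t0] := ltP 0 (t : R); last by rewrite !mul0r mulr0.
  rewrite !mul1r /g theta_powR inv1E ?addr_gt0 ?mulr_gt0//.
  rewrite !mulrA -!expRD; congr (expR _ * _ * _); ring.
have mh : measurable_fun setT h.
  rewrite (_ : h = fun t => expR (by_ j * y j) *
      ((0 < (t : R))%R%:R * (expR (- (2 * gam j * t)) * g y j t))).
    apply: measurable_funM => //; apply: measurable_funM; first exact: measurable_posb.
    by apply: measurable_funM => //; apply: measurable_expR_lin; exact: measurable_MR.
  by apply/funext => t; rewrite E mulrA -expRD subrr expR0 mul1r.
under eq_integral => t _ do rewrite E EFinM.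
have mhE : measurable_fun setT (EFin \o h) by exact/measurable_EFinP.
rewrite ge0_integralZl//; last by move=> t _; rewrite lee_fin.
apply: (@le_trans _ _ ((expR (- (by_ j * y j)))%:E *
    (M j * (y j `^ (- sg) * expR ((by_ j + 2 * gam j * sg) * y j)))%:E)%E).
  by apply: lee_wpmul2l; [rewrite lee_fin expR_ge0|exact: MP].
rewrite -EFinM lee_fin theta_powR le_eqVlt; apply/orP; left; apply/eqP.
rewrite mulrCA; congr (_ * _); rewrite mulrCA mulrC -expRD; congr (expR _ * _); ring.
Qed.

End one_sided_estimate.

(** * A measurable majorant of the kernel and its Schur conditions *)

Section majorant_kernel.
Context {R : realType} {n : nat} (A : 'M[int]_n) (p : R).
Hypothesis polA : monomial_polyhedron R A.
Hypothesis p1 : 1 < p.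
Local Notation Cm := (@Cm R n).
Local Notation V := (volC n).
Local Notation tv := (@tv R n A).
Local Notation gam := (@gam R n A).
Local Notation kap := (@kap R n A).
Local Notation inU := (@inU R n A).
Local Notation beta := (@beta R n A).
Local Notation cexp := (@cexp R n A p).
Local Notation kerX := (@kerX R n A p).
Local Notation theta := (@theta R n A).
Local Notation reps := (reps polA p1).
Local Notation minimal_rep := (@minimal_rep R n A p).

Let p0 : 0 < p := lt_trans ltr01 p1.
Let q : R := p / (p - 1).
Let pm0 : 0 < p - 1. Proof. by rewrite subr_gt0. Qed.
Let q0 : 0 < q. Proof. exact: divr_gt0. Qed.
Let qE : q^-1 = 1 - p^-1.
Proof. by rewrite /q invf_div mulrBl mul1r divff// gt_eqF. Qed.
Let pq : p^-1 + q^-1 = 1. Proof. by rewrite qE addrCA subrr addr0. Qed.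

(** The factor 2 is that of [mbk_le], where real and imaginary parts are bounded separately. *)
Definition kerD (r : 'rV[int]_n) : R := 2 * (kap^-1 * \prod_j kercst A p r j).

Definition kerT (r : 'rV[int]_n) (z w : Cm) : R :=
  expR (- \sum_j (beta r j * (tnth (tv z) j : R) + (p - 1) * beta r j * (tnth (tv w) j : R))) *
  \prod_j (cabs (1 - kerX j z w) ^+ 2)^-1.

(** This replaces the absolute value of the kernel in all integrals: it dominates it on the
    polyhedron off the hyperplanes, and is visibly measurable. *)
Definition kerK (x : Cm * Cm) : R :=
  inU x.1 * inU x.2 * \sum_(r <- reps) kerD r * kerT r x.1 x.2.

Definition inUb (z : Cm) : bool := inU z != 0.

Lemma inUbE z : (inUb z)%:R = inU z.
Proof.
rewrite /inUb; case: eqP => [->//|/eqP /inU_neq0[nz tz]].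
by rewrite inU1.
Qed.

Lemma inUbP z : inUb z -> nzero z /\ forall j, 0 < (tnth (tv z) j : R).
Proof. exact: inU_neq0. Qed.

Lemma kerD_ge0 r : minimal_rep r -> 0 <= kerD r.
Proof.
move=> hr; rewrite mulr_ge0// mulr_ge0 ?invr_ge0 ?(ltW (kap_gt0 polA))// prodr_ge0// => j _.
rewrite /kercst addr_ge0// addr_ge0 ?(ltW p0)// mulr_ge0// ltW//.
exact: (minimal_rep_cexp_gt0 j hr).
Qed.

Lemma kerT_ge0 r z w : 0 <= kerT r z w.
Proof.
by rewrite mulr_ge0 ?expR_ge0// prodr_ge0// => j _; rewrite invr_ge0 sqr_ge0.
Qed.

Lemma kerK_ge0 x : 0 <= kerK x.
Proof.
apply: mulr_ge0; first by rewrite mulr_ge0 ?inU_ge0.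
rewrite big_seq; apply: sumr_ge0 => r /(mem_reps polA p1) hr.
by rewrite mulr_ge0 ?kerT_ge0// kerD_ge0.
Qed.

Lemma kerK_out z w : ~~ (inUb z && inUb w) -> kerK (z, w) = 0.
Proof.
rewrite negb_and /inUb !negbK /kerK/= => /orP[]/eqP ->; first by rewrite !mul0r.
by rewrite mulr0 mul0r.
Qed.

Lemma cmeas_zeta j : cmeas (fun z : Cm => zeta A j z).
Proof. exact: cmeas_mono. Qed.

Lemma cmeas_kerX d (T : measurableType d) (F G : T -> Cm) j :
  measurable_fun setT F -> measurable_fun setT G -> cmeas (fun x => kerX j (F x) (G x)).
Proof.
move=> mF mG; apply: cmeasM; first apply: cmeasM.
- exact: (cmeas_comp (cmeas_zeta j) mF).
- by apply: cmeas_conj; exact: (cmeas_comp (cmeas_zeta j) mG).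
- apply: cmeas_real; apply: (measurableT_comp (measurable_powR (p - 2))).
  by apply: measurable_cabs; exact: (cmeas_comp (cmeas_zeta j) mG).
Qed.

Lemma measurable_kerT d (T : measurableType d) (F G : T -> Cm) r :
  measurable_fun setT F -> measurable_fun setT G ->
  measurable_fun setT (fun x => kerT r (F x) (G x)).
Proof.
move=> mF mG.
have mt j (H : T -> Cm) : measurable_fun setT H -> measurable_fun setT (fun x => tnth (tv (H x)) j : R).
  by move=> mH; exact: (measurableT_comp (measurable_tnth_tv A j) mH).
apply: measurable_funM.
  apply: (measurableT_comp (@measurable_expR R)); apply: measurable_funN.
  apply: measurable_sum => j; apply: measurable_funD; apply: measurable_funM => //; exact: mt.
apply: measurable_prod => j _; apply: measurable_inv => [x|]; first exact: sqr_ge0.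
apply: measurable_funX; apply: measurable_cabs; apply: cmeasD; first exact: cmeas_cst.
by apply: cmeasN; exact: cmeas_kerX.
Qed.

Lemma measurable_kerK : measurable_fun setT kerK.
Proof.
apply: measurable_funM.
  apply: measurable_funM.
    exact: (measurableT_comp (measurable_inU A) measurable_fst).
  exact: (measurableT_comp (measurable_inU A) measurable_snd).
apply: measurable_sum => r; apply: measurable_funM => //.
by apply: measurable_kerT; [exact: measurable_fst|exact: measurable_snd].
Qed.

Lemma mbk_le_kerK z w : inUb z -> inUb w ->
  cabs (@mbk R n p (@mpoly_set R n A) z w) <= kerK (z, w).
Proof.
move=> /inUbP[nz tz] /inUbP[nw tw].
apply: (le_trans (mbk_le polA p1 nz nw tz tw)).
rewrite /kerK /kerG /= (inU1 nz tz) (inU1 nw tw) !mul1r mulrA mulr_sumr.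
rewrite le_eqVlt; apply/orP; left; apply/eqP; apply: eq_bigr => r _.
rewrite (cabs_kerE p polA r nz nw) /kerT /kerD.
rewrite [\prod_j (kercst _ _ _ _ / _)]big_split/=.
by move: (expR _) (\prod_j kercst A p r j) (\prod_j _) => a b c; ring.
Qed.

Definition thetaV (z : Cm) : R := \prod_j theta j (tnth (tv z) j : R).

Lemma thetaV_powR z a : thetaV z `^ a = \prod_j theta j (tnth (tv z) j : R) `^ a.
Proof. by rewrite /thetaV prod_powR// => j; rewrite mulr_ge0 ?expR_ge0 ?powR_ge0. Qed.

Lemma thetaV_gt0 z : inUb z -> 0 < thetaV z.
Proof. by move=> /inUbP[_ tz]; apply: prodr_gt0 => j _; exact: theta_gt0. Qed.

Lemma measurable_thetaV : measurable_fun setT thetaV.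
Proof.
have := measurable_prod_theta A 1 (R := R) (n := n).
rewrite (_ : (fun _ => _) = thetaV)//; apply/funext => z; apply: eq_bigr => j _.
by rewrite powRr1// mulr_ge0 ?expR_ge0 ?powR_ge0.
Qed.

Lemma zeta_csmul (l : 'I_n -> R[i]) v j :
  zeta A j (csmul l v) = \prod_k l k ^ A j k * zeta A j v.
Proof.
rewrite /zeta /mono -big_split/=; apply: eq_bigr => k _.
by rewrite coord_csmul expfzMl mxE.
Qed.

Lemma kerX_csmul_l (l : 'I_n -> R[i]) z w j :
  kerX j (csmul l z) w = \prod_k l k ^ A j k * kerX j z w.
Proof. by rewrite /kerX zeta_csmul; move: (zeta A j z) => u; rewrite !mulrA. Qed.

Lemma kerX_csmul_r (l : 'I_n -> R[i]) z w j : cabs (\prod_k l k ^ A j k) = 1 ->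
  kerX j z (csmul l w) = (\prod_k l k ^ A j k)^* * kerX j z w.
Proof.
rewrite /kerX zeta_csmul; move: (\prod_k _) (zeta A j w) (zeta A j z) => u v a u1.
by rewrite rmorphM/= cabsM u1 mul1r !mulrA [a * u^*]mulrC.
Qed.

Let detA : \det A != 0 := proj1 polA.

Lemma schur_sum (s : seq 'rV[int]_n) (F : 'rV[int]_n -> Cm -> R) (D M : 'rV[int]_n -> R) (c : R) :
  (forall r, r \in s -> 0 <= D r) -> (forall r v, 0 <= F r v) ->
  (forall r, measurable_fun setT (F r)) ->
  (forall r, r \in s -> (\int[V]_v (F r v)%:E <= (M r * c)%:E)%E) ->
  (\int[V]_v (\sum_(r <- s) D r * F r v)%:E <= ((\sum_(r <- s) D r * M r) * c)%:E)%E.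
Proof.
elim: s => [|r s IH] D0 F0 mF FM.
  under eq_integral do rewrite big_nil.
  by rewrite integral0 big_nil mul0r.
have Dr : 0 <= D r by apply: D0; rewrite inE eqxx.
have D0' i : i \in s -> 0 <= D i by move=> hi; apply: D0; rewrite inE hi orbT.
under eq_integral do rewrite big_cons EFinD EFinM.
have mFr : measurable_fun setT (EFin \o F r) by exact/measurable_EFinP.
rewrite ge0_integralD//.
- rewrite big_cons mulrDl EFinD; apply: leeD.
    rewrite ge0_integralZl//; last by move=> v _; rewrite lee_fin.
    by rewrite -mulrA EFinM; apply: lee_wpmul2l => //; apply: FM; rewrite inE eqxx.
  by apply: IH => // i hi; apply: FM; rewrite inE hi orbT.
- by move=> v _; rewrite -EFinM lee_fin mulr_ge0.
- exact: emeasurable_funM.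
- by move=> v _; rewrite lee_fin big_seq sumr_ge0// => i hi; rewrite mulr_ge0// D0'.
- apply/measurable_EFinP; apply: measurable_sum => i; exact: measurable_funM.
Qed.

Lemma schur_left : exists2 M : R, 0 <= M & forall z, inUb z ->
  (\int[V]_w (kerK (z, w) * thetaV w `^ p^-1)%:E <= (M * thetaV z `^ p^-1)%:E)%E.
Proof.
have sg01 : 0 < p^-1 < 1 by rewrite invr_gt0 p0 invf_lt1.
(* The condition on [r] is placed under the constant so that a constant can be chosen for every
   [r]. *)
have one r : exists2 M : R, 0 <= M & minimal_rep r -> forall z, inUb z ->
    (\int[V]_w (inU w * (kerT r z w * thetaV w `^ p^-1))%:E <= (M * thetaV z `^ p^-1)%:E)%E.
  have [hr|hr] := pselect (minimal_rep r); last by exists 0.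
  have c0 j : 0 < cexp r j := minimal_rep_cexp_gt0 j hr.
  (* This rate and the next are [cexp r j / q] and [cexp r j / p], so their positivity is the
     integrability of [e_r]. *)
  have at0 j : 0 < 2 * gam j * (1 - p^-1) + (p - 1) * beta r j.
    rewrite (_ : _ + _ = q^-1 * cexp r j) ?mulr_gt0 ?invr_gt0//.
    by rewrite qE -[cexp r j]/(p * beta r j + 2 * gam j); field; rewrite gt_eqF.
  have ay0 j : 0 < beta r j + 2 * gam j * p^-1.
    rewrite (_ : _ + _ = p^-1 * cexp r j) ?mulr_gt0 ?invr_gt0//.
    by rewrite -[cexp r j]/(p * beta r j + 2 * gam j); field; rewrite gt_eqF.
  have [M M0 hM] := one_sided_estimate polA sg01 ltr01 pm0 at0 ay0.
  exists M; first exact: M0.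
  move=> _ z /inUbP[nz tz].
  rewrite [X in (_ <= (M * X)%:E)%E](thetaV_powR z p^-1).
  have := hM (fun j => tnth (tv z) j) (fun j w => kerX j z w) tz.
  move=> /(_ _ _ _)/wrap[| | |le].
  - by move=> j; apply: cmeas_kerX; [exact: measurable_cst|exact: measurable_id].
  - by move=> j w nw; rewrite (cabs_kerX A p _ nz nw) mul1r.
  (* Rotating [w] multiplies [kerX] by the conjugate phase, so conjugate phases are prescribed. *)
  - move=> om om1; have [l l1 hl] := @torus_onto R n A (fun j => (om j)^*) detA
      (fun j => etrans (cabs_conj (om j)) (om1 j)).
    exists l => // w j; rewrite kerX_csmul_r hl ?cabs_conj// conjCK.
    by [].
  - apply: le_trans le; rewrite le_eqVlt; apply/orP; left; apply/eqP.
    apply: eq_integral => w _; congr EFin; rewrite /rad_weight /kerT thetaV_powR.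
    by move: (inU w) (expR _) (\prod_j _) (\prod_j _) => a b c e; ring.
pose M r := s2val (cid2 (one r)).
have M0 r : 0 <= M r := s2valP (cid2 (one r)).
have MP r := s2valP' (cid2 (one r)).
exists (\sum_(r <- reps) kerD r * M r).
  rewrite big_seq sumr_ge0// => r /(mem_reps polA p1) hr.
  by rewrite mulr_ge0 ?kerD_ge0.
move=> z zU.
rewrite (_ : (fun w => _) = fun w => (\sum_(r <- reps) kerD r *
    (inU w * (kerT r z w * thetaV w `^ p^-1)))%:E); last first.
  apply/funext => w; congr EFin; rewrite /kerK/= -(inUbE z) zU mul1r mulr_sumr mulr_suml.
  by apply: eq_bigr => r _; rewrite mulrCA -!mulrA.
apply: schur_sum.
- by move=> r /(mem_reps polA p1); exact: kerD_ge0.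
- by move=> r w; apply: mulr_ge0 (inU_ge0 _ _) (mulr_ge0 (kerT_ge0 _ _ _) (powR_ge0 _ _)).
- move=> r; apply: measurable_funM; first exact: measurable_inU.
  apply: measurable_funM; first by apply: measurable_kerT; [exact: measurable_cst|exact: measurable_id].
  exact: (measurableT_comp (measurable_powR p^-1) measurable_thetaV).
- by move=> r /(mem_reps polA p1) hr; exact: MP.
Qed.

Lemma schur_right : exists2 M : R, 0 <= M & forall w, inUb w ->
  (\int[V]_z (kerK (z, w) * thetaV z `^ q^-1)%:E <= (M * thetaV w `^ q^-1)%:E)%E.
Proof.
have sg01 : 0 < q^-1 < 1.
  by rewrite invr_gt0 q0 qE/= ltrBlDr ltrDl invr_gt0.
have one r : exists2 M : R, 0 <= M & minimal_rep r -> forall w, inUb w ->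
    (\int[V]_z (inU z * (kerT r z w * thetaV z `^ q^-1))%:E <= (M * thetaV w `^ q^-1)%:E)%E.
  have [hr|hr] := pselect (minimal_rep r); last by exists 0.
  have c0 j : 0 < cexp r j := minimal_rep_cexp_gt0 j hr.
  (* Now the two rates are [cexp r j / p] and [cexp r j / q], in the opposite order. *)
  have at0 j : 0 < 2 * gam j * (1 - q^-1) + beta r j.
    rewrite (_ : _ + _ = p^-1 * cexp r j) ?mulr_gt0 ?invr_gt0//.
    by rewrite qE -[cexp r j]/(p * beta r j + 2 * gam j); field; rewrite gt_eqF.
  have ay0 j : 0 < (p - 1) * beta r j + 2 * gam j * q^-1.
    rewrite (_ : _ + _ = q^-1 * cexp r j) ?mulr_gt0 ?invr_gt0//.
    by rewrite qE -[cexp r j]/(p * beta r j + 2 * gam j); field; rewrite gt_eqF.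
  have [M M0 hM] := one_sided_estimate polA sg01 pm0 ltr01 at0 ay0.
  exists M; first exact: M0.
  move=> _ w /inUbP[nw tw].
  rewrite [X in (_ <= (M * X)%:E)%E](thetaV_powR w q^-1).
  have := hM (fun j => tnth (tv w) j) (fun j z => kerX j z w) tw.
  move=> /(_ _ _ _)/wrap[| | |le].
  - by move=> j; apply: cmeas_kerX; [exact: measurable_id|exact: measurable_cst].
  - by move=> j z nz; rewrite (cabs_kerX A p _ nz nw) mul1r addrC.
  - move=> om om1; have [l l1 hl] := @torus_onto R n A om detA om1.
    by exists l => // z j; rewrite kerX_csmul_l hl.
  - apply: le_trans le; rewrite le_eqVlt; apply/orP; left; apply/eqP.
    apply: eq_integral => z _; congr EFin; rewrite /rad_weight /kerT thetaV_powR.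
    rewrite [X in expR (- X)](_ : _ = \sum_j ((p - 1) * beta r j * (tnth (tv w) j : R) +
        beta r j * (tnth (tv z) j : R))); last by apply: eq_bigr => j _; rewrite addrC.
    by move: (inU z) (expR _) (\prod_j _) (\prod_j _) => a b c e; ring.
pose M r := s2val (cid2 (one r)).
have M0 r : 0 <= M r := s2valP (cid2 (one r)).
have MP r := s2valP' (cid2 (one r)).
exists (\sum_(r <- reps) kerD r * M r).
  rewrite big_seq sumr_ge0// => r /(mem_reps polA p1) hr.
  by rewrite mulr_ge0 ?kerD_ge0.
move=> w wU.
rewrite (_ : (fun z => _) = fun z => (\sum_(r <- reps) kerD r *
    (inU z * (kerT r z w * thetaV z `^ q^-1)))%:E); last first.
  apply/funext => z; congr EFin; rewrite /kerK/= -(inUbE w) wU mulr1 mulr_sumr mulr_suml.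
  by apply: eq_bigr => r _; rewrite mulrCA -!mulrA.
apply: schur_sum.
- by move=> r /(mem_reps polA p1); exact: kerD_ge0.
- by move=> r z; apply: mulr_ge0 (inU_ge0 _ _) (mulr_ge0 (kerT_ge0 _ _ _) (powR_ge0 _ _)).
- move=> r; apply: measurable_funM; first exact: measurable_inU.
  apply: measurable_funM; first by apply: measurable_kerT; [exact: measurable_id|exact: measurable_cst].
  exact: (measurableT_comp (measurable_powR q^-1) measurable_thetaV).
- by move=> r /(mem_reps polA p1) hr; exact: MP.
Qed.

Lemma kerK_bounded : exists2 M : R, 0 <= M &
  forall f : Cm -> R, measurable_fun setT f -> (forall w, 0 <= f w) ->
  (\int[V]_z ((\int[V]_w (kerK (z, w) * f w)%:E) `^ p) <=
   (M `^ p)%:E * \int[V]_w ((inUb w)%:R * f w `^ p)%:E)%E.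
Proof.
have [Ml Ml0 hl] := schur_left; have [Mr Mr0 hr] := schur_right.
(* The sum serves as one constant for both Schur conditions. *)
exists (Ml + Mr); first exact: addr_ge0.
apply: (schur_test p0 q0 pq (addr_ge0 Ml0 Mr0) _ measurable_kerK measurable_thetaV
  kerK_ge0 kerK_out thetaV_gt0).
- by under eq_fun do rewrite inUbE; exact: measurable_inU.
- move=> z zU; apply: (le_trans (hl z zU)); rewrite lee_fin.
  by rewrite ler_wpM2r ?powR_ge0// lerDl.
- move=> w wU; apply: (le_trans (hr w wU)); rewrite lee_fin.
  by rewrite ler_wpM2r ?powR_ge0// lerDr.
Qed.

End majorant_kernel.

(** * Boundedness of the operator with the absolute value of the kernel *)

Lemma if_lee (R : realType) (b : bool) (x y : \bar R) :
  (b -> x <= y)%E -> (0 <= y)%E -> ((if b then x else 0) <= y)%E.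
Proof. by case: b => // /(_ isT). Qed.

Theorem theorem1p2 (R : realType) (n : nat) (p : R) (A : 'M[int]_n) :
  1 < p -> monomial_polyhedron R A ->
  exists C : R, 0 <= C /\
    forall f : Cn R n -> R[i],
      measurable_fun setT (fun z => complex.Re (f z)) ->
      measurable_fun setT (fun z => complex.Im (f z)) ->
      (intOn (mpoly_set A) (fun w => ((cabs (f w)) `^ p)%:E) < +oo)%E ->
      (intOn (mpoly_set A)
         (fun z => (intOn (mpoly_set A)
                      (fun w => (cabs (mbk p (mpoly_set A) z w) * cabs (f w))%:E))
                   `^ p)
       <= (C `^ p)%:E * intOn (mpoly_set A) (fun w => ((cabs (f w)) `^ p)%:E))%E.
Proof.
move=> p1 polA; have [M M0 hM] := kerK_bounded polA p1.
exists M; split=> // f mRe mIm _.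
have mf : measurable_fun [set: @Cm R n] (fun w : @Cm R n => cabs (f w)).
  by apply: measurable_cabs; split; [exact: mRe|exact: mIm].
have inUbU (z : @Cm R n) : nzero z -> @inUb R n A z = `[< @mpoly_set R n A z >].
  move=> nz; apply/idP/asboolP => [/inUbP[_ tz]|/(mpoly_nzero _ nz) tz].
    exact/(mpoly_nzero _ nz).
  by rewrite /inUb (inU1 nz tz) oner_eq0.
have K0 := kerK_ge0 polA p1.
have mKf : measurable_fun [set: @Cm R n * @Cm R n]
    (fun x => (kerK polA p1 x * cabs (f x.2))%:E).
  apply/measurable_EFinP; apply: measurable_funM; first exact: measurable_kerK.
  exact: (measurableT_comp mf measurable_snd).
have mSf : measurable_fun [set: @Cm R n] (fun w => (((inUb A w)%:R : R) * cabs (f w) `^ p)%:E).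
  apply/measurable_EFinP; apply: measurable_funM.
    by under eq_fun do rewrite inUbE; exact: measurable_inU.
  exact: (measurableT_comp (measurable_powR p) mf).
(* The right side becomes an honest integral of a measurable function. The left side is only bounded
   above, first in [z] and then in [w], by replacing the kernel with [kerK] off the hyperplanes. *)
rewrite {2}/intOn [X in (_ <= _ * X)%E](intCnE_nzero (g := fun w => ((inUb A w)%:R * cabs (f w) `^ p)%:E))//.
- apply: (le_trans _ (hM (fun w => cabs (f w)) mf (fun w => cabs_ge0 _))).
  apply: intCn_le_nzero.
  + by move=> z; case: ifP => // _; exact: poweR_ge0.
  + apply: (measurableT_comp (measurable_poweR p)).
    apply: (@measurable_fun_fubini_tonelli_F _ _ _ _ _ (volC n) _ mKf) => x.
    by rewrite lee_fin mulr_ge0 ?cabs_ge0.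
  + by move=> z; exact: poweR_ge0.
  + move=> z nz.
    apply: if_lee => [/asboolP zU|]; last exact: poweR_ge0.
    have zUb : inUb A z.
      rewrite (inUbU z nz).
      exact/asboolP.
    apply: gt0_ler_poweR; first by rewrite ltW// (lt_trans ltr01).
    * rewrite in_itv/= leey andbT; apply: intCn_ge0 => w; case: ifP => // _.
      by rewrite lee_fin mulr_ge0 ?cabs_ge0.
    * rewrite in_itv/= leey andbT; apply: integral_ge0 => w _.
      by rewrite lee_fin mulr_ge0 ?cabs_ge0.
    apply: intCn_le_nzero.
    * by move=> w; case: ifP => // _; rewrite lee_fin mulr_ge0 ?cabs_ge0.
    * by apply: (measurableT_comp mKf); exact: pair1_measurable.
    * by move=> w; rewrite lee_fin mulr_ge0 ?cabs_ge0.
    * move=> w nw; apply: if_lee => [/asboolP wU|]; last by rewrite lee_fin mulr_ge0 ?cabs_ge0.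
      rewrite lee_fin ler_wpM2r ?cabs_ge0//; apply: mbk_le_kerK => //.
      by rewrite inUbU//; exact/asboolP.
- by move=> z; case: ifP => // _; rewrite lee_fin powR_ge0.
- by move=> z; rewrite lee_fin mulr_ge0 ?powR_ge0.
- by move=> z nz; rewrite inUbU//; case: asboolP => _; rewrite ?mul1r ?mul0r.
Qed.
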